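(* Let $k\ge 1$ and let $(\mathbf u_h,\mathbf B_h,p_h,r_h)\in \mathbf V_h^0\times\mathbf W_h^0\times Q_h^0\times R_h^0$, with $\mathbf u_h=\{\mathbf u_{ho},\mathbf u_{hb}\}$ and $\mathbf B_h=\{\mathbf B_{ho},\mathbf B_{hb}\}$, be a solution of the weak Galerkin scheme (WG) described in the context. Then the velocity and magnetic field approximations are globally divergence-free, in the sense that $$\mathbf u_{ho}\in \mathbf H(\mathrm{div},\Omega),\quad \nabla\cdot\mathbf u_{ho}=0,\qquad\text{and}\qquad \mathbf B_{ho}\in \mathbf H(\mathrm{div},\Omega),\quad \nabla\cdot\mathbf B_{ho}=0 .$$
   Context: **Setting.** $\Omega\subset\mathbb R^d$ ($d=2,3$) is a polygonal/polyhedral domain; $H_a,N,R_m>0$ are constants; $\mathbf f,\mathbf g\in[L^2(\Omega)]^d$. $\mathcal T_h$ is a shape regular partition of $\Omega$ into closed simplexes, $\varepsilon_h$ the set of all edges ($d=2$) or faces ($d=3$) of the elements, $h_K$ the diameter of $K\in\mathcal T_h$, $\mathbf n=\mathbf n_K$ the outward unit normal on $\partial K$. $\mathcal P_m(D)$ is the set of polynomials of degree $\le m$ on $D$. $(\cdot,\cdot)_K$, $\langle\cdot,\cdot\rangle_{\partial K}$ are $L^2$ inner products, $(\cdot,\cdot)$ is the $L^2(\Omega)$ inner product, $\langle u,v\rangle_{\partial\mathcal T_h}=\sum_{K}\langle u,v\rangle_{\partial K}$. $L^2_0(\Omega)$: functions in $L^2(\Omega)$ with zero mean. $\mathbf H(\mathrm{div},\Omega)=\{\mathbf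 v\in L^2(\Omega)^d:\nabla\cdot\mathbf v\in L^2(\Omega)\}$. For $d=2$: $\mathbf v\times\mathbf w=v_1w_2-v_2w_1$, $\nabla\times\mathbf v=\partial_1v_2-\partial_2v_1$ for vectors, $\nabla\times\phi=(\partial_2\phi,-\partial_1\phi)^T$ for scalars; for $d=3$ the usual cross product and curl. **Discrete weak operators** (elementwise, integer $m\ge0$). For $v=\{v_o,v_b\}$ ($v_o$ on $K$, $v_b$ on $\partial K$), $\nabla_{w,m}v|_K\in[\mathcal P_m(K)]^d$ is defined by $(\nabla_{w,m}v,\boldsymbol\phi)_K=-(v_o,\nabla\cdot\boldsymbol\phi)_K+\langle v_b,\boldsymbol\phi\cdot\mathbf n\rangle_{\partial K}$ for all $\boldsymbol\phi\in[\mathcal P_m(K)]^d$ (componentwise for vectors $\mathbf v$). For $\mathbf w=\{\mathbf w_o,\mathbf w_b\}$, $\nabla_{w,m}\cdot\mathbf w|_K\in\mathcal P_m(K)$ is defined by $(\nabla_{w,m}\cdot\mathbf w,\phi)_K=-(\mathbf w_o,\nabla\phi)_K+\langle\mathbf w_b\cdot\mathbf n,\phi\rangle_{\partial K}$ for all $\phi\in\mathcal P_m(K)$, and $\nabla_{w,m}\times\mathbf w|_K\in[\mathcal P_m(K)]^{2d-3}$ by $(\nabla_{w,m}\times\mathbf w,\phi)_K=(\mathbf w_o,\nabla\times\phi)_K-\langle\mathbf w_b\times\mathbf n,\phi\rangle_{\partial K}$ for all $\phi\in[\mathcal P_m(K)]^{2d-3}$. **Spaces** ($k\ge1$). $\mathbf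 V_h=\{\{\mathbf v_{ho},\mathbf v_{hb}\}:\mathbf v_{ho}|_K\in[\mathcal P_k(K)]^d,\ \mathbf v_{hb}|_e\in[\mathcal P_k(e)]^d,\ \forall K\in\mathcal T_h,e\in\varepsilon_h\}$; $\mathbf V_h^0=\{\mathbf v_h\in\mathbf V_h:\mathbf v_{hb}|_{\partial\Omega}=0\}$; $\mathbf W_h^0=\{\mathbf w_h\in\mathbf V_h:\mathbf w_{hb}\times\mathbf n|_{\partial\Omega}=0\}$; $Q_h=\{\{q_{ho},q_{hb}\}:q_{ho}|_K\in\mathcal P_{k-1}(K),\ q_{hb}|_e\in\mathcal P_k(e)\}$; $Q_h^0=\{q_h\in Q_h:q_{ho}\in L_0^2(\Omega)\}$; $R_h^0=\{\theta_h\in Q_h:\theta_{hb}|_{\partial\Omega}=0\}$. **Forms** ($\tau|_{\partial K}=h_K^{-1}$). $a_h(\mathbf u_h,\mathbf v_h)=\frac1{H_a^2}(\nabla_{w,k-1}\mathbf u_h,\nabla_{w,k-1}\mathbf v_h)+\frac1{H_a^2}\langle\tau(\mathbf u_{ho}-\mathbf u_{hb}),\mathbf v_{ho}-\mathbf v_{hb}\rangle_{\partial\mathcal T_h}$; $\tilde a_h(\mathbf B_h,\mathbf w_h)=\frac1{R_m^2}(\nabla_{w,k-1}\times\mathbf B_h,\nabla_{w,k-1}\times\mathbf w_h)+\frac1{R_m^2}\langle\tau(\mathbf B_{ho}-\mathbf B_{hb})\times\mathbf n,(\mathbf w_{ho}-\mathbf w_{hb})\times\mathbf n\rangle_{\partial\mathcal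 T_h}$; $b_h(\mathbf v_h,q_h)=(\nabla_{w,k}q_h,\mathbf v_{ho})$; $\tilde b_h(\mathbf w_h,\theta_h)=\frac1{R_m}(\nabla_{w,k}\theta_h,\mathbf w_{ho})$; $c_h(\Phi_h;\mathbf u_h,\mathbf v_h)=\frac1{2N}\big[(\nabla_{w,k}\cdot\{\mathbf u_{ho}\otimes\Phi_{ho},\mathbf u_{hb}\otimes\Phi_{hb}\},\mathbf v_{ho})-(\nabla_{w,k}\cdot\{\mathbf v_{ho}\otimes\Phi_{ho},\mathbf v_{hb}\otimes\Phi_{hb}\},\mathbf u_{ho})\big]$, where the $i$-th component of $\nabla_{w,k}\cdot\{\mathbf u_{ho}\otimes\Phi_{ho},\mathbf u_{hb}\otimes\Phi_{hb}\}$ is $\nabla_{w,k}\cdot\{u_{ho,i}\Phi_{ho},u_{hb,i}\Phi_{hb}\}$; $\tilde c_h(\mathbf v_h;\mathbf B_h,\mathbf w_h)=\frac1{R_m}(\nabla_{w,k}\times\mathbf w_h,\mathbf v_{ho}\times\mathbf B_{ho})$. **Scheme (WG).** Find $(\mathbf u_h,\mathbf B_h,p_h,r_h)\in\mathbf V_h^0\times\mathbf W_h^0\times Q_h^0\times R_h^0$ such that for all $(\mathbf v_h,\mathbf w_h,q_h,\theta_h)\in\mathbf V_h^0\times\mathbf W_h^0\times Q_h^0\times R_h^0$ $$a_h(\mathbf u_h,\mathbf v_h)+\tilde a_h(\mathbf B_h,\mathbf w_h)+b_h(\mathbf v_h,p_h)-b_h(\mathbf u_h,q_h)+\tilde b_h(\mathbf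 w_h,r_h)-\tilde b_h(\mathbf B_h,\theta_h)+c_h(\mathbf u_h;\mathbf u_h,\mathbf v_h)+\tilde c_h(\mathbf v_h;\mathbf B_h,\mathbf B_h)-\tilde c_h(\mathbf u_h;\mathbf B_h,\mathbf w_h)=(\mathbf f,\mathbf v_{ho})+\tfrac1{R_m}(\mathbf g,\mathbf w_{ho}).$$ *)

(* Defs.v *)
From HB Require Import structures.
From mathcomp Require Import all_boot all_order all_algebra.
From mathcomp Require Import all_classical all_reals all_analysis.
Set Implicit Arguments.
Unset Strict Implicit.
Unset Printing Implicit Defensive.
Import Order.TTheory GRing.Theory Num.Theory.
Import numFieldNormedType.Exports.
Local Open Scope classical_set_scope.
Local Open Scope ring_scope.

Section lebesgue_cons.
Context (R : realType) (n : nat).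
Local Notation T := (measurableTypeR R).
Let leb1 : {sigma_finite_measure set T -> \bar R} := @lebesgue_measure R.
Variable mu : {sigma_finite_measure set (n.-tuple T) -> \bar R}.

Definition tcons (x : T * n.-tuple T) : n.+1.-tuple T := [tuple of x.1 :: x.2].

Lemma measurable_tcons : measurable_fun [set: T * n.-tuple T] tcons.
Proof. exact: (measurable_cons measurable_fst measurable_snd). Qed.


(* image of [lebesgue_measure \x mu] under (x, t) |-> x :: t *)
Definition consmeas := pushforward (leb1 \x mu)%E tcons.

Let consmeas0 : consmeas set0 = 0%E.
Proof. by rewrite /consmeas /pushforward preimage_set0 measure0. Qed.

Let consmeas_ge0 A : (0 <= consmeas A)%E.
Proof. by rewrite /consmeas /pushforward measure_ge0. Qed.

Let consmeas_sigma_additive : semi_sigma_additive consmeas.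
Proof.
move=> F mF tF mUF; rewrite /consmeas /pushforward preimage_bigcup.
apply: measure_semi_sigma_additive.
- by move=> i; rewrite -[X in measurable X]setTI; exact: measurable_tcons.
- apply/trivIsetP => /= i j _ _ ij; rewrite -preimage_setI.
  by move/trivIsetP : tF => /(_ _ _ _ _ ij) ->//; rewrite preimage_set0.
- rewrite -preimage_bigcup -[X in measurable X]setTI.
  exact: measurable_tcons.
Qed.

HB.instance Definition _ := isMeasure.Build _ _ _
  consmeas consmeas0 consmeas_ge0 consmeas_sigma_additive.

Lemma consmeas_sigma_finite : sigma_finite setT consmeas.
Proof.
have /sigma_finiteP[F [TF ndF Foo]] := sigma_finiteT leb1.
have /sigma_finiteP[G [TG ndG Goo]] := sigma_finiteT mu.
pose g (t : n.+1.-tuple T) : T * n.-tuple T := (thead t, [tuple of behead t]).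
have mg : measurable_fun setT g.
  by apply: measurable_fun_pair; [exact: measurable_tnth|exact: measurable_behead].
have gK : g \o tcons = id.
  by apply/funext => -[a t]; congr (_, _); exact/val_inj.
exists (fun i => g @^-1` (F i `*` G i)).
  rewrite -preimage_bigcup (_ : \bigcup_i _ = setT) ?preimage_setT//.
  rewrite -setXTT TF TG predeqE => -[x y]; split.
    by move=> [i _ []/= ? ?]; split; exists i.
  move=> [/= [i _ Fix] [k _ Gky]]; exists (maxn i k) => //; split.
  - by move: x Fix; exact/subsetPset/ndF/leq_maxl.
  - by move: y Gky; exact/subsetPset/ndG/leq_maxr.
move=> k; have [? ?] := Foo k; have [? ?] := Goo k; split.
  by rewrite -[X in measurable X]setTI; apply: mg => //; exact: measurableX.
rewrite /consmeas /pushforward -comp_preimage gK preimage_id.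
by rewrite product_measure1E// lte_mul_pinfty// ge0_fin_numE.
Qed.
HB.instance Definition _ :=
  Measure_isSigmaFinite.Build _ _ _ consmeas consmeas_sigma_finite.
End lebesgue_cons.

(* Lebesgue (Borel) measure on R^n, carried by n-tuples *)
Fixpoint lebn (R : realType) (n : nat) :
    {sigma_finite_measure set (n.-tuple (measurableTypeR R)) -> \bar R} :=
  match n with
  | 0 => (\d_ ([tuple] : 0.-tuple (measurableTypeR R)))
  | m.+1 => consmeas (lebn R m)
  end.

Section Euclidean.
Context {R : realType}.

Definition rv_of_tuple n (t : n.-tuple (measurableTypeR R)) : 'rV[R]_n :=
  \row_i (tnth t i : R).

Definition lint n (D : set 'rV[R]_n) (f : 'rV[R]_n -> R) : R :=
  \int[lebn R n]_(t in @rv_of_tuple n @^-1` D) f (rv_of_tuple t).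

(* f restricted to D is in L^2(D): extended by 0, it is in L^2(R^n) *)
Definition L2 n (D : set 'rV[R]_n) (f : 'rV[R]_n -> R) : Prop :=
  (f \o @rv_of_tuple n) \_ (@rv_of_tuple n @^-1` D) \in Lfun (lebn R n) 2%:E.

Definition L20 n (D : set 'rV[R]_n) (f : 'rV[R]_n -> R) : Prop :=
  L2 D f /\ lint D f = 0.

Definition L2vec n m (D : set 'rV[R]_n) (f : 'rV[R]_n -> 'rV[R]_m) : Prop :=
  forall i, L2 D (fun x => f x 0 i).

Definition dot n (u v : 'rV[R]_n) : R := \sum_i u 0 i * v 0 i.

(* the norm `|_| of 'rV[R]_n in MathComp-Analysis is the max norm *)
Definition enorm n (u : 'rV[R]_n) : R := Num.sqrt (dot u u).

(* v_i, with coordinates counted from 0 (and 0 if i >= n) *)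
Definition co n (v : 'rV[R]_n) (i : nat) : R :=
  if insub i is Some j then v 0 j else 0.

(* The values live in R^(2d-3), i.e. R for d = 2 and R^3 for d = 3. *)
Definition cross d (v w : 'rV[R]_d) : 'rV[R]_(2 * d - 3) :=
  \row_(i < 2 * d - 3)
    if d == 2%N then co v 0 * co w 1 - co v 1 * co w 0
    else co v (i.+1 %% 3) * co w (i.+2 %% 3)
         - co v (i.+2 %% 3) * co w (i.+1 %% 3).

Definition pderiv n (j : nat) (f : 'rV[R]_n -> R) : 'rV[R]_n -> R :=
  'D_(\row_(i < n) (i == j :> nat)%:R) f.

Definition grad n (f : 'rV[R]_n -> R) (x : 'rV[R]_n) : 'rV[R]_n :=
  \row_(i < n) pderiv i f x.

Definition div n (F : 'rV[R]_n -> 'rV[R]_n) (x : 'rV[R]_n) : R :=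
  \sum_(i < n) pderiv i (fun y => F y 0 i) x.

(* The curl of a field with values in R^(2d-3): (d_2 phi, - d_1 phi) for d = 2,
   the usual curl for d = 3. *)
Definition curl d (phi : 'rV[R]_d -> 'rV[R]_(2 * d - 3)) (x : 'rV[R]_d)
    : 'rV[R]_d :=
  let dphi j l := pderiv j (fun y => co (phi y) l) x in
  \row_(i < d)
    if d == 2%N then (if i == 0%N :> nat then dphi 1%N 0%N else - dphi 0%N 0%N)
    else dphi (i.+1 %% 3)%N (i.+2 %% 3)%N - dphi (i.+2 %% 3)%N (i.+1 %% 3)%N.

Fixpoint Ck n (k : nat) (f : 'rV[R]_n -> R) : Prop :=
  continuous f /\
  if k is l.+1 then
    forall i : 'I_n, (forall x, derivable f x (\row_(j < n) (j == i)%:R)) /\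
                     Ck l (pderiv i f)
  else True.

Definition Cc_infty n (Omega : set 'rV[R]_n) (f : 'rV[R]_n -> R) : Prop :=
  [/\ forall k, Ck k f, compact (closure [set x | f x != 0]) &
      closure [set x | f x != 0] `<=` Omega].

(* w is the distributional divergence of v on Omega *)
Definition weak_div n (Omega : set 'rV[R]_n) (v : 'rV[R]_n -> 'rV[R]_n)
    (w : 'rV[R]_n -> R) : Prop :=
  forall phi, Cc_infty Omega phi ->
    lint Omega (fun x => dot (v x) (grad phi x)) =
    - lint Omega (fun x => w x * phi x).

Definition Hdiv n (Omega : set 'rV[R]_n) (v : 'rV[R]_n -> 'rV[R]_n) : Prop :=
  L2vec Omega v /\ exists w, L2 Omega w /\ weak_div Omega v w.

(* P_m(R^n): polynomial functions of total degree <= m *)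
Definition polyfun n (m : nat) (f : 'rV[R]_n -> R) : Prop :=
  exists c : {ffun 'I_n -> 'I_m.+1} -> R, forall x,
    f x = \sum_(a : {ffun 'I_n -> 'I_m.+1} | (\sum_i a i <= m)%N)
            c a * \prod_i x 0 i ^+ a i.

Definition polyvec n l (m : nat) (f : 'rV[R]_n -> 'rV[R]_l) : Prop :=
  forall i, polyfun m (fun x => f x 0 i).

(* P_m(D): restrictions to D of polynomials *)
Definition polyfun_on n (m : nat) (D : set 'rV[R]_n) (f : 'rV[R]_n -> R)
    : Prop :=
  exists2 g, polyfun m g & {in D, f =1 g}.

Definition polyvec_on n l (m : nat) (D : set 'rV[R]_n)
    (f : 'rV[R]_n -> 'rV[R]_l) : Prop :=
  forall i, polyfun_on m D (fun x => f x 0 i).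

Definition hull n (I : finType) (S : {pred I}) (a : I -> 'rV[R]_n)
    : set 'rV[R]_n :=
  [set x | exists l : I -> R, [/\ {in S, forall i, 0 <= l i},
     \sum_(i in S) l i = 1 & x = \sum_(i in S) l i *: a i]].

Definition affine_indep n (I : finType) (S : {pred I}) (a : I -> 'rV[R]_n)
    : Prop :=
  forall l : I -> R, \sum_(i in S) l i = 0 ->
    \sum_(i in S) l i *: a i = 0 -> {in S, forall i, l i = 0}.

Definition bdry n (A : set 'rV[R]_n) : set 'rV[R]_n := closure A `\` A°.

(* bounded domain whose boundary is a finite union of (d-1)-simplexes *)
Definition polyhedral_domain d (Omega : set 'rV[R]_d) : Prop :=
  [/\ open Omega, connected Omega, Omega !=set0, bounded_set Omega &
      exists (s : nat) (F : 'I_s -> 'I_d -> 'rV[R]_d),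
        (forall j, affine_indep predT (F j)) /\
        bdry Omega = \bigcup_j hull predT (F j)].

Definition ref_simplex n : set 'rV[R]_n :=
  [set t | (forall i, 0 <= t 0 i) /\ \sum_i t 0 i <= 1].

End Euclidean.

(* Cells and faces are given by the sets of (indices of) their vertices. *)
Record mesh (R : realType) (d : nat) := Mesh {
  mesh_nv : nat ;
  mesh_pt : 'I_mesh_nv -> 'rV[R]_d ;
  cells : {set {set 'I_mesh_nv}} }.

Section Mesh.
Context {R : realType} {d : nat}.
Variable T : mesh R d.
Local Notation V := 'rV[R]_d.
Local Notation simp := {set 'I_(mesh_nv T)}.

Definition geom (S : simp) : set V := hull (mem S) (@mesh_pt R d T).

(* the faces of the cell K; each is a (d-1)-simplex *)
Definition cell_faces (K : simp) : {set simp} :=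
  [set e : simp | (e \subset K) && (#|e| == d)]%SET.

(* epsilon_h *)
Definition faces : {set simp} :=
  [set e : simp | [exists K in cells T, e \in cell_faces K]]%SET.

(* Conforming partition of Omega into nondegenerate closed simplexes that
   resolves the boundary. *)
Definition triangulates (Omega : set V) : Prop :=
  [/\ forall K, K \in cells T -> #|K| = d.+1 /\ affine_indep (mem K) (@mesh_pt R d T),
      forall K K', K \in cells T -> K' \in cells T ->
        geom K `&` geom K' = geom (K :&: K')%SET,
      closure Omega = \bigcup_(K in [set K | K \in cells T]) geom K &
      bdry Omega =
        \bigcup_(e in [set e | e \in faces /\ geom e `<=` bdry Omega]) geom e].

Definition diam (K : simp) : R :=
  sup [set enorm (x - y) | x in geom K & y in geom K].

Definition inradius (K : simp) : R :=
  sup [set r | 0 <= r /\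
               exists x, forall y, enorm (y - x) <= r -> geom K y].

Definition shape_regular (sigma : R) : Prop :=
  forall K, K \in cells T -> diam K <= sigma * (2 * inradius K).

(* outward unit normal of K on its face e *)
Definition normal (K e : simp) : V :=
  xget 0 [set n | [/\ dot n n = 1,
    {in e &, forall i j, dot n (mesh_pt i - mesh_pt j) = 0} &
    forall i j, i \in K -> i \notin e -> j \in e ->
      dot n (mesh_pt i - mesh_pt j) < 0]].

Definition face_vertex (e : simp) (i : nat) : V :=
  nth 0 [seq mesh_pt j | j <- enum e] i.

Definition face_edges (e : simp) : 'M[R]_(d.-1, d) :=
  \matrix_(i < d.-1) (face_vertex e i.+1 - face_vertex e 0).

(* Surface integral over e, through the affine parametrization of e by the
   reference simplex; the square root of the Gram determinant is the surface
   element. *)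
Definition face_int (e : simp) (f : V -> R) : R :=
  let E := face_edges e in
  Num.sqrt (\det (E *m E^T)) *
  lint (@ref_simplex R d.-1) (fun t => f (face_vertex e 0 + t *m E)).

(* the integral over the boundaries of all cells, of a function g K e on each
   face e of each cell K *)
Definition bdry_int (g : simp -> simp -> V -> R) : R :=
  \sum_(K in cells T) \sum_(e in cell_faces K) face_int e (g K e).

(* The function on Omega equal to F K inside each cell K, and to 0 on the null
   set of points interior to no cell. *)
Definition piecewise (X : nmodType) (F : simp -> V -> X) (x : V) : X :=
  \sum_(K in cells T | x \in ((geom K)° : set V)) F K x.

(* A weak function {v_o, v_b}: wo v K is v_o on K, and wb v e is v_b on e,
   of which only the values on e matter. *)
Record wfun (X : Type) := WFun { wo : simp -> V -> X ; wb : simp -> V -> X }.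

Definition wcomp n (v : wfun 'rV[R]_n) (i : 'I_n) : wfun R :=
  WFun (fun K x => wo v K x 0 i) (fun e x => wb v e x 0 i).

(* {u_(o,i) Phi_o, u_(b,i) Phi_b} *)
Definition wscale (u Phi : wfun V) (i : 'I_d) : wfun V :=
  WFun (fun K x => wo u K x 0 i *: wo Phi K x)
       (fun e x => wb u e x 0 i *: wb Phi e x).

(* Discrete weak operators. As K has nonempty interior, P_m(K) is identified
   with the polynomial functions on R^d. *)
Definition is_wgrad (m : nat) (v : wfun R) (K : simp) (G : V -> V) : Prop :=
  polyvec m G /\ forall phi : V -> V, polyvec m phi ->
    lint (geom K) (fun x => dot (G x) (phi x)) =
    - lint (geom K) (fun x => wo v K x * div phi x)
    + \sum_(e in cell_faces K)
        face_int e (fun x => wb v e x * dot (phi x) (normal K e)).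

Definition wgrad m v K : V -> V := xget (fun=> 0) (is_wgrad m v K).

Definition is_wdiv (m : nat) (w : wfun V) (K : simp) (D : V -> R) : Prop :=
  polyfun m D /\ forall phi : V -> R, polyfun m phi ->
    lint (geom K) (fun x => D x * phi x) =
    - lint (geom K) (fun x => dot (wo w K x) (grad phi x))
    + \sum_(e in cell_faces K)
        face_int e (fun x => dot (wb w e x) (normal K e) * phi x).

Definition wdiv m w K : V -> R := xget (fun=> 0) (is_wdiv m w K).

Definition is_wcurl (m : nat) (w : wfun V) (K : simp)
    (C : V -> 'rV[R]_(2 * d - 3)) : Prop :=
  polyvec m C /\ forall phi : V -> 'rV[R]_(2 * d - 3), polyvec m phi ->
    lint (geom K) (fun x => dot (C x) (phi x)) =
    lint (geom K) (fun x => dot (wo w K x) (curl phi x))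
    - \sum_(e in cell_faces K)
        face_int e (fun x => dot (cross (wb w e x) (normal K e)) (phi x)).

Definition wcurl m w K : V -> 'rV[R]_(2 * d - 3) :=
  xget (fun=> 0) (is_wcurl m w K).

End Mesh.

Section Scheme.
Context {R : realType} {d : nat}.
Variables (Omega : set 'rV[R]_d) (T : mesh R d) (k : nat).
Local Notation V := 'rV[R]_d.
Local Notation simp := {set 'I_(mesh_nv T)}.

Definition Vh (v : wfun T V) : Prop :=
  (forall K, K \in cells T -> polyvec k (wo v K)) /\
  (forall e, e \in faces T -> polyvec_on k (geom e) (wb v e)).

Definition Vh0 (v : wfun T V) : Prop :=
  Vh v /\ forall e, e \in faces T -> geom e `<=` bdry Omega ->
    {in geom e, forall x, wb v e x = 0}.

Definition Wh0 (w : wfun T V) : Prop :=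
  Vh w /\ forall K e, K \in cells T -> e \in cell_faces K ->
    geom e `<=` bdry Omega ->
    {in geom e, forall x, cross (wb w e x) (normal K e) = 0}.

Definition Qh (q : wfun T R) : Prop :=
  (forall K, K \in cells T -> polyfun k.-1 (wo q K)) /\
  (forall e, e \in faces T -> polyfun_on k (geom e) (wb q e)).

Definition Qh0 (q : wfun T R) : Prop := Qh q /\ L20 Omega (piecewise (wo q)).

Definition Rh0 (theta : wfun T R) : Prop :=
  Qh theta /\ forall e, e \in faces T -> geom e `<=` bdry Omega ->
    {in geom e, forall x, wb theta e x = 0}.

(* L^2(Omega) inner product *)
Definition ip n (F G : V -> 'rV[R]_n) : R :=
  lint Omega (fun x => dot (F x) (G x)).

Variables Ha N Rm : R.

Definition ah (u v : wfun T V) : R :=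
  1 / Ha ^+ 2 *
    \sum_(i < d) ip (piecewise (wgrad k.-1 (wcomp u i)))
                    (piecewise (wgrad k.-1 (wcomp v i))) +
  1 / Ha ^+ 2 *
    bdry_int (fun (K e : simp) x =>
      (diam K)^-1 * dot (wo u K x - wb u e x) (wo v K x - wb v e x)).

Definition ath (B w : wfun T V) : R :=
  1 / Rm ^+ 2 * ip (piecewise (wcurl k.-1 B)) (piecewise (wcurl k.-1 w)) +
  1 / Rm ^+ 2 *
    bdry_int (fun (K e : simp) x =>
      (diam K)^-1 * dot (cross (wo B K x - wb B e x) (normal K e))
                        (cross (wo w K x - wb w e x) (normal K e))).

Definition bh (v : wfun T V) (q : wfun T R) : R :=
  ip (piecewise (wgrad k q)) (piecewise (wo v)).

Definition bth (w : wfun T V) (theta : wfun T R) : R :=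
  1 / Rm * ip (piecewise (wgrad k theta)) (piecewise (wo w)).

(* weak divergence of {u_o (x) Phi_o, u_b (x) Phi_b} *)
Definition wdiv_tensor (u Phi : wfun T V) (K : simp) (x : V) : V :=
  \row_(i < d) wdiv k (wscale u Phi i) K x.

Definition ch (Phi u v : wfun T V) : R :=
  1 / (2 * N) * (ip (piecewise (wdiv_tensor u Phi)) (piecewise (wo v))
                 - ip (piecewise (wdiv_tensor v Phi)) (piecewise (wo u))).

Definition cth (v B w : wfun T V) : R :=
  1 / Rm * ip (piecewise (wcurl k w))
              (piecewise (fun K x => cross (wo v K x) (wo B K x))).

Definition WG_solution (f g : V -> V) (u B : wfun T V) (p r : wfun T R)
    : Prop :=
  [/\ Vh0 u, Wh0 B, Qh0 p, Rh0 r &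
    forall v w q theta, Vh0 v -> Wh0 w -> Qh0 q -> Rh0 theta ->
      ah u v + ath B w + bh v p - bh u q + bth w r - bth B theta
      + ch u u v + cth v B B - cth u B w
      = ip f (piecewise (wo v)) + 1 / Rm * ip g (piecewise (wo w))].

End Scheme.

(* Main.v *)
(** Testing the scheme with [v = 0], [w = 0] isolates [b_h(u_h, q) = 0], which by
    the definition of the weak gradient and integration by parts reads
      [sum_K (- (q_o, div u_o)_K + <q_b, u_o . n>_(bd K)) = 0]
    for every admissible [q].
    Taking [q_o = 0] and [q_b = J_e], the sum of the one or two normal traces of
    [u_o] on the face [e], kills the jumps [J_e] (for the magnetic field, only on
    the faces off the boundary, where [theta_b] is free).  Then [q_o = div u_o]
    is admissible, since its mean is the sum of the integrals of the [J_e], and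
    [div u_o] vanishes on every cell.  Green's formula on each cell against a
    test function, whose trace vanishes on the boundary faces, concludes.

    Green's formula on a simplex reduces to edge directions: for two vertices
    [a_i], [a_j] an affine change of variables to the reference simplex, Fubini
    and the one-dimensional fundamental theorem express the integral of the
    derivative along [a_i - a_j] by the two faces opposite to [a_i] and [a_j]. *)
Require Import Defs.
From mathcomp Require Import all_boot all_order fingroup perm all_algebra.
From mathcomp Require Import all_classical all_reals all_analysis.
From mathcomp Require Import measurable_realfun ring lra.
Set Implicit Arguments.
Unset Strict Implicit.
Unset Printing Implicit Defensive.
Import Order.TTheory GRing.Theory Num.Theory.
Import numFieldNormedType.Exports.
Local Open Scope classical_set_scope.
Local Open Scope ring_scope.

(** * Affine changes of variables *)

Section Tuples.
Context {R : realType}.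
Local Notation T := (measurableTypeR R).
Local Notation leb := (@lebesgue_measure R).

(** Two obstacles shape the development. [lebn] is an iterated product measure on tuples, related by
    definition neither to the topology nor to the linear algebra of row vectors, so the
    measurability of open sets and the factor [|det A|] of an affine substitution are derived from
    Tonelli's theorem and a block factorization of [A]. And [wgrad] and [normal] are choices by
    [xget], with value 0 if nothing fits, so each defining property is available only after
    existence has been proved: by a compatible linear system for the gradient, by a kernel vector of
    the face edges for the normal. Edge directions are used because only two faces are transversal
    to [a_i - a_j]: all the others contain both vertices. One determinant, read as height times base
    over either of these faces, turns the Jacobian into the two surface elements, and the edges at
    one vertex span all directions. The weak gradient has degree [k], the degree of [u_o], so [u_o]
    itself may be inserted in its definition; this makes [b_h] computable. *)

Definition tuple_of_rv n (x : 'rV[R]_n) : n.-tuple T := [tuple (x 0 i : T) | i < n].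

Lemma tuple_of_rvK n : cancel (@tuple_of_rv n) (@rv_of_tuple R n).
Proof. by move=> x; apply/rowP => i; rewrite mxE tnth_mktuple. Qed.

Lemma rv_of_tupleK n : cancel (@rv_of_tuple R n) (@tuple_of_rv n).
Proof. by move=> t; apply/eq_from_tnth => i; rewrite tnth_mktuple mxE. Qed.

Lemma rv_tcons n (x : T) (t : n.-tuple T) :
  rv_of_tuple (tcons (x, t)) = row_mx (x : R)%:M (rv_of_tuple t) :> 'rV[R]_(1 + n).
Proof.
apply/rowP => i; rewrite !mxE; case: splitP => j ij.
  have -> : i = ord0 by apply/val_inj; rewrite /= ij ord1.
  by rewrite !mxE !ord1 eqxx mulr1n.
have -> : i = lift ord0 j by exact/val_inj.
by rewrite mxE /tcons tnthS; congr tnth; apply/val_inj.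
Qed.

Lemma measurable_affine_form n (a : 'I_n -> R) (b : R) :
  measurable_fun [set: n.-tuple T] (fun t => (\sum_i tnth t i * a i + b : R)).
Proof.
apply: measurable_funD => //; apply: measurable_sum => i.
by apply: measurable_funM => //; exact: measurable_tnth.
Qed.

(** The substitution is carried to tuples because the measure and its sigma-algebra live there,
    while the matrix acts on rows. *)
Definition aff n m (A : 'M[R]_(n, m)) (b : 'rV[R]_m) (t : n.-tuple T) : m.-tuple T :=
  tuple_of_rv (rv_of_tuple t *m A + b).

Lemma measurable_aff n m (A : 'M[R]_(n, m)) b : measurable_fun setT (aff A b).
Proof.
apply/measurable_fun_tnthP => i.
rewrite (_ : _ \o _ = fun t => (\sum_j tnth t j * A j i + b 0 i : R)).
  exact: measurable_affine_form.
apply/funext => t /=; rewrite tnth_mktuple !mxE; congr (_ + _).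
by apply: eq_bigr => j _; rewrite mxE.
Qed.

(** [lebn] in dimension [n.+1] is by definition the image of a product measure under [tcons], so the
    product theorem transfers. Both orders are kept: the first coordinate is the inner variable when
    only it is transformed, the remaining ones when it is frozen. *)
Lemma lebn_tonelli n (F : n.+1.-tuple T -> \bar R) :
  measurable_fun setT F -> (forall t, 0 <= F t)%E ->
  (\int[lebn R n.+1]_t F t = \int[leb]_x \int[lebn R n]_t F (tcons (x, t)))%E /\
  (\int[lebn R n.+1]_t F t = \int[lebn R n]_t \int[leb]_x F (tcons (x, t)))%E.
Proof.
move=> mF F0 /=; have mc := @measurable_tcons R n.
have E : (\int[consmeas (lebn R n)]_t F t = \int[leb \x lebn R n]_z F (tcons z))%E.
  by rewrite ge0_integral_pushforward.
have mFc : measurable_fun setT (F \o @tcons R n) by exact: measurableT_comp.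
rewrite E; split.
  exact: (fubini_tonelli1 (F \o @tcons R n) mFc (fun z => F0 _)).
exact: (fubini_tonelli2 (F \o @tcons R n) mFc (fun z => F0 _)).
Qed.

(** By uniqueness of Lebesgue measure: [|a|] times the image of [leb] under [x * a + b] gives every
    half-open interval its length. *)
Lemma lebesgue_affine (a b : R) (F : T -> \bar R) : a != 0 ->
  measurable_fun setT F -> (forall x, 0 <= F x)%E ->
  (\int[leb]_x F x = `|a|%:E * \int[leb]_x F (x * a + b)%R)%E.
Proof.
move=> a0 mF F0; pose phi (x : T) : T := x * a + b.
have mphi : measurable_fun setT phi.
  by apply: measurable_funD => //; apply: measurable_funM.
rewrite -(_ : \int[pushforward leb phi]_x F x = \int[leb]_x F (x * a + b)%R)%E; last first.
  by rewrite ge0_integral_pushforward.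
pose r : {nonneg R} := NngNum (normr_ge0 a).
rewrite -[X in (X%:E * _)%E]/(r%:num) -(ge0_integral_mscale (pushforward leb phi) measurableT r)//.
apply: eq_measure_integral => A mA _; apply: lebesgue_measure_unique => //.
move=> _ [[c d] _ <-] /=; rewrite lebesgue_measure_itv/=.
rewrite [RHS](_ : _ = (`|a|%:E * leb (phi @^-1` [set` `]c, d]]))%E)//.
have [an|ap|] := ltrgtP a 0; last by move/eqP; rewrite (negbTE a0).
(* A negative slope turns []c, d]] into an interval closed on the left, so the two signs are
   computed apart. *)
- have E : phi @^-1` [set` `]c, d]] = [set` `[(d - b) / a, (c - b) / a[].
    apply/seteqP; split=> x /=; rewrite /phi !in_itv /=;
    by rewrite ler_ndivrMr // ltr_ndivlMr // ltrBlDr lerBrDr andbC.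
  rewrite E.
  rewrite lebesgue_measure_itv /= !lte_fin ltr_nM2r ?invr_lt0// ltrD2r.
  case: ifP => _; last by rewrite mule0.
  by rewrite -EFinD -EFinM ltr0_norm//; congr EFin; field.
- have E : phi @^-1` [set` `]c, d]] = [set` `](c - b) / a, (d - b) / a]].
    apply/seteqP; split=> x /=; rewrite /phi !in_itv /=;
    by rewrite ltr_pdivrMr // ler_pdivlMr // ltrBlDr lerBrDr.
  rewrite E.
  rewrite lebesgue_measure_itv /= !lte_fin ltr_pM2r ?invr_gt0// ltrD2r.
  case: ifP => _; last by rewrite mule0.
  by rewrite -EFinD -EFinM gtr0_norm//; congr EFin; field.
Qed.

End Tuples.

Section ChangeOfVariables.
Context {R : realType}.
Local Notation T := (measurableTypeR R).
Local Notation leb := (@lebesgue_measure R).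

Lemma tuple_of_row_mx n (y : R) (s : 'rV[R]_n) :
  tuple_of_rv (row_mx y%:M s : 'rV_(1 + n)) = tcons (y, tuple_of_rv s).
Proof.
by apply: (can_inj (@rv_of_tupleK R n.+1)); rewrite tuple_of_rvK rv_tcons tuple_of_rvK.
Qed.

(** Nonnegative integrands let Tonelli's theorem apply directly. As a predicate in [A] and [b] the
    formula is closed under composition, so block factors can be treated one by one. *)
Definition lebn_scales n (A : 'M[R]_n) (b : 'rV[R]_n) := forall F : n.-tuple T -> \bar R,
  measurable_fun setT F -> (forall t, 0 <= F t)%E ->
  (\int[lebn R n]_t F t = `|\det A|%:E * \int[lebn R n]_t F (aff A b t))%E.

Lemma lebn_scales_comp n (A B : 'M[R]_n) b c :
  lebn_scales A b -> lebn_scales B c -> lebn_scales (A *m B) (b *m B + c).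
Proof.
move=> hA hB F mF F0; rewrite hB // (hA (F \o aff B c)) //; last by move=> t; exact: F0.
  rewrite muleA -EFinM -normrM det_mulmx mulrC; congr (_ * _)%E.
  apply: eq_integral => t _ /=; congr F.
  by rewrite /aff tuple_of_rvK mulmxDl mulmxA addrA.
exact: measurableT_comp mF (measurable_aff B c).
Qed.

(** The map sends [x :: t] to [(x * a + t c + b0) :: t]: with [t] frozen it is one-dimensional and
    affine, so the integral over [x] is taken inside. *)
Lemma lebn_scales_col n (a : R) (c : 'cV[R]_n) (b0 : R) : a != 0 ->
  lebn_scales (block_mx a%:M 0 c 1%:M : 'M[R]_(1 + n)) (row_mx (b0%:M) 0).
Proof.
move=> a0 F mF F0; rewrite det_lblock det1 mulr1 det_scalar1.
have mG := measurableT_comp mF (measurable_aff (block_mx a%:M 0 c 1%:M : 'M[R]_(1 + n)) (row_mx b0%:M 0)).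
have G0 t : (0 <= (F \o aff (block_mx a%:M 0 c 1%:M : 'M[R]_(1 + n)) (row_mx b0%:M 0)) t)%E by exact: F0.
have E x t : aff (block_mx a%:M 0 c 1%:M : 'M[R]_(1 + n)) (row_mx b0%:M 0) (tcons (x, t)) =
    tcons (x * a + ((rv_of_tuple t *m c) 0 0 + b0), t).
  rewrite /aff rv_tcons mul_row_block !mulmx0 mulmx1 add0r add_row_mx addr0.
  rewrite {1}[_ *m c]mx11_scalar -scalar_mxM -!raddfD /= tuple_of_row_mx rv_of_tupleK.
  by rewrite addrA.
have [_ ->] := lebn_tonelli mF F0; have [_ ->] := lebn_tonelli mG G0.
have mFc t : measurable_fun setT (fun x => F (tcons (x, t))).
  apply: (@measurableT_comp _ _ _ _ _ _ F) => //.
  apply: (measurableT_comp (@measurable_tcons R n)).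
  exact: measurable_pair2.
have mgc := measurableT_comp mG (@measurable_tcons R n).
rewrite -ge0_integralZl//.
- apply: eq_integral => t _ /=; rewrite (lebesgue_affine (((rv_of_tuple t *m c) 0 0 + b0)) a0)//.
  by congr (_ * _)%E; apply: eq_integral => x _; rewrite E.
- exact: (@measurable_fun_fubini_tonelli_G _ _ _ _ _ leb (_ \o @tcons R n) mgc (fun z => G0 _)).
- by move=> t _; apply: integral_ge0.
Qed.

Lemma lebn_scales_row n (D : 'M[R]_n) (b b' : 'rV[R]_n) :
  (forall b, lebn_scales D b) ->
  lebn_scales (block_mx 1%:M b 0 D : 'M[R]_(1 + n)) (row_mx 0 b').
Proof.
move=> hD F mF F0; rewrite det_ublock det1 mul1r.
have mG := measurableT_comp mF (measurable_aff (block_mx 1%:M b 0 D : 'M[R]_(1 + n)) (row_mx 0 b')).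
have G0 t : (0 <= (F \o aff (block_mx 1%:M b 0 D : 'M[R]_(1 + n)) (row_mx 0 b')) t)%E by exact: F0.
have E x t : aff (block_mx 1%:M b 0 D : 'M[R]_(1 + n)) (row_mx 0 b') (tcons (x, t)) =
    tcons (x, aff D (x *: b + b') t).
  rewrite /aff rv_tcons mul_row_block !mulmx0 mulmx1 addr0 add_row_mx addr0.
  by rewrite mul_scalar_mx tuple_of_row_mx addrAC addrC addrA.
have [-> _] := lebn_tonelli mF F0; have [-> _] := lebn_tonelli mG G0.
have mFc x : measurable_fun setT (fun t => F (tcons (x, t))).
  apply: (@measurableT_comp _ _ _ _ _ _ F) => //.
  apply: (measurableT_comp (@measurable_tcons R n)).
  exact: measurable_pair1.
have mgc := measurableT_comp mG (@measurable_tcons R n).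
rewrite -ge0_integralZl//.
- apply: eq_integral => x _ /=; rewrite (hD (x *: b + b') _ (mFc x))//.
  by congr (_ * _)%E; apply: eq_integral => t _; rewrite E.
- exact: (@measurable_fun_fubini_tonelli_F _ _ _ _ _ (lebn R n) (_ \o @tcons R n) mgc (fun z => G0 _)).
- by move=> t _; apply: integral_ge0.
Qed.

(** Induction on the dimension. With a nonzero corner, one step of block elimination writes the
    matrix as a column factor times a row factor whose lower block is the Schur complement, of
    smaller size. *)
Lemma lebn_scales_unitmx n (A : 'M[R]_n) b : A \in unitmx -> lebn_scales A b.
Proof.
elim: n A b => [|n IHn] A b uA.
  move=> F mF F0; rewrite det_mx00 normr1 mul1e; apply: eq_integral => t _.
  by rewrite [t]tuple0 [aff _ _ _]tuple0.
have shift D b' : D \in unitmx -> lebn_scales (D : 'M[R]_n) b' by exact: IHn.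
have nz (a : R) (x : 'rV[R]_n) (c : 'cV[R]_n) (D : 'M[R]_n) (b1 : 'rV_n.+1) : a != 0 ->
    block_mx a%:M x c D \in @unitmx R (1 + n) -> lebn_scales (block_mx a%:M x c D : 'M[R]_(1 + n)) b1.
  move=> a0 uB; pose S : 'M[R]_n := D - c *m (a^-1 *: x).
  have BE : block_mx a%:M x c D =
      (block_mx a%:M 0 c 1%:M : 'M[R]_(1 + n)) *m (block_mx 1%:M (a^-1 *: x) 0 S : 'M[R]_(1 + n)).
    rewrite mulmx_block !mulmx0 !mul0mx !mulmx1 !mul1mx !addr0 mul_scalar_mx scalerA mulfV // scale1r.
    by rewrite /S addrCA subrr addr0; congr block_mx.
  have uS : S \in unitmx.
    move: uB; rewrite BE !unitmxE det_mulmx det_lblock det_ublock !det1 mulr1 mul1r det_scalar1.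
    by rewrite unitrM => /andP[].
  rewrite BE.
  pose y : R := (lsubmx (b1 : 'rV_(1 + n))) 0 0.
  (* The translation is split to fit the composition rule: its first entry is carried through the
     second factor, and the remainder corrects the other entries. *)
  have -> : b1 = row_mx y%:M 0 *m (block_mx 1%:M (a^-1 *: x) 0 S : 'M[R]_(1 + n)) +
                 row_mx 0 (rsubmx (b1 : 'rV_(1 + n)) - (y * a^-1) *: x).
    rewrite mul_row_block !mulmx0 !mul0mx mulmx1 !addr0 add_row_mx addr0 mul_scalar_mx scalerA.
    by rewrite addrC subrK /y -mx11_scalar hsubmxK.
  apply: lebn_scales_comp; first exact: lebn_scales_col.
  by apply: lebn_scales_row => b2; exact: shift.
pose A' : 'M[R]_(1 + n) := A.
have uA' : A' \in unitmx by [].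
have AE : A' = block_mx (ulsubmx A' 0 0)%:M (ursubmx A') (dlsubmx A') (drsubmx A').
  by rewrite -mx11_scalar submxK.
have [a0|a0] := eqVneq (ulsubmx A' 0 0) 0; last first.
  rewrite -[A]/A' AE; apply: nz => //; by rewrite -AE.
(* If the column below the zero corner vanished too, so would the determinant. *)
have [i ci] : exists i, dlsubmx A' i 0 != 0.
  apply/existsP; rewrite -negb_forall; apply/negP => /forallP c0.
  move: uA'; rewrite AE a0 unitmxE (_ : dlsubmx A' = 0); last first.
    by apply/colP => i; have := c0 i => /eqP ->; rewrite mxE.
  by rewrite det_ublock det_scalar1 mul0r unitr0.
(* a zero corner entry is made invertible by adding a row to the first one *)
pose U (s : R) : 'M[R]_(1 + n) := block_mx 1%:M (s *: delta_mx 0 i) 0 1%:M.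
have UU : U (-1) *m U 1 = 1%:M.
  rewrite /U mulmx_block !mulmx0 !mul0mx !mulmx1 !mul1mx !addr0 ?add0r.
  by rewrite scaleN1r scale1r subrr -scalar_mx_block.
have -> : A = U (-1) *m (U 1 *m A') by rewrite mulmxA UU mul1mx.
rewrite -[b]add0r -(mul0mx _ (U 1 *m A')); apply: lebn_scales_comp.
  rewrite (_ : 0 = row_mx 0 0 :> 'rV_(1 + n)); last by rewrite row_mx0.
  by apply: lebn_scales_row => b2; apply: shift; exact: unitmx1.
have E : U 1 *m A' = block_mx (dlsubmx A' i 0)%:M (ursubmx A' + row i (drsubmx A'))
    (dlsubmx A') (drsubmx A').
  rewrite {1}AE a0 /U mulmx_block !mul0mx !mul1mx !scale1r !add0r -!rowE raddf0 add0r.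
  by congr block_mx; apply/matrixP => r s; rewrite !ord1 [LHS]mxE [RHS]mxE mulr1n.
rewrite E; apply: nz => //; rewrite -E unitmx_mul uA' andbT.
by case/mulmx1_unit: UU.
Qed.

End ChangeOfVariables.

(** * Integration over row vectors *)

Section RowVectors.
Context {R : realType}.
Local Notation T := (measurableTypeR R).
Local Notation rv := (@rv_of_tuple R _).

Definition rv_measurable n (D : set 'rV[R]_n) := measurable (rv @^-1` D).

Definition rv_integrable n (D : set 'rV[R]_n) (f : 'rV[R]_n -> R) :=
  (lebn R n).-integrable (rv @^-1` D) (EFin \o (f \o rv)).

Definition rv_null n (D : set 'rV[R]_n) :=
  rv_measurable D /\ lebn R n (rv @^-1` D) = 0%E.

Lemma rv_box_measurable n (a b : 'I_n -> R) :
  rv_measurable [set x : 'rV[R]_n | forall i, a i < x 0 i < b i].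
Proof.
rewrite /rv_measurable (_ : _ @^-1` _ =
    \bigcap_(i in setT) ((@tnth _ T ^~ i) @^-1` [set` `]a i, b i[])); last first.
  apply/seteqP; split=> t /= h i; first by rewrite /= in_itv /=; have := h i; rewrite mxE.
  by have := h i I; rewrite mxE /= in_itv.
apply: fin_bigcap_measurable; first exact: finite_finset.
move=> i _; rewrite -[X in measurable X]setTI; apply: measurable_tnth => //.
Qed.

(** Measurability on tuples is generated by the coordinates, so an open set is written as the
    countable union of the boxes with rational corners that it contains. *)
Lemma open_rv_measurable n (U : set 'rV[R]_n) : open U -> rv_measurable U.
Proof.
move=> oU.
pose box (q : {ffun 'I_n -> rat} * {ffun 'I_n -> rat}) :=
  [set x : 'rV[R]_n | forall i, ratr (q.1 i) < x 0 i < ratr (q.2 i)].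
pose B q := if `[< box q `<=` U >] then box q else set0.
rewrite /rv_measurable (_ : U = \bigcup_q B q); last first.
  apply/seteqP; split=> [x Ux|x [q _]]; last by rewrite /B; case: asboolP => // + xq; apply.
  have /nbhs_ballP[e /= e0 eU] : nbhs x U by exact: open_nbhs_nbhs.
  have /choice[q1 q1P] i : exists q : rat, ratr q \in `]x 0 i - e, x 0 i[.
    by apply: rat_in_itvoo; rewrite ltrBlDr ltrDl.
  have /choice[q2 q2P] i : exists q : rat, ratr q \in `]x 0 i, x 0 i + e[.
    by apply: rat_in_itvoo; rewrite ltrDl.
  exists (finfun q1, finfun q2) => //; rewrite /B asboolT => [i /=|y /= yq].
    by rewrite !ffunE; have := q1P i; have := q2P i; rewrite !in_itv /= => /andP[-> _] /andP[_ ->].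
  apply: eU; split => // i j; rewrite ord1 /ball /= ltr_distlC.
  have := q1P j; have := q2P j; have := yq j; rewrite !ffunE !in_itv /=.
  by move=> /andP[y1 y2] /andP[_ z2] /andP[z1 _]; rewrite (lt_trans z1 y1) (lt_trans y2 z2).
rewrite preimage_bigcup; apply: countable_bigcupT_measurable => [|q].
  exact: countableP.
by rewrite /B; case: asboolP => _; [exact: rv_box_measurable | rewrite preimage_set0].
Qed.

Lemma closed_rv_measurable n (U : set 'rV[R]_n) : closed U -> rv_measurable U.
Proof.
move=> cU; rewrite /rv_measurable -[U]setCK preimage_setC; apply: measurableC.
exact: (open_rv_measurable (closed_openC cU)).
Qed.

Lemma continuous_rv_measurable n (f : 'rV[R]_n -> R) :
  continuous f -> measurable_fun setT (f \o rv).
Proof.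
move=> /continuousP cf; apply: (measurability _ (RGenOpens.measurableE R)).
move=> _ [_ [a [b ->] <-]]; rewrite setTI comp_preimage.
by apply: open_rv_measurable; apply: cf; exact: interval_open.
Qed.

(** For [e > 0] these are the balls of the max norm, written by coordinates so that they split under
    [tcons]. *)
Definition cube n (c : 'rV[R]_n) (e : R) := [set x : 'rV[R]_n | forall i, `|x 0 i - c 0 i| < e].

Lemma cubeE n (c : 'rV[R]_n) e : cube c e = [set x | forall i, c 0 i - e < x 0 i < c 0 i + e].
Proof.
by apply/seteqP; split=> x xc i; have := xc i; rewrite ltr_distl.
Qed.

Lemma cube_measurable n (c : 'rV[R]_n) e : rv_measurable (cube c e).
Proof. by rewrite cubeE; exact: rv_box_measurable. Qed.

Lemma lebn_cube n (c : 'rV[R]_n) e : 0 < e ->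
  lebn R n (rv @^-1` cube c e) = ((2 * e) ^+ n)%:E.
Proof.
move=> e0; elim: n c => [|n IHn] c.
  by rewrite expr0 /= /dirac indicE mem_set// => -[].
pose I : set T := [set` `]c 0 0 - e, c 0 0 + e[].
pose c' : 'rV[R]_n := \row_i c 0 (lift ord0 i).
rewrite [LHS](_ : _ = (lebesgue_measure \x lebn R n)%E
  (@tcons R n @^-1` (rv @^-1` cube c e)))//.
have -> : @tcons R n @^-1` (rv @^-1` cube c e) = I `*` (rv @^-1` cube c' e).
  apply/seteqP; split=> -[x t] /=.
    move=> h; split; first by have := h ord0; rewrite mxE ltr_distl /I /= in_itv.
    by move=> i; have := h (lift ord0 i); rewrite !mxE /tcons tnthS /=.
  rewrite /I /= in_itv /= => -[xI tc] i; rewrite mxE; case: (unliftP ord0 i) => [j ->|->].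
    by have := tc j; rewrite !mxE /tcons tnthS.
  by rewrite ltr_distl.
have leI : lebesgue_measure I = (2 * e)%:E.
  rewrite /I lebesgue_measure_itv /= lte_fin.
  rewrite ifT; last by rewrite ltrBlDr -addrA ltrDl; apply: addr_gt0.
  by rewrite -EFinB; congr EFin; ring.
rewrite product_measure1E ?IHn; [|exact: measurable_itv|exact: cube_measurable].
by rewrite -[X in (X * _)%E]/(lebesgue_measure I) leI -EFinM -exprS.
Qed.

Lemma bounded_rv_finite n (D : set 'rV[R]_n) :
  rv_measurable D -> bounded_set D -> (lebn R n (rv @^-1` D) < +oo)%E.
Proof.
move=> mD [M [_ /(_ (`|M| + 1))]] h.
have M1 : M < `|M| + 1 by rewrite (le_lt_trans (ler_norm _))// ltrDl.
have e0 : 0 < `|M| + 2 by rewrite ltr_wpDl.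
apply: (@le_lt_trans _ _ (lebn R n (rv @^-1` cube 0 (`|M| + 2)))).
  apply: le_measure; rewrite ?inE //; first exact: cube_measurable.
  move=> t /(h M1) /= tM i; rewrite [X in _ - X]mxE subr0.
  apply: (@le_lt_trans _ _ (`|M| + 1)); last by rewrite ltrD2l ltr1n.
  apply: le_trans tM; rewrite [leRHS]/Num.norm /= mx_normrE.
  by apply/bigmax_geP; right => /=; exists (0, i).
by rewrite lebn_cube // ltry.
Qed.

(** The integrands are continuous on the whole space, hence bounded on a closed ball containing [D];
    this settles integrability on cells and reference simplexes. *)
Lemma continuous_rv_integrable n (D : set 'rV[R]_n) (f : 'rV[R]_n -> R) :
  continuous f -> rv_measurable D -> bounded_set D -> rv_integrable D f.
Proof.
move=> cf mD bD; apply: measurable_bounded_integrable => //.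
- exact: bounded_rv_finite.
- by apply: measurable_funTS; exact: continuous_rv_measurable.
case: bD => M [_ /(_ (`|M| + 1))] h.
have M1 : M < `|M| + 1 by rewrite (le_lt_trans (ler_norm _))// ltrDl.
pose K := [set x : 'rV[R]_n | `|x| <= `|M| + 1].
have cK : compact K.
  apply: bounded_closed_compact.
    exists (`|M| + 1); split; first exact: num_real.
    by move=> r Mr x /= xK; rewrite (le_trans xK) // ltW.
  apply: (@closed_comp _ _ (fun x : 'rV[R]_n => `|x|) [set y : R | y <= `|M| + 1]).
    by move=> x _; exact: norm_continuous.
  exact: closed_le.
have /compact_bounded[N [_ /(_ (`|N| + 1))]] := continuous_compact (continuous_subspaceT cf) cK.
have N1 : N < `|N| + 1 by rewrite (le_lt_trans (ler_norm _))// ltrDl.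
move=> /(_ N1) hN; exists (`|N| + 1); split; first exact: num_real.
move=> r Nr t /= Dt; apply: le_trans (ltW Nr); apply: hN.
by exists (rv t) => //=; exact: h.
Qed.

End RowVectors.

(** * Linearity, null sets and affine substitution for [lint] *)

Section RowIntegrals.
Context {R : realType}.
Local Notation rv := (@rv_of_tuple R _).

Lemma rv_integrableD n (D : set 'rV[R]_n) f g : rv_measurable D ->
  rv_integrable D f -> rv_integrable D g -> rv_integrable D (fun x => f x + g x).
Proof. by move=> mD iF ig; exact: (integrableD mD iF ig). Qed.

Lemma rv_integrableZ n (D : set 'rV[R]_n) c f : rv_measurable D ->
  rv_integrable D f -> rv_integrable D (fun x => c * f x).
Proof. by move=> mD iF; exact: (integrableZl mD c iF). Qed.

Lemma rv_integrableS n (D E : set 'rV[R]_n) f : rv_measurable D -> rv_measurable E ->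
  E `<=` D -> rv_integrable D f -> rv_integrable E f.
Proof. by move=> mD mE ED; apply: integrableS => // t; exact: ED. Qed.

Lemma lintD n (D : set 'rV[R]_n) f g : rv_measurable D ->
  rv_integrable D f -> rv_integrable D g ->
  lint D (fun x => f x + g x) = lint D f + lint D g.
Proof. by move=> mD iF ig; exact: (RintegralD mD iF ig). Qed.

Lemma lintZ n (D : set 'rV[R]_n) c f : rv_measurable D ->
  rv_integrable D f -> lint D (fun x => c * f x) = c * lint D f.
Proof. by move=> mD iF; exact: (RintegralZl c mD iF). Qed.

Lemma eq_lint n (D : set 'rV[R]_n) f g :
  (forall x, D x -> f x = g x) -> lint D f = lint D g.
Proof. by move=> fg; apply: eq_Rintegral => t /[!inE] Dt; exact: fg. Qed.

Lemma rv_integrable0 n (D : set 'rV[R]_n) : rv_integrable D (fun=> 0).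
Proof. exact: integrable0. Qed.

Lemma lint0 n (D : set 'rV[R]_n) : lint D (fun=> 0) = 0.
Proof. by rewrite /lint /Rintegral integral0. Qed.

Lemma lint0_eq n (D : set 'rV[R]_n) f : (forall x, D x -> f x = 0) -> lint D f = 0.
Proof. by move=> f0; rewrite (eq_lint f0) lint0. Qed.

Lemma rv_integrable_sum n (I : Type) (r : seq I) (P : pred I) (D : set 'rV[R]_n) (f : I -> _) :
  rv_measurable D -> (forall i, P i -> rv_integrable D (f i)) ->
  rv_integrable D (fun x => \sum_(i <- r | P i) f i x).
Proof.
move=> mD fi; elim: r => [|i r IHr].
  rewrite (_ : (fun x => _) = fun=> 0); first exact: rv_integrable0.
  by apply/funext => x; rewrite big_nil.
rewrite (_ : (fun x => _) = fun x => if P i then f i x + \sum_(j <- r | P j) f j x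
    else \sum_(j <- r | P j) f j x); last by apply/funext => x; rewrite big_cons.
case Pi: (P i) => //.
by apply: rv_integrableD => //; exact: fi.
Qed.

Lemma lint_sum n (I : Type) (r : seq I) (P : pred I) (D : set 'rV[R]_n) (f : I -> _) :
  rv_measurable D -> (forall i, P i -> rv_integrable D (f i)) ->
  lint D (fun x => \sum_(i <- r | P i) f i x) = \sum_(i <- r | P i) lint D (f i).
Proof.
move=> mD fi; elim: r => [|i r IHr].
  by rewrite big_nil -[RHS](lint0 D); apply: eq_lint => x _; rewrite big_nil.
rewrite big_cons (_ : (fun x => _) = fun x => if P i then f i x + \sum_(j <- r | P j) f j x
    else \sum_(j <- r | P j) f j x); last by apply/funext => x; rewrite big_cons.
case Pi: (P i) => //.
rewrite lintD ?IHr//; first exact: fi.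
exact: rv_integrable_sum.
Qed.

Lemma rv_nullU n (D E : set 'rV[R]_n) : rv_null D -> rv_null E -> rv_null (D `|` E).
Proof.
move=> [mD D0] [mE E0]; split; first exact: measurableU.
by rewrite preimage_setU measureU0.
Qed.

Lemma rv_null_sub n (D E : set 'rV[R]_n) : rv_measurable E -> E `<=` D -> rv_null D -> rv_null E.
Proof.
move=> mE ED [mD D0]; split => //; apply: subset_measure0 D0 => //.
by move=> t; exact: ED.
Qed.

Lemma rv_null0 n : rv_null (set0 : set 'rV[R]_n).
Proof. by split; rewrite ?/rv_measurable preimage_set0 // measure0. Qed.

Lemma rv_null_bigcup n (I : finType) (P : pred I) (D : I -> set 'rV[R]_n) :
  (forall i, P i -> rv_null (D i)) -> rv_null (\big[setU/set0]_(i | P i) D i).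
Proof.
by move=> h; elim/big_ind: _ => //; [exact: rv_null0 | exact: rv_nullU].
Qed.

Lemma lint_setD_null n (D N : set 'rV[R]_n) f : rv_measurable D -> rv_null N ->
  rv_integrable D f -> lint D f = lint (D `\` N) f.
Proof.
move=> mD [mN N0] iF.
by rewrite /lint /Rintegral (negligible_integral mN mD iF N0).
Qed.

Lemma lint_eq_null n (D E N : set 'rV[R]_n) f : rv_measurable D -> rv_measurable E ->
  rv_null N -> D `\` E `<=` N -> E `\` D `<=` N ->
  rv_integrable D f -> rv_integrable E f -> lint D f = lint E f.
Proof.
move=> mD mE N0 DE ED iD iE.
rewrite (lint_setD_null mD N0 iD) (lint_setD_null mE N0 iE); congr lint.
apply/seteqP; split=> x [Dx Nx]; split=> //; apply: contrapT => nx; apply: Nx.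
  exact: DE.
exact: ED.
Qed.

Lemma in_preimage_aff n m (A : 'M[R]_(n, m)) b (D : set 'rV[R]_m) t :
  (aff A b t \in rv @^-1` D) = (t \in rv @^-1` [set x | D (x *m A + b)]).
Proof. by apply/idP/idP; rewrite !inE /= /aff tuple_of_rvK. Qed.

Lemma rv_affine_measurable n m (A : 'M[R]_(n, m)) b (D : set 'rV[R]_m) :
  rv_measurable D -> rv_measurable [set x | D (x *m A + b)].
Proof.
move=> mD; have := measurable_aff A b measurableT mD; rewrite setTI.
by congr measurable; apply/seteqP; split=> t; rewrite /= /aff tuple_of_rvK.
Qed.

(** The nonnegative formula is applied to the positive and negative parts of the extension of [f] by
    0. *)
Lemma lint_affine n (A : 'M[R]_n) b (D : set 'rV[R]_n) f : A \in unitmx ->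
  rv_measurable D -> rv_integrable D f ->
  lint D f = `|\det A| * lint [set x | D (x *m A + b)] (fun x => f (x *m A + b)).
Proof.
move=> uA mD iF; have mD' := rv_affine_measurable A b mD.
pose g := (EFin \o (f \o rv)) \_ (rv @^-1` D).
have ig : (lebn R n).-integrable setT g.
  by apply/integrable_restrict => //; rewrite setTI.
have mg : measurable_fun setT g by case/integrableP: ig.
have d0 : (0 < `|\det A|%:E)%E.
  by rewrite lte_fin normr_gt0 -unitfE -unitmxE.
have E : (\int[lebn R n]_t g t = `|\det A|%:E * \int[lebn R n]_t (g (aff A b t)))%E.
  have -> : (\int[lebn R n]_t (g (aff A b t)) = \int[lebn R n]_t (g^\+ (aff A b t)) -
      \int[lebn R n]_t (g^\- (aff A b t)))%E.
    by rewrite integralE; congr (_ - _)%E; apply: eq_integral => t _; rewrite ?funeposE ?funenegE.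
  rewrite [LHS]integralE.
  have mgp : measurable_fun setT g^\+%E by exact: measurable_funepos.
  have mgn : measurable_fun setT g^\-%E by exact: measurable_funeneg.
  have Ep := lebn_scales_unitmx b uA mgp (fun t => funepos_ge0 _ _).
  have En := lebn_scales_unitmx b uA mgn (fun t => funeneg_ge0 _ _).
  have : (\int[lebn R n]_t g^\+%E t < +oo)%E by exact: integral_funepos_lt_pinfty.
  have : (0 <= \int[lebn R n]_t (g^\+ (aff A b t)))%E.
    by apply: integral_ge0 => t _; exact: funepos_ge0.
  rewrite Ep En; move: (\int[lebn R n]_t g^\+ _)%E (\int[lebn R n]_t g^\- _)%E => y z y0 lt.
  (* Factoring out the determinant needs a difference that is not [oo - oo]: [y] is finite because
     [g] is integrable and [|det A|] is positive. *)
  rewrite -muleBr //; apply: fin_num_adde_defr.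
  by move: y0 lt; case: y => [r||] //; rewrite gt0_muley.
rewrite /lint /Rintegral [in LHS]integral_mkcond E.
rewrite [X in (_ * X)%E](_ : _ = \int[lebn R n]_(t in rv @^-1` [set x | D (x *m A + b)%R])
   (f (rv t *m A + b)%R)%:E)%E; last first.
  rewrite [RHS]integral_mkcond; apply: eq_integral => t _.
  rewrite /g !patchE /= in_preimage_aff.
  by rewrite /aff tuple_of_rvK.
(* For an infinite integral both sides are 0, since [fine] sends infinities to 0. *)
case: (\int[lebn R n]_(t in _) _)%E => [r||] //=.
  by rewrite gt0_muley //= mulr0.
by rewrite gt0_muleNy //= mulr0.
Qed.

Lemma rv_null_affine n (A : 'M[R]_n) b (D : set 'rV[R]_n) : A \in unitmx ->
  rv_null D -> rv_null [set x | D (x *m A + b)].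
Proof.
move=> uA [mD D0]; have mD' := rv_affine_measurable A b mD; split => //.
have mi : measurable_fun setT (EFin \o \1_(rv @^-1` D) : n.-tuple _ -> \bar R).
  exact/measurable_EFinP/measurable_indic.
have := lebn_scales_unitmx b uA mi (fun t => ltac:(by rewrite lee_fin)).
have iE E : rv_measurable E -> (\int[lebn R n]_t (\1_(rv @^-1` E) t)%:E = lebn R n (rv @^-1` E))%E.
  by move=> mE; rewrite integral_indic // setIT.
rewrite [X in X = _](iE _ mD) [X in X = _]D0.
rewrite [X in _ = (_ * X)%E](_ : _ = lebn R n (rv @^-1` [set x | D (x *m A + b)])); last first.
  by rewrite -(iE _ mD'); apply: eq_integral => t _ /=; rewrite !indicE in_preimage_aff.
move=> /esym/eqP; rewrite mule_eq0 eqe normr_eq0.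
by have := uA; rewrite unitmxE unitfE => /negbTE -> /= /eqP.
Qed.

Lemma rv_null_coord n (c : R) : rv_null [set x : 'rV[R]_(1 + n) | x 0 0 = c].
Proof.
have mD : rv_measurable [set x : 'rV[R]_(1 + n) | x 0 0 = c].
  apply: closed_rv_measurable.
  apply: (@closed_comp _ _ (fun x : 'rV[R]_(1 + n) => x 0 0) [set c]) => [x _|].
    exact: coord_continuous.
  exact: closed_eq.
split => //.
rewrite [LHS](_ : _ = (lebesgue_measure \x lebn R n)%E
  (@tcons R n @^-1` (rv @^-1` [set x : 'rV[R]_(1 + n) | x 0 0 = c])))//.
have -> : @tcons R n @^-1` (rv @^-1` [set x : 'rV[R]_(1 + n) | x 0 0 = c]) = [set c] `*` setT.
  by apply/seteqP; split=> -[x t] /=; rewrite mxE // => -[].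
rewrite product_measure1E; [|exact: measurable_set1|exact: measurableT].
by rewrite -[X in (X * _)%E]/(lebesgue_measure [set c]) lebesgue_measure_set1 mul0e.
Qed.

Lemma ball_cube n (c : 'rV[R]_n) e : 0 < e -> ball c e = cube c e.
Proof.
move=> e0; apply/seteqP; split=> x.
  by move=> [_ h] i; have := h 0 i; rewrite /ball /= distrC.
by move=> h; split=> // i j; rewrite ord1 /ball /= distrC; exact: h.
Qed.

(** If [f x > 0] then [f > f x / 2] near [x]. As [D] lies in the closure of its interior, this
    neighbourhood contains a cube inside [D], whose contribution to the integral is positive. *)
Lemma lint_eq0 n (D : set 'rV[R]_n) (f : 'rV[R]_n -> R) : continuous f ->
  (forall x, 0 <= f x) -> rv_measurable D -> bounded_set D -> D `<=` closure D° ->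
  lint D f = 0 -> forall x, D x -> f x = 0.
Proof.
move=> cf f0 mD bD DD D0 x Dx; apply/eqP/negP => /negP fx.
have fx0 : 0 < f x by rewrite lt_def fx f0.
pose c := f x / 2.
have [y [Dy yU]] : D° `&` [set z | c < f z] !=set0.
  apply: (DD _ Dx); apply: (@open_nbhs_nbhs _ _ [set z | c < f z]); split.
    apply: (@open_comp _ _ f [set z | c < z]) => [z _|]; [exact: cf | exact: open_gt].
  by rewrite /= /c ltr_pdivrMr // ltr_pMr // ltr1n.
have oU : nbhs y [set z | c < f z].
  apply: open_nbhs_nbhs; split => //.
  by apply: (@open_comp _ _ f [set z | c < z]) => [z _|]; [exact: cf | exact: open_gt].
have /nbhs_ballP[r /= r0 rU] : nbhs y (D `&` [set z | c < f z]).
  exact: filterI.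
rewrite ball_cube // in rU.
have iD := continuous_rv_integrable cf mD bD.
have mC := cube_measurable y r.
have mf : measurable_fun setT (EFin \o (f \o rv)).
  by apply/measurable_EFinP; exact: continuous_rv_measurable.
have : ((c * (2 * r) ^+ n)%:E <= \int[lebn R n]_(t in rv @^-1` D) (f (rv t))%:E)%E.
  apply: (@le_trans _ _ (\int[lebn R n]_(t in rv @^-1` cube y r) (f (rv t))%:E)%E).
    rewrite EFinM -(lebn_cube y r0) -integral_cst //.
    apply: ge0_le_integral => //.
    - by move=> t _; rewrite lee_fin /c divr_ge0.
    - exact: measurable_funTS mf.
    - by move=> t /rU[_ /= h]; rewrite lee_fin ltW.
  apply: ge0_subset_integral => //.
  - exact: measurable_funTS mf.
  - by move=> t _; rewrite lee_fin.
  - by move=> t /rU[].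
rewrite -[X in (_ <= X)%E]fineK; last exact: integrable_fin_num.
rewrite lee_fin -[fine _]/(lint D f) D0 leNgt => /negP; apply.
by rewrite mulr_gt0 ?divr_gt0 // exprn_gt0 // mulr_gt0.
Qed.

End RowIntegrals.

(** * Directional derivatives *)

Section DirectionalDerivatives.
Context {R : realType} {V : normedModType R}.

(** Both derivatives are limits of the same difference quotient; one-variable calculus thus applies
    to directional derivatives. *)
Lemma is_derive_line (F : V -> R) (p v : V) (s a : R) :
  is_derive (p + s *: v) v F a <-> is_derive s 1 (fun s => F (p + s *: v)) a.
Proof.
have E : (fun h : R => h^-1 *: (((fun s => F (p + s *: v)) \o shift s) (h *: 1) - F (p + s *: v))) =
    (fun h : R => h^-1 *: ((F \o shift (p + s *: v)) (h *: v) - F (p + s *: v))).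
  apply/funext => h /=; congr (_ *: (F _ - _)).
  by rewrite [h *: 1]mulr1 scalerDl addrCA.
split=> -[dF Fa]; split.
- by rewrite /derivable E.
- by rewrite /derive E.
- by move: dF; rewrite /derivable E.
- by move: Fa; rewrite /derive E.
Qed.

Lemma is_derive_continuous1 (f : R -> R) (df : R -> R) :
  (forall x : R, is_derive x 1 f (df x)) -> continuous f.
Proof.
by move=> hf x; apply: differentiable_continuous; apply/derivable1_diffP; case: (hf x).
Qed.

Lemma is_derive_scale (F : V -> R) (x v : V) (c a : R) :
  is_derive x v F a -> is_derive x (c *: v) F (c * a).
Proof.
rewrite -{1}[x]addr0 -{1}(scale0r v) => /is_derive_line h.
rewrite -{1}[x]addr0 -{1}(scale0r (c *: v)); apply/is_derive_line.
rewrite (_ : (fun s => _) = (fun s => F (x + s *: v)) \o (fun s => s * c)); last first.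
  by apply/funext => s /=; rewrite scalerA.
rewrite mulrC; apply: is_derive1_comp.
  by rewrite mul0r.
rewrite (_ : (fun s => s * c) = c \*: id); last by apply/funext => s; rewrite /= mulrC.
by apply: is_derive_eq; rewrite [_ *: _]mulr1.
Qed.

(** Additivity in the direction, without Frechet differentiability: by the mean value theorem the
    extra increment along [h *: w] is [h] times [D] at a point tending to [x], and [D] is
    continuous. *)
Lemma is_deriveDdir (F D : V -> R) (x v w : V) (a : R) :
  (forall y, is_derive y w F (D y)) -> continuous D ->
  is_derive x v F a -> is_derive x (v + w) F (a + D x).
Proof.
move=> hw cD [dF Fa].
have /choice[th thP] (h : R) : exists t : R, 0 <= t <= 1 /\
    F (h *: (v + w) + x) - F (h *: v + x) = h * D (h *: v + x + t *: (h *: w)).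
  have hd (s : R) : is_derive s 1 (fun s => F (h *: v + x + s *: (h *: w)))
      (h * D (h *: v + x + s *: (h *: w))).
    by apply/is_derive_line; apply: is_derive_scale.
  have [|t] := @MVT_segment R _ _ 0 1 ler01 (fun s _ => hd s).
    by apply: continuous_subspaceT; exact: is_derive_continuous1 hd.
  rewrite in_itv /= subr0 mulr1 scale1r scale0r addr0 => t01 E; exists t; split => //.
  by rewrite -E scalerDr addrAC.
suff L : h^-1 *: ((F \o shift x) (h *: (v + w)) - F x) @[h --> 0^'] --> a + D x.
  by split; [apply/cvg_ex; exists (a + D x) | exact: cvg_lim L].
have L : h^-1 *: ((F \o shift x) (h *: v) - F x) @[h --> 0^'] --> a.
  by rewrite -Fa.
have LD : D (h *: v + x + th h *: (h *: w)) @[h --> 0^'] --> D x.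
  apply: (@cvg_comp _ _ _ (fun h : R => h *: v + x + th h *: (h *: w)) D _ (nbhs x)); last exact: cD.
  apply/cvgrPdist_lt => e e0; near=> h.
  (* The added 1 keeps the divisor positive when [v] and [w] vanish. *)
  have hM : `|h| * (`|v| + `|w| + 1) < e.
    rewrite -ltr_pdivlMr; last by rewrite ltr_wpDl.
    near: h; apply: dnbhs0_lt.
    by rewrite divr_gt0 // ltr_wpDl.
  apply: le_lt_trans hM; have [/andP[t0 t1] _] := thP h.
  rewrite opprD addrA opprD addrCA subrr addr0 -opprD normrN (le_trans (ler_normD _ _)) //.
  rewrite !normrZ (ger0_norm t0) mulrDr mulrDr mulr1 -addrA lerD2l.
  by apply: (@le_trans _ _ (`|h| * `|w|)); rewrite ?ler_piMl ?mulr_ge0 ?lerDl.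
have E : \forall h \near 0^', h^-1 *: ((F \o shift x) (h *: v) - F x) + D (h *: v + x + th h *: (h *: w)) =
   h^-1 *: ((F \o shift x) (h *: (v + w)) - F x).
  near=> h.
  have h0 : h != 0 by near: h; exact: nbhs_dnbhs_neq.
  have [_ /eqP] := thP h; rewrite subr_eq => /eqP Eh.
  rewrite /= Eh -[X in X + _ = _]/(h^-1 * _) -[RHS]/(h^-1 * _).
  by field.
apply: cvg_trans (cvgD L LD).
apply: near_eq_cvg; exact: E.
Unshelve. all: by end_near.
Qed.
End DirectionalDerivatives.

(** * The reference simplex *)

Section RefSimplex.
Context {R : realType}.
Local Notation rv := (@rv_of_tuple R _).
Local Notation leb := (@lebesgue_measure R).

Lemma continuous_sum (T : topologicalType) (I : Type) (r : seq I) (P : pred I) (f : I -> T -> R) :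
  (forall i, P i -> continuous (f i)) -> continuous (fun x => \sum_(i <- r | P i) f i x).
Proof.
move=> cf; elim: r => [|i r IHr].
  by rewrite (_ : (fun x => _) = cst 0); [exact: cst_continuous | apply/funext => x; rewrite big_nil].
rewrite (_ : (fun x => _) = fun x => if P i then f i x + \sum_(j <- r | P j) f j x
    else \sum_(j <- r | P j) f j x); last by apply/funext => x; rewrite big_cons.
case Pi: (P i) => // x; apply: cvgD; [exact: cf | exact: IHr].
Qed.

Lemma continuous_add (T : topologicalType) (f g : T -> R) :
  continuous f -> continuous g -> continuous (fun x => f x + g x).
Proof. by move=> cf cg x; apply: cvgD; [exact: cf | exact: cg]. Qed.

Lemma continuous_mul (T : topologicalType) (f g : T -> R) :
  continuous f -> continuous g -> continuous (fun x => f x * g x).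
Proof. by move=> cf cg x; apply: cvgM; [exact: cf | exact: cg]. Qed.

Lemma continuous_mull (T : topologicalType) (c : R) (f : T -> R) :
  continuous f -> continuous (fun x => c * f x).
Proof. by move=> cf; apply: continuous_mul => //; exact: cst_continuous. Qed.

Definition unit_row n (j : nat) : 'rV[R]_n := \row_(i < n) (i == j :> nat)%:R.

(** Phrased by partial derivatives, to match [Ck] and to be checked on monomials; [is_deriveDdir]
    recovers the other directional derivatives from it. *)
Definition C1 n (F : 'rV[R]_n -> R) :=
  [/\ continuous F, forall (j : 'I_n) x, derivable F x (unit_row n j)
    & forall j : 'I_n, continuous (pderiv j F)].

Lemma row_unit_sum n (v : 'rV[R]_n) : v = \sum_(i < n) v 0 i *: unit_row n i.
Proof.
apply/rowP => j; rewrite summxE (bigD1 j) //= !mxE eqxx mulr1 big1 ?addr0 // => i ij.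
by rewrite !mxE val_eqE eq_sym (negbTE ij) mulr0.
Qed.

(** The coordinate directions of [v] are added one at a time, each addition using the continuity of
    one partial derivative. *)
Lemma C1_is_derive n (F : 'rV[R]_n -> R) x v :
  C1 F -> is_derive x v F (dot v (grad F x)).
Proof.
move=> [_ dF cF].
have -> : dot v (grad F x) = \sum_(i < n) v 0 i * pderiv i F x.
  by apply: eq_bigr => i _; rewrite mxE.
rewrite [v in is_derive _ v]row_unit_sum.
elim: (index_enum _) => [|i r IHr].
  rewrite !big_nil -(scale0r v) -{2}(mul0r (dot v (grad F x))).
  split.
    apply/derivable1P; rewrite (_ : (fun h => _) = cst (F x)) ; first exact: derivable_cst.
    by apply/funext => h; rewrite scale0r scaler0 add0r.
  rewrite mul0r /derive (_ : (fun h => _) = fun=> 0); first exact: lim_cst.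
  by apply/funext => h /=; rewrite scale0r scaler0 add0r subrr scaler0.
rewrite !big_cons addrC [X in is_derive _ _ _ X]addrC.
apply: (is_deriveDdir (D := fun y => v 0 i * pderiv i F y)) => //.
  by move=> y; apply: is_derive_scale; exact: derivableP.
exact: continuous_mull.
Qed.

Lemma dot_grad_continuous n (F : 'rV[R]_n -> R) v : C1 F ->
  continuous (fun x => dot v (grad F x)).
Proof.
move=> [_ _ cF]; rewrite /dot (_ : (fun x => _) = fun x => \sum_(i < n) v 0 i * pderiv i F x).
  by apply: continuous_sum => i _; exact: continuous_mull.
by apply/funext => x; apply: eq_bigr => i _; rewrite mxE.
Qed.

Lemma row_continuous (V : topologicalType) n (f : V -> 'rV[R]_n) :
  (forall i, continuous (fun x => f x 0 i)) -> continuous f.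
Proof.
move=> cf x U [P PU] sPU; rewrite /nbhs /=.
have : \forall y \near x, forall i, P 0 i (f y 0 i).
  by apply: filter_forall => i; apply: cf; exact: PU.
by apply: filterS => y Py; apply: sPU => i j; rewrite ord1.
Qed.

Lemma affine_continuous n m (A : 'M[R]_(n, m)) b : continuous (fun x : 'rV[R]_n => x *m A + b).
Proof.
apply: row_continuous => i.
rewrite (_ : (fun x => _) = fun x : 'rV[R]_n => (\sum_j x 0 j * A j i) + b 0 i).
  apply: continuous_add; last exact: cst_continuous.
  apply: continuous_sum => j _; apply: continuous_mul; last exact: cst_continuous.
  exact: coord_continuous.
by apply/funext => x; rewrite !mxE.
Qed.

Lemma row_mx_continuous n (t : 'rV[R]_n) : continuous (fun s : R => row_mx s%:M t : 'rV[R]_(1 + n)).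
Proof.
apply: row_continuous => i; case: (splitP i) => j ij.
  have -> : i = lshift n j by exact/val_inj.
  rewrite (_ : (fun x : R => _) = id); first by move=> s; exact: cvg_id.
  by apply/funext => x; rewrite row_mxEl mxE ord1 eqxx mulr1n.
have -> : i = rshift 1 j by exact/val_inj.
rewrite (_ : (fun x : R => _) = cst (t 0 j)); first exact: cst_continuous.
by apply/funext => x; rewrite row_mxEr.
Qed.

Definition row_sum n (t : 'rV[R]_n) := \sum_i t 0 i.

Lemma row_sum_continuous n : continuous (@row_sum n).
Proof. by apply: continuous_sum => i _; exact: coord_continuous. Qed.

Lemma ref_simplex_bounded n : bounded_set (@ref_simplex R n).
Proof.
exists 1; split => // M M1 x [x0 x1]; apply: le_trans (ltW M1).
rewrite [leLHS]/Num.norm /= mx_normrE; apply/bigmax_leP; split => // -[i j] _ /=.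
rewrite ord1 ger0_norm //; apply: le_trans x1.
by rewrite (bigD1 j) //= lerDl sumr_ge0.
Qed.

Lemma ref_simplex_closed n : closed (@ref_simplex R n).
Proof.
rewrite (_ : ref_simplex (n:=n) = \bigcap_(i in [set: 'I_n]) [set x : 'rV[R]_n | 0 <= x 0 i]
   `&` [set x : 'rV[R]_n | row_sum x <= 1]).
  apply: closedI.
    apply: closed_bigI => i _; apply: (@closed_comp _ _ (fun x : 'rV[R]_n => x 0 i) [set y | 0 <= y]).
      by move=> x _; exact: coord_continuous.
    exact: closed_ge.
  apply: (@closed_comp _ _ (@row_sum n) [set y | y <= 1]).
    by move=> x _; exact: row_sum_continuous.
  exact: closed_le.
by apply/seteqP; split=> x [x0 x1]; split => // i; [move=> _; exact: x0 | exact: x0].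
Qed.

Lemma ref_simplex_measurable n : rv_measurable (@ref_simplex R n).
Proof. by apply: closed_rv_measurable; exact: ref_simplex_closed. Qed.

Definition open_simplex n := [set x : 'rV[R]_n | (forall i, 0 < x 0 i) /\ row_sum x < 1].

Lemma open_simplex_open n : open (@open_simplex n).
Proof.
have o1 : open [set x : 'rV[R]_n | row_sum x < 1].
  apply: (@open_comp _ _ (@row_sum n) [set y | y < 1]); last exact: open_lt.
  by move=> x _; exact: row_sum_continuous.
rewrite openE => x [x0 x1]; suff h : nbhs x [set y : 'rV[R]_n | forall i, 0 < y 0 i].
  exact: filterI h (open_nbhs_nbhs (conj o1 x1)).
apply: (@filter_forall _ _ (fun i => [set y : 'rV[R]_n | 0 < y 0 i]) _ (nbhs_filter x)) => i.
apply: (@open_nbhs_nbhs _ _ [set x : 'rV[R]_n | 0 < x 0 i]); split; last exact: x0.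
apply: (@open_comp _ _ (fun x : 'rV[R]_n => x 0 i) [set y | 0 < y]); last exact: open_gt.
by move=> y _; exact: coord_continuous.
Qed.

(** A point is moved slightly towards the barycentre, all of whose barycentric coordinates equal
    [1 / (n + 1)]; a convex combination giving it positive weight lies in the open simplex. *)
Lemma ref_simplex_closure n : @ref_simplex R n `<=` closure (@open_simplex n).
Proof.
move=> x [x0 x1] B /nbhs_ballP[e /= e0 eB].
pose c : 'rV[R]_n := const_mx (n.+1%:R^-1).
have n0 : 0 < n.+1%:R^-1 :> R by rewrite invr_gt0 ltr0n.
have c1 : row_sum c < 1.
  rewrite /row_sum (eq_bigr (fun=> n.+1%:R^-1)) => [|i _]; last by rewrite mxE.
  rewrite sumr_const card_ord -[_ *+ _]mulr_natl ltr_pdivrMr ?ltr0n // mul1r ltr_nat //.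
pose M := `|c - x| + 1.
have M0 : 0 < M by rewrite ltr_wpDl.
(* The bound [1 / 2] keeps [1 - d] positive, the other one makes the displacement [d * |c - x|]
   smaller than [e]. *)
pose d := Num.min (1 / 2) (e / (2 * M)).
have d0 : 0 < d by rewrite lt_min !divr_gt0 // mulr_gt0.
have d1 : d < 1 by rewrite gt_min; apply/orP; left; lra.
exists (x + d *: (c - x)); split.
  split=> [i|].
    rewrite !mxE [X in 0 < X](_ : _ = (1 - d) * x 0 i + d * n.+1%:R^-1); last by ring.
    by rewrite ltr_wpDl ?mulr_gt0 // mulr_ge0 // subr_ge0 ltW.
  rewrite /row_sum (eq_bigr (fun i => (1 - d) * x 0 i + d * c 0 i)); last by move=> i _; rewrite !mxE; ring.
  rewrite big_split /= -!mulr_sumr -/(row_sum c) -/(row_sum x).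
  have : row_sum x <= 1 by [].
  nra.
apply: eB; rewrite -ball_normE /= opprD addrA subrr sub0r normrN normrZ gtr0_norm //.
have : d <= e / (2 * M) by rewrite ge_min lexx orbT.
rewrite ler_pdivlMr ?mulr_gt0 // => h.
have : `|c - x| < M by rewrite /M ltrDl.
nra.
Qed.

End RefSimplex.

(** * The fundamental theorem of calculus on the reference simplex *)

Section RefSimplexFTC.
Context {R : realType}.
Local Notation rv := (@rv_of_tuple R _).
Local Notation leb := (@lebesgue_measure R).

Lemma lebn_fubini n (F : n.+1.-tuple (measurableTypeR R) -> \bar R) :
  (lebn R n.+1).-integrable setT F ->
  (\int[lebn R n.+1]_t F t = \int[lebn R n]_t \int[leb]_x F (tcons (x, t)))%E.
Proof.
move=> /integrableP[mF iF]; have mc := @measurable_tcons R n.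
have i2 : (leb \x lebn R n)%E.-integrable setT (F \o @tcons R n).
  apply/integrableP; split; first exact: measurableT_comp.
  move: iF; rewrite ge0_integral_pushforward //=.
  exact: measurableT_comp.
rewrite [LHS](_ : _ = \int[leb \x lebn R n]_z (F \o @tcons R n) z)%E; last first.
  by rewrite [LHS]integral_pushforward.
by rewrite -integral21_prod_meas1.
Qed.

Lemma row_sum_row_mx n (x : R) (t : 'rV[R]_n) :
  row_sum (row_mx x%:M t : 'rV[R]_(1 + n)) = x + row_sum t.
Proof.
rewrite /row_sum big_split_ord big_ord1 row_mxEl mxE eqxx mulr1n; congr (_ + _).
by apply: eq_bigr => i _; rewrite row_mxEr.
Qed.

Lemma ref_simplex_row_mx n (x : R) (t : 'rV[R]_n) :
  ref_simplex (row_mx x%:M t : 'rV[R]_(1 + n)) <->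
  ref_simplex t /\ 0 <= x <= 1 - row_sum t.
Proof.
rewrite /ref_simplex /= -!/(row_sum _) row_sum_row_mx lerBrDr; split.
  move=> [h0 h1].
  have x0 : 0 <= x by have := h0 (lshift n 0); rewrite row_mxEl mxE mulr1n.
  split; last by rewrite x0.
  split; first by move=> i; have := h0 (rshift 1 i); rewrite row_mxEr.
  by apply: le_trans h1; rewrite lerDr.
move=> [[t0 t1] /andP[x0 x1]]; split => // i.
rewrite -(splitK i); case: (fintype.split i) => j /=; last by rewrite row_mxEr.
by rewrite row_mxEl mxE ord1 mulr1n.
Qed.

(** Over [t] the section of the simplex is the segment [[0, 1 - row_sum t]], so integrating in the
    first coordinate leaves the values of [G] at its endpoints: on the slanted face and on the face
    where that coordinate is 0. *)
Lemma lint_ref_FTC n (G G' : 'rV[R]_(1 + n) -> R) : continuous G' ->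
  (forall x, is_derive x (row_mx 1%:M 0) G (G' x)) ->
  lint (@ref_simplex R (1 + n)) G' =
  lint (@ref_simplex R n) (fun t => G (row_mx (1 - row_sum t)%:M t) - G (row_mx 0%:M t)).
Proof.
move=> cG' dG.
have iG := continuous_rv_integrable cG' (@ref_simplex_measurable R (1 + n)) (@ref_simplex_bounded R (1 + n)).
pose F := (EFin \o (G' \o rv)) \_ (rv @^-1` (@ref_simplex R (1 + n))).
have iF : (lebn R (1 + n)).-integrable setT F.
  by apply/integrable_restrict; rewrite ?setTI //; exact: ref_simplex_measurable.
rewrite /lint /Rintegral [in LHS]integral_mkcond -/F (lebn_fubini iF) [in RHS]integral_mkcond.
congr fine; apply: eq_integral => t _; rewrite patchE; case: ifPn => /= Ht; last first.
  apply: integral0_eq => x _; rewrite /F patchE ifF //; apply/negP => /set_mem /=.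
  rewrite rv_tcons => /ref_simplex_row_mx[h _]; move/negP: Ht; apply; exact/mem_set.
have {}Ht := set_mem Ht; rewrite /= in Ht.
pose a := 1 - row_sum (rv t).
have a0 : 0 <= a by rewrite subr_ge0; case: Ht.
pose g (x : R) := G' (row_mx x%:M (rv t) : 'rV[R]_(1 + n)).
transitivity (\int[leb]_(x in [set` `[0%R, a]]) (g x)%:E)%E.
  rewrite [RHS]integral_mkcond; apply: eq_integral => x _.
  rewrite /F !patchE /= rv_tcons; congr (if _ then _ else _).
  apply/idP/idP => /set_mem /= h; apply/mem_set => /=.
    by move: h; rewrite rv_tcons => /ref_simplex_row_mx[_]; rewrite in_itv.
  by rewrite rv_tcons; apply/ref_simplex_row_mx; split => //; rewrite in_itv in h.
pose p : 'rV[R]_(1 + n) := row_mx 0%:M (rv t).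
have pE (s : R) : row_mx s%:M (rv t) = p + s *: row_mx 1%:M 0 :> 'rV[R]_(1 + n).
  by rewrite /p scale_row_mx add_row_mx scaler0 addr0 scale_scalar_mx mulr1 raddf0 add0r.
have dg (s : R) : is_derive s 1 (fun s => G (row_mx s%:M (rv t) : 'rV[R]_(1 + n))) (g s).
  rewrite /g pE (_ : (fun s : R => _) = fun s => G (p + s *: row_mx 1%:M 0)).
    by apply: (iffLR (@is_derive_line R _ G p _ s _)); exact: dG.
  by apply/funext => r; rewrite pE.
have cg : continuous g.
  move=> s; apply: (@continuous_comp _ _ _ (fun s : R => row_mx s%:M (rv t) : 'rV[R]_(1 + n)) G').
    exact: row_mx_continuous.
  exact: cG'.
(* When the segment is a single point both sides are 0; the fundamental theorem asks for positive
   length. *)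
move: a0; rewrite le_eqVlt => /predU1P[a0|a0].
  by rewrite -/a -a0 set_itv1 integral_set1 subrr.
have cG1 := is_derive_continuous1 dg.
rewrite (continuous_FTC2 (F := fun s => G (row_mx s%:M (rv t) : 'rV[R]_(1 + n)))) //.
- exact: continuous_subspaceT.
- split => [x _||]; first by case: (dg x).
    exact/cvg_at_right_filter/cG1.
  exact/cvg_at_left_filter/cG1.
- by move=> x _; rewrite derive1E; case: (dg x).
Qed.

End RefSimplexFTC.

(** * Affine simplexes and the divergence theorem *)

Section AffineSimplex.
Context {R : realType} {d : nat}.
Local Notation V := 'rV[R]_d.

Definition edges m (P : 'I_m.+1 -> V) : 'M[R]_(m, d) :=
  \matrix_(i < m) (P (lift ord0 i) - P ord0).

Definition param m (P : 'I_m.+1 -> V) (t : 'rV[R]_m) : V := P ord0 + t *m edges P.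

(** The formula of [face_int] for an ordered family of points and any dimension [m]; for [m = d] the
    square root is [|det (edges P)|], so cells and faces share one notion. *)
Definition simplex_int m (P : 'I_m.+1 -> V) (f : V -> R) : R :=
  Num.sqrt (\det (edges P *m (edges P)^T)) * lint (@ref_simplex R m) (fun t => f (param P t)).

(** Barycentric coordinates in the reference simplex, whose vertex [ord0] is the origin. *)
Definition bary m (t : 'rV[R]_m) (k : 'I_m.+1) : R :=
  if unlift ord0 k is Some j then t 0 j else 1 - row_sum t.

Lemma bary0 m (t : 'rV[R]_m) : bary t ord0 = 1 - row_sum t.
Proof. by rewrite /bary unlift_none. Qed.

Lemma bary_lift m (t : 'rV[R]_m) i : bary t (lift ord0 i) = t 0 i.
Proof. by rewrite /bary liftK. Qed.

Lemma bary_sum m (t : 'rV[R]_m) : \sum_k bary t k = 1.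
Proof.
rewrite big_ord_recl bary0 (eq_bigr (fun i => t 0 i)) => [|i _]; last by rewrite bary_lift.
by rewrite subrK.
Qed.

Lemma row_bary m (l : 'I_m.+1 -> R) : \sum_k l k = 1 -> bary (\row_i l (lift ord0 i)) =1 l.
Proof.
rewrite big_ord_recl => l1 k; case: (unliftP ord0 k) => [i ->|->].
  by rewrite bary_lift mxE.
rewrite bary0 -l1 /row_sum [X in _ - X](eq_bigr (fun i => l (lift ord0 i))) ?addrK // => i _.
by rewrite mxE.
Qed.

Lemma mulmx_edges m (P : 'I_m.+1 -> V) (t : 'rV[R]_m) :
  t *m edges P = \sum_i t 0 i *: (P (lift ord0 i) - P ord0).
Proof. by rewrite mulmx_sum_row; apply: eq_bigr => i _; rewrite rowK. Qed.

Lemma param_bary m (P : 'I_m.+1 -> V) t : param P t = \sum_k bary t k *: P k.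
Proof.
rewrite /param mulmx_edges big_ord_recl bary0 scalerBl scale1r -addrA; congr (_ + _).
rewrite (eq_bigr (fun i => t 0 i *: P (lift ord0 i) - t 0 i *: P ord0)); last first.
  by move=> i _; rewrite scalerBr.
rewrite sumrB -scaler_suml addrC; congr (_ + _).
by apply: eq_bigr => i _; rewrite bary_lift.
Qed.

Lemma ref_simplexE m (t : 'rV[R]_m) : ref_simplex t <-> forall k, 0 <= bary t k.
Proof.
split=> [[t0 t1] k|h].
  by case: (unliftP ord0 k) => [i ->|->]; rewrite ?bary_lift // bary0 subr_ge0.
split=> [i|]; first by rewrite -bary_lift.
by have := h ord0; rewrite bary0 subr_ge0.
Qed.

Lemma open_simplexE m (t : 'rV[R]_m) : open_simplex t <-> forall k, 0 < bary t k.
Proof.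
split=> [[t0 t1] k|h].
  by case: (unliftP ord0 k) => [i ->|->]; rewrite ?bary_lift // bary0 subr_gt0.
split=> [i|]; first by rewrite -bary_lift.
by have := h ord0; rewrite bary0 subr_gt0.
Qed.

Lemma hull_param m (P : 'I_m.+1 -> V) : hull predT P = param P @` (@ref_simplex R m).
Proof.
apply/seteqP; split=> x.
  move=> [l [l0 l1 ->]]; have lE := row_bary l1.
  exists (\row_i l (lift ord0 i)); last by rewrite param_bary; apply: eq_bigr => k _; rewrite lE.
  by apply/ref_simplexE => k; rewrite lE; exact: l0.
move=> [t /ref_simplexE t0 <-]; exists (bary t); split => //; first exact: bary_sum.
by rewrite param_bary.
Qed.

(** An affine relation among the points is a linear relation among the edges: the coefficient of
    [P ord0] is minus the sum of the others. *)
Lemma affine_indep_row_free m (P : 'I_m.+1 -> V) : affine_indep predT P <-> row_free (edges P).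
Proof.
split=> [h|rf l l0 lP].
  apply/row_freeP; apply/row_freeP; rewrite -kermx_eq0; apply/rowV0P => v.
  move=> /sub_kermxP vE; pose l k := if unlift ord0 k is Some j then v 0 j else - row_sum v.
  have l0 : l ord0 = - row_sum v by rewrite /l unlift_none.
  have ll i : l (lift ord0 i) = v 0 i by rewrite /l liftK.
  have l1 : \sum_k l k = 0.
    by rewrite big_ord_recl l0 (eq_bigr (fun i => v 0 i)) ?addNr // => i _; rewrite ll.
  have lP : \sum_k l k *: P k = 0.
    rewrite big_ord_recl l0 -[RHS]vE mulmx_edges scaleNr /row_sum scaler_suml addrC -sumrB.
    by apply: eq_bigr => i _; rewrite ll scalerBr.
  by apply/rowP => i; rewrite mxE -ll; exact: (h l l1 lP).
pose v : 'rV[R]_m := \row_i l (lift ord0 i).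
have vE : v *m edges P = 0.
  rewrite mulmx_edges -[RHS]lP big_ord_recl.
  move: l0; rewrite big_ord_recl => /eqP; rewrite addr_eq0 => /eqP ->.
  rewrite scaleNr scaler_suml addrC -sumrB.
  by apply: eq_bigr => i _; rewrite mxE scalerBr.
have v0 : v = 0 by apply: (row_free_inj rf); rewrite mul0mx.
have ll i : l (lift ord0 i) = 0 by have /rowP/(_ i) := v0; rewrite !mxE.
move=> k _; case: (unliftP ord0 k) => [i ->|->] //.
by move: l0; rewrite big_ord_recl big1 ?addr0.
Qed.

Lemma param_inj m (P : 'I_m.+1 -> V) : row_free (edges P) -> injective (param P).
Proof. by move=> rf s t /addrI /(row_free_inj rf). Qed.

Lemma param_continuous m (P : 'I_m.+1 -> V) : continuous (param P).
Proof.
by rewrite (_ : param P = fun t => t *m edges P + P ord0); [exact: affine_continuous | apply/funext => t; rewrite addrC].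
Qed.

Lemma hull_compact m (P : 'I_m.+1 -> V) : compact (hull predT P).
Proof.
rewrite hull_param; apply: continuous_compact.
  by apply: continuous_subspaceT; exact: param_continuous.
by apply: bounded_closed_compact; [exact: ref_simplex_bounded | exact: ref_simplex_closed].
Qed.

Lemma hull_measurable m (P : 'I_m.+1 -> V) : rv_measurable (hull predT P).
Proof.
apply: closed_rv_measurable; apply: compact_closed; last exact: hull_compact.
exact: norm_hausdorff.
Qed.

Lemma hull_bounded m (P : 'I_m.+1 -> V) : bounded_set (hull predT P).
Proof. exact/compact_bounded/hull_compact. Qed.

(* Reordering the vertices changes the parametrization by an affine automorphism
   [t |-> t *m S + b] of the reference simplex. *)
Lemma simplex_int_perm m (P : 'I_m.+1 -> V) (s : {perm 'I_m.+1}) f :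
  affine_indep predT P -> continuous f ->
  simplex_int (P \o s) f = simplex_int P f.
Proof.
move=> /[dup] iP /affine_indep_row_free rP cf; pose Q := P \o s.
have rQ : row_free (edges Q).
  apply/affine_indep_row_free => l l0 lP k _; rewrite -(permK s k).
  apply: (iP (fun k => l ((s^-1)%g k))) => //.
    by rewrite (reindex_inj (@perm_inj _ s)) /= -[RHS]l0; apply: eq_bigr => i _; rewrite permK.
  by rewrite (reindex_inj (@perm_inj _ s)) /= -[RHS]lP; apply: eq_bigr => i _; rewrite permK.
pose sv i := (s^-1)%g (lift ord0 i) : 'I_m.+1.
(* Each permuted barycentric coordinate is affine in [t]: [b] holds its value at 0 and [S] its
   linear part. *)
pose b : 'rV[R]_m := \row_i bary 0 (sv i).
pose S : 'M[R]_m := \matrix_(j, i) ((sv i == lift ord0 j)%:R - (sv i == ord0)%:R).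
have neq_lift' i : lift ord0 i != ord0 :> 'I_m.+1 by rewrite eq_sym neq_lift.
have baryE (t : 'rV[R]_m) k : bary t k = \sum_j t 0 j * ((k == lift ord0 j)%:R - (k == ord0)%:R) + bary 0 k.
  case: (unliftP ord0 k) => [i ->|->].
    rewrite !bary_lift (bigD1 i) // eqxx (negbTE (neq_lift' _)) subr0 mulr1.
    rewrite big1 => [|j ji]; first by rewrite /= mxE !addr0.
    by rewrite (inj_eq lift_inj) eq_sym (negbTE ji) subr0 mulr0.
  have rs0 : row_sum (0 : 'rV[R]_m) = 0 by apply: big1 => i _; rewrite mxE.
  rewrite !bary0 rs0 subr0 addrC; congr (_ + _).
  rewrite /row_sum -sumrN; apply: eq_bigr => j _.
  by rewrite (negbTE (neq_lift _ _)) eqxx sub0r mulrN1.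
have Sb t : t *m S + b = \row_i bary t (sv i).
  apply/rowP => i; rewrite !mxE [RHS]baryE; congr (_ + _).
  by apply: eq_bigr => j _; rewrite mxE.
have barySb t : bary (t *m S + b) =1 (fun k => bary t ((s^-1)%g k)).
  move=> k; rewrite Sb (@row_bary _ (fun k => bary t ((s^-1)%g k))) //.
  by rewrite (reindex_inj (@perm_inj _ s)) /= -[RHS](bary_sum t); apply: eq_bigr => i _; rewrite permK.
have paramE t : param Q t = param P (t *m S + b).
  rewrite !param_bary [RHS](reindex_inj (@perm_inj _ s)) /=.
  by apply: eq_bigr => k _; rewrite barySb permK.
have EQ : edges Q = S *m edges P.
  apply/row_matrixP => j; rewrite !rowE mulmxA.
  have := paramE (delta_mx 0 j); have := paramE 0; rewrite /param mul0mx addr0 mul0mx add0r => ->.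
  by rewrite mulmxDl [X in _ = _ + X]addrC addrA => /addrI.
have uS : S \in unitmx.
  rewrite -row_free_unit /row_free eqn_leq rank_leq_row /=.
  by rewrite -{1}(eqP rQ) EQ mxrankM_maxl.
have refE : @ref_simplex R m = [set t | ref_simplex (t *m S + b)].
  apply/seteqP; split=> t /=.
    by move=> /ref_simplexE h; apply/ref_simplexE => k; rewrite barySb.
  move=> /ref_simplexE h; apply/ref_simplexE => k.
  by have := h (s k); rewrite barySb permK.
have L : lint (@ref_simplex R m) (fun t => f (param P t)) =
    `|\det S| * lint (@ref_simplex R m) (fun t => f (param Q t)).
  rewrite (@lint_affine _ _ S b _ _ uS); last first.
  - apply: continuous_rv_integrable; last exact: ref_simplex_bounded.
      by move=> t; apply: continuous_comp; [exact: param_continuous | exact: cf].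
    exact: ref_simplex_measurable.
  - exact: ref_simplex_measurable.
  rewrite -refE (_ : (fun t => f (param Q t)) = fun t => f (param P (t *m S + b))) //.
  by apply/funext => t; rewrite paramE.
(* The factor [|det S|] of the substitution is the one by which the surface elements differ, as
   [det (S G S^T) = det S ^ 2 * det G]. *)
rewrite /simplex_int -/Q L EQ; move: (lint _ _) => x.
rewrite trmx_mul mulmxA -[S *m _ *m _]mulmxA !det_mulmx det_tr.
by rewrite mulrAC -expr2 sqrtrM ?sqr_ge0 // sqrtr_sqr -mulrA mulrCA.
Qed.

End AffineSimplex.

(** * Dependence on the vertex set, and simplexes of full dimension *)

Section SimplexDivergence.
Context {R : realType}.

(** Two injective enumerations of the same vertices differ by a permutation, so the integral depends
    on the vertex set alone. *)
Lemma simplex_int_image d m (I : finType) (P : I -> 'rV[R]_d) (a b : 'I_m.+1 -> I) f :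
  injective a -> injective b -> (forall i, exists j, a j = b i) ->
  affine_indep predT (P \o a) -> continuous f ->
  simplex_int (P \o b) f = simplex_int (P \o a) f.
Proof.
move=> ia ib /choice[h hP] iP cf.
have ih : injective h by move=> i j hij; apply: ib; rewrite -!hP hij.
rewrite -(simplex_int_perm (perm ih) iP cf); congr simplex_int.
by apply/funext => i /=; rewrite permE hP.
Qed.

(** Coefficients are pushed forward along [a] by summing over its fibres, which have at most one
    point. *)
Lemma affine_indep_comp d m m' (P : 'I_m -> 'rV[R]_d) (a : 'I_m' -> 'I_m) :
  injective a -> affine_indep predT P -> affine_indep predT (P \o a).
Proof.
move=> ia iP l l0 lP k _; pose l' j := \sum_(i | a i == j) l i.
have <- : l' (a k) = l k.
  rewrite /l' (big_pred1 k) // => i /=; apply/eqP/eqP => [/ia//|-> //].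
apply: iP => //; rewrite /l'.
  by rewrite -[RHS]l0 [RHS](partition_big a predT).
rewrite -[RHS]lP [RHS](partition_big a predT) //=; apply: eq_bigr => j _.
by rewrite scaler_suml; apply: eq_bigr => i /eqP <-.
Qed.

Lemma hull_reindex d m m' (P : 'I_m -> 'rV[R]_d) (a : 'I_m' -> 'I_m) :
  hull predT (P \o a) `<=` hull predT P.
Proof.
move=> x [l [l0 l1 ->]]; exists (fun j => \sum_(i | a i == j) l i); split.
- by move=> j _; apply: sumr_ge0 => i _; exact: l0.
- by rewrite -[RHS]l1 [RHS](partition_big a predT).
- rewrite (partition_big a predT) //=; apply: eq_bigr => j _.
  by rewrite scaler_suml; apply: eq_bigr => i /eqP <-.
Qed.

Lemma hull_perm d m (P : 'I_m -> 'rV[R]_d) (s : {perm 'I_m}) :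
  hull predT (P \o s) = hull predT P.
Proof.
apply/seteqP; split; first exact: hull_reindex.
rewrite [X in hull _ X `<=` _](_ : P = (P \o s) \o (s^-1)%g); first exact: hull_reindex.
by apply/funext => i /=; rewrite permKV.
Qed.

Section FullDimensional.
Context {n : nat}.
Implicit Types P : 'I_n.+1 -> 'rV[R]_n.

Lemma edges_unit P : affine_indep predT P -> edges P \in unitmx.
Proof. by move/affine_indep_row_free; rewrite row_free_unit. Qed.

Lemma param_preimage P (A : set 'rV[R]_n) : affine_indep predT P ->
  param P @` A = [set x | A (x *m invmx (edges P) - P ord0 *m invmx (edges P))].
Proof.
move=> /edges_unit uE; apply/seteqP; split=> x /=.
  by move=> [t At <-]; rewrite -mulmxBl /param addrC addKr mulmxK.
by rewrite -mulmxBl => Ax; eexists; first exact: Ax; rewrite /param mulmxKV // addrC subrK.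
Qed.

(** In full dimension the Gram determinant is [det (edges P) ^ 2], so the surface element is the
    Jacobian of [param P]. *)
Lemma lint_hull P f : affine_indep predT P -> continuous f ->
  lint (hull predT P) f = simplex_int P f.
Proof.
move=> /[dup] iP /edges_unit uE cf.
have mH := hull_measurable P.
rewrite (@lint_affine _ _ (edges P) (P ord0) _ _ uE mH); last first.
  by apply: continuous_rv_integrable => //; exact: hull_bounded.
rewrite /simplex_int det_mulmx det_tr -expr2 sqrtr_sqr; congr (_ * _).
have -> : [set x : 'rV[R]_n | hull predT P (x *m edges P + P ord0)] = @ref_simplex R n.
  rewrite hull_param; apply/seteqP; split=> t /=.
    by move=> [s hs]; rewrite addrC => /(param_inj ((affine_indep_row_free P).1 iP)) <-.
  by move=> ht; exists t => //; rewrite addrC.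
by apply: eq_lint => t _; rewrite addrC.
Qed.

Lemma hull_interior P t : affine_indep predT P -> open_simplex t ->
  ((hull predT P)° (param P t)).
Proof.
move=> iP ot; apply: (@filterS _ _ _ (param P @` @open_simplex R n)).
  rewrite hull_param; apply: image_subset => y [y0 y1]; split; last exact: ltW.
  by move=> i; exact: ltW.
apply: open_nbhs_nbhs; split; last by exists t.
rewrite param_preimage //.
apply: (@open_comp _ _ (fun x : 'rV[R]_n => x *m invmx (edges P) - P ord0 *m invmx (edges P)) _).
  by move=> y _; exact: affine_continuous.
exact: open_simplex_open.
Qed.

Lemma hull_closure_interior P : affine_indep predT P ->
  hull predT P `<=` closure ((hull predT P)°).
Proof.
move=> iP x; rewrite {1}hull_param => -[t /ref_simplex_closure ht <-] B hB.
have /ht[s [os hs]] : nbhs t (param P @^-1` B) by exact: param_continuous.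
by exists (param P s); split => //; exact: hull_interior.
Qed.

End FullDimensional.

End SimplexDivergence.

(** * Volume as height times base, and the derivative along an edge *)

Section Divergence.
Context {R : realType}.

Lemma dotE n (u v : 'rV[R]_n) : dot u v = (u *m v^T) 0 0.
Proof. by rewrite mxE; apply: eq_bigr => i _; rewrite mxE. Qed.

Lemma dotC n (u v : 'rV[R]_n) : dot u v = dot v u.
Proof. by apply: eq_bigr => i _; rewrite mulrC. Qed.

Lemma dotDl n (u v w : 'rV[R]_n) : dot (u + v) w = dot u w + dot v w.
Proof. by rewrite !dotE mulmxDl mxE. Qed.

Lemma dotZl n c (u w : 'rV[R]_n) : dot (c *: u) w = c * dot u w.
Proof. by rewrite !dotE -scalemxAl mxE. Qed.

Lemma dotNl n (u w : 'rV[R]_n) : dot (- u) w = - dot u w.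
Proof. by rewrite !dotE mulNmx mxE. Qed.

Lemma dotBl n (u v w : 'rV[R]_n) : dot (u - v) w = dot u w - dot v w.
Proof. by rewrite dotDl dotNl. Qed.

Lemma dot0l n (w : 'rV[R]_n) : dot 0 w = 0.
Proof. by rewrite dotE mul0mx mxE. Qed.

Lemma dot_suml n (I : Type) (r : seq I) (P : pred I) (f : I -> 'rV[R]_n) w :
  dot (\sum_(i <- r | P i) f i) w = \sum_(i <- r | P i) dot (f i) w.
Proof.
elim/big_rec2: _ => [|i x y _ <-]; first by rewrite dot0l.
by rewrite dotDl.
Qed.

Lemma dot_ge0 n (u : 'rV[R]_n) : 0 <= dot u u.
Proof. by apply: sumr_ge0 => i _; rewrite -expr2 sqr_ge0. Qed.

Lemma dot_eq0 n (u : 'rV[R]_n) : dot u u = 0 -> u = 0.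
Proof.
move=> /eqP; rewrite psumr_eq0 => [/allP h|i _]; last by rewrite -expr2 sqr_ge0.
apply/rowP => i; rewrite mxE; apply/eqP.
by have := h i (mem_index_enum _); rewrite -expr2 sqrf_eq0.
Qed.

(** The Gram matrix of [col_mx v E] is block diagonal with blocks 1 and [E E^T]. This exhibits the
    Gram determinant of a face as a square. *)
Lemma gram_det_normal n (v : 'rV[R]_(1 + n)) (E : 'M[R]_(n, 1 + n)) :
  dot v v = 1 -> E *m v^T = 0 -> \det (E *m E^T) = \det (col_mx v E) ^+ 2.
Proof.
move=> v1 Ev; have NN : col_mx v E *m (col_mx v E)^T = block_mx 1%:M 0 0 (E *m E^T).
  rewrite tr_col_mx mul_col_row Ev [v *m v^T]mx11_scalar -dotE v1.
  by rewrite -[v *m E^T]trmxK trmx_mul trmxK Ev trmx0.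
have -> : \det (col_mx v E) ^+ 2 = \det (col_mx v E *m (col_mx v E)^T) by rewrite det_mulmx det_tr.
by rewrite NN det_ublock det1 mul1r.
Qed.

Lemma gram_unitmx n m (E : 'M[R]_(n, m)) : row_free E -> E *m E^T \in unitmx.
Proof.
move=> rE; rewrite -row_free_unit -kermx_eq0; apply/rowV0P => x /sub_kermxP xE.
apply: (row_free_inj rE); rewrite mul0mx; apply: dot_eq0.
by rewrite dotE trmx_mul mulmxA -[x *m E *m E^T]mulmxA xE mul0mx mxE.
Qed.

(** Volume is height times base: [col_mx w E] times the transpose of [col_mx v E] is block
    triangular with diagonal [dot w v] and [E E^T]. *)
Lemma det_col_normal n (w v : 'rV[R]_(1 + n)) (E : 'M[R]_(n, 1 + n)) :
  dot v v = 1 -> E *m v^T = 0 -> col_mx w E \in unitmx ->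
  `|\det (col_mx w E)| = `|dot w v| * Num.sqrt (\det (E *m E^T)).
Proof.
move=> v1 Ev uM; pose N := col_mx v E.
have MN : col_mx w E *m N^T = block_mx (dot w v)%:M (w *m E^T) 0 (E *m E^T).
  by rewrite tr_col_mx mul_col_row Ev dotE -mx11_scalar.
(* One factor [det N] will be cancelled. A kernel row has first entry 0 by pairing with [v], and the
   rest is killed by the invertibility of [col_mx w E]. *)
have uN : \det N != 0.
  rewrite -unitfE -unitmxE -row_free_unit; apply/row_freeP; apply/row_freeP.
  rewrite -kermx_eq0; apply/rowV0P => x /sub_kermxP.
  rewrite -(hsubmxK x) mul_row_col => xN.
  have x0 : lsubmx x = 0.
    have := congr1 (fun y => y *m v^T) xN.
    by rewrite /= mulmxDl -!mulmxA Ev mulmx0 addr0 mul0mx [v *m v^T]mx11_scalar -dotE v1 mulmx1.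
  rewrite x0 in xN *; move: xN; rewrite mul0mx add0r => xE.
  have : row_mx 0 (rsubmx x) *m col_mx w E = 0 by rewrite mul_row_col mul0mx add0r.
  move=> /(congr1 (fun y => y *m invmx (col_mx w E))).
  by rewrite mulmxK // mul0mx.
have gE : \det N ^+ 2 = \det (E *m E^T) by rewrite (gram_det_normal v1 Ev).
have dMN : \det (col_mx w E) * \det N = dot w v * \det N ^+ 2.
  by rewrite -{1}[\det N]det_tr -det_mulmx MN det_ublock det_scalar1 gE.
rewrite -gE sqrtr_sqr -normrM; congr `|_|.
by apply: (mulIf uN); rewrite dMN -mulrA expr2.
Qed.

Section Simplex.
Context {n : nat}.
Implicit Types P : 'I_n.+2 -> 'rV[R]_n.+1.

Let one : 'I_n.+2 := lift ord0 ord0.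

Lemma lift1_0 : lift one ord0 = ord0.
Proof. exact/val_inj. Qed.

Lemma lift1_lift0 (l : 'I_n) : lift one (lift ord0 l) = lift ord0 (lift ord0 l).
Proof. exact/val_inj. Qed.

Lemma row_mx_lift0 (x : 'M[R]_1) (t : 'rV[R]_n) l : (row_mx x t : 'rV[R]_(1 + n)) 0 (lift ord0 l) = t 0 l.
Proof. by rewrite -(row_mxEr x t); congr (row_mx _ _ _ _); apply/val_inj. Qed.

Lemma row_mx_0 (x : 'M[R]_1) (t : 'rV[R]_n) : (row_mx x t : 'rV[R]_(1 + n)) 0 ord0 = x 0 0.
Proof. by rewrite -(row_mxEl x t); congr (row_mx _ _ _ _); apply/val_inj. Qed.

(** The upper endpoint of the segment gives [ord0] weight 0; in [param_face1] the lower endpoint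
    does the same for [one]. The boundary terms are thus face integrals. *)
Lemma param_face0 P (t : 'rV[R]_n) :
  param P (row_mx (1 - row_sum t)%:M t : 'rV[R]_(1 + n)) = param (P \o lift ord0) t.
Proof.
rewrite !param_bary big_ord_recl bary0 row_sum_row_mx subrK subrr scale0r add0r.
apply: eq_bigr => k _; rewrite bary_lift; congr (_ *: _).
case: (unliftP ord0 k) => [l ->|->]; first by rewrite bary_lift row_mx_lift0.
by rewrite bary0 row_mx_0 mxE mulr1n.
Qed.

Lemma param_face1 P (t : 'rV[R]_n) :
  param P (row_mx 0%:M t : 'rV[R]_(1 + n)) = param (P \o lift one) t.
Proof.
rewrite !param_bary !big_ord_recl !bary0 row_sum_row_mx add0r /= lift1_0; congr (_ + _).
rewrite bary_lift row_mx_0 mxE mulr1n scale0r add0r.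
apply: eq_bigr => l _; rewrite lift1_lift0; congr (_ *: _).
by rewrite !bary_lift row_mx_lift0.
Qed.

Lemma edges_face1 P : edges P = col_mx (P one - P ord0) (edges (P \o lift one)) :> 'M[R]_(1 + n).
Proof.
apply/row_matrixP => i; rewrite rowK -(splitK i); case: (fintype.split i) => l /=.
  by rewrite rowKu row_id ord1; congr (P _ - _); apply/val_inj.
rewrite rowKd rowK /= lift1_0; congr (P _ - _).
by rewrite lift1_lift0; apply/val_inj.
Qed.

(** Edges drawn from [P ord0] are those drawn from [P one] plus the edge between the two: a
    unipotent change of rows, which preserves the determinant. *)
Lemma edges_face0 P : edges P = (block_mx 1%:M 0 (const_mx 1) 1%:M : 'M[R]_(1 + n)) *m
  col_mx (P one - P ord0) (edges (P \o lift ord0)) :> 'M[R]_(1 + n).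
Proof.
rewrite mul_block_col mul1mx mul0mx addr0 mul1mx.
apply/row_matrixP => i; rewrite rowK -(splitK i); case: (fintype.split i) => l /=.
  by rewrite rowKu row_id ord1; congr (P _ - _); apply/val_inj.
rewrite rowKd linearD /= rowK row_mul (_ : row l (const_mx 1) = 1%:M); last first.
  by apply/rowP => j; rewrite !mxE ord1 eqxx.
rewrite mul1mx /= [RHS]addrC subrKA; congr (P _ - _).
exact/val_inj.
Qed.

(** The three conditions by which [normal] is chosen, for the face opposite to the vertex [k] of an
    ordered simplex. *)
Definition outward P (k : 'I_n.+2) (v : 'rV[R]_n.+1) :=
  [/\ dot v v = 1, forall i j, i != k -> j != k -> dot v (P i - P j) = 0
    & forall i, i != k -> dot v (P k - P i) < 0].

Lemma edges_normal P k v : outward P k v -> edges (P \o lift k) *m v^T = 0.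
Proof.
move=> [_ vP _]; apply/row_matrixP => i; rewrite row_mul rowK linear0.
have nk j : lift k j != k by rewrite eq_sym neq_lift.
by rewrite [LHS]mx11_scalar -dotE dotC vP ?nk // raddf0.
Qed.

(** In the coordinates of [param P] the edge [w] is the first unit direction, so [lint_ref_FTC]
    leaves the two opposite faces. The Jacobian is height times base over either one, and the
    heights are [dot w v0 > 0] and [- dot w v1 > 0], which produces the signs. *)
Lemma lint_hull_deriv01 P v0 v1 F : affine_indep predT P -> C1 F ->
  outward P ord0 v0 -> outward P one v1 ->
  lint (hull predT P) (fun x => dot (P one - P ord0) (grad F x)) =
  dot (P one - P ord0) v0 * simplex_int (P \o lift ord0) F +
  dot (P one - P ord0) v1 * simplex_int (P \o lift one) F.
Proof.
move=> iP cF o0 o1; set w := P one - P ord0.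
have uE := edges_unit iP.
have cF0 : continuous F by case: cF.
have cdF := @dot_grad_continuous _ _ _ w cF.
pose G (t : 'rV[R]_(1 + n)) := F (param P t).
pose G' (t : 'rV[R]_(1 + n)) := dot w (grad F (param P t)).
have cG' : continuous G'.
  move=> t; apply: (@continuous_comp _ _ _ (param P) (fun y => dot w (grad F y))).
    exact: param_continuous.
  exact: cdF.
have e0 : (row_mx 1%:M 0 : 'rV[R]_(1 + n)) *m edges P = w.
  by rewrite edges_face1 mul_row_col mul1mx mul0mx addr0.
have dG t : is_derive t (row_mx 1%:M 0 : 'rV[R]_(1 + n)) G (G' t).
  rewrite -[t in is_derive t]addr0 -(scale0r (row_mx 1%:M 0 : 'rV[R]_(1 + n))).
  apply: (iffRL (@is_derive_line R _ G t _ 0 _)).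
  rewrite (_ : (fun s : R => _) = fun s => F (param P t + s *: w)); last first.
    by apply/funext => s; rewrite /G /param mulmxDl -scalemxAl e0 addrA.
  apply: (iffLR (@is_derive_line R _ F (param P t) _ 0 _)).
  by rewrite scale0r addr0; exact: C1_is_derive.
have FTC := lint_ref_FTC cG' dG.
have mr := @ref_simplex_measurable R n.
have br := @ref_simplex_bounded R n.
have cP (Q : 'I_n.+1 -> 'rV[R]_n.+1) : continuous (fun t => F (param Q t)).
  by move=> t; apply: continuous_comp; [exact: param_continuous | exact: cF0].
have iQ Q := continuous_rv_integrable (cP Q) mr br.
have {}FTC : lint (@ref_simplex R n.+1) G' =
    lint (@ref_simplex R n) (fun t => F (param (P \o lift ord0) t)) -
    lint (@ref_simplex R n) (fun t => F (param (P \o lift one) t)).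
  rewrite [LHS]FTC -[X in _ - X]mul1r -mulNr -lintZ // -lintD //; last exact: rv_integrableZ.
  by apply: eq_lint => t _; rewrite /G param_face0 param_face1 mulN1r.
have w0 : 0 < dot w v0.
  by case: o0 => _ _ /(_ one isT); rewrite dotC /w -opprB dotNl oppr_lt0.
have w1 : dot w v1 < 0 by case: o1 => _ _ /(_ ord0 isT); rewrite dotC.
have d1 : `|\det (edges P)| = - dot w v1 * Num.sqrt (\det (edges (P \o lift one) *m (edges (P \o lift one))^T)).
  move: uE; rewrite edges_face1 => uE.
  by rewrite (det_col_normal (v := v1)) ?ltr0_norm //; [case: o1 | exact: edges_normal].
have d0 : `|\det (edges P)| = dot w v0 * Num.sqrt (\det (edges (P \o lift ord0) *m (edges (P \o lift ord0))^T)).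
  move: uE; rewrite edges_face0 det_mulmx (@det_lblock _ 1 n) !det1 !mul1r unitmx_mul => /andP[_ uE].
  by rewrite (det_col_normal (v := v0)) ?gtr0_norm //; [case: o0 | exact: edges_normal].
rewrite lint_hull // /simplex_int det_mulmx det_tr -expr2 sqrtr_sqr FTC.
by rewrite mulrBr {1}d0 d1 mulNr mulNr opprK !mulrA.
Qed.

End Simplex.

End Divergence.

(** * The divergence theorem on a simplex, its normals and its faces *)

Section DivergenceTheorem.
Context {R : realType} {n : nat}.
Implicit Types P : 'I_n.+2 -> 'rV[R]_n.+1.

Lemma simplex_int_sum m d (Q : 'I_m.+1 -> 'rV[R]_d) (I : Type) (r : seq I) (f : I -> 'rV[R]_d -> R) :
  (forall i, continuous (f i)) ->
  simplex_int Q (fun x => \sum_(i <- r) f i x) = \sum_(i <- r) simplex_int Q (f i).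
Proof.
move=> cf; rewrite /simplex_int -mulr_sumr; congr (_ * _).
rewrite (lint_sum r (P := predT) (f := fun i t => f i (param Q t))) //.
  exact: ref_simplex_measurable.
move=> i _; apply: continuous_rv_integrable; last exact: ref_simplex_bounded.
  by move=> t; apply: (@continuous_comp _ _ _ (param Q) (f i)); [exact: param_continuous | exact: cf].
exact: ref_simplex_measurable.
Qed.

Lemma simplex_intZ m d (Q : 'I_m.+1 -> 'rV[R]_d) (c : R) (f : 'rV[R]_d -> R) : continuous f ->
  simplex_int Q (fun x => c * f x) = c * simplex_int Q f.
Proof.
move=> cf; rewrite /simplex_int mulrCA lintZ //.
  exact: ref_simplex_measurable.
apply: continuous_rv_integrable; last exact: ref_simplex_bounded.
  by move=> t; apply: (@continuous_comp _ _ _ (param Q) f); [exact: param_continuous | exact: cf].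
exact: ref_simplex_measurable.
Qed.

(** Reordering moves [j] and [i] to the first two vertices; the other terms of the sum vanish, since
    those faces contain both endpoints of the edge. *)
Lemma lint_hull_deriv P (v : 'I_n.+2 -> 'rV[R]_n.+1) F i j :
  affine_indep predT P -> C1 F -> (forall k, outward P k (v k)) -> i != j ->
  lint (hull predT P) (fun x => dot (P i - P j) (grad F x)) =
  \sum_k dot (P i - P j) (v k) * simplex_int (P \o lift k) F.
Proof.
move=> iP cF ov ij; pose one : 'I_n.+2 := lift ord0 ord0.
pose x := tperm ord0 j one.
have xj : x != j by rewrite /x -{2}(tpermL ord0 j) (inj_eq perm_inj).
(* [j] is brought to position [ord0]; the vertex [x] then at [one] is exchanged with [i], which
   leaves [j] alone because [x] and [i] differ from it. *)
pose s := (tperm ord0 j * tperm x i)%g.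
have s0 : s ord0 = j by rewrite permM tpermL tpermD // eq_sym.
have s1 : s one = i by rewrite permM -/x tpermL.
have os k : outward (P \o s) k (v (s k)).
  have [v1 v2 v3] := ov (s k); split => // [a b ak bk|a ak].
    by apply: v2; rewrite (inj_eq perm_inj).
  by apply: v3; rewrite (inj_eq perm_inj).
have iPs : affine_indep predT (P \o s) by apply: affine_indep_comp => //; exact: perm_inj.
have := lint_hull_deriv01 iPs cF (os ord0) (os one).
rewrite hull_perm /= -/one s0 s1 => ->.
have sE k : simplex_int ((P \o s) \o lift k) F = simplex_int (P \o lift (s k)) F.
  rewrite (simplex_int_image (P := P) (a := lift (s k)) (b := s \o lift k)) //.
  - exact: lift_inj.
  - by apply: inj_comp; [exact: perm_inj | exact: lift_inj].
  - move=> a; have : s k != s (lift k a) by rewrite (inj_eq perm_inj) neq_lift.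
    by case/unlift_some => b bE _; exists b; rewrite /= bE.
  - by apply: affine_indep_comp => //; exact: lift_inj.
  - by case: cF.
rewrite !sE s0 s1 [RHS](bigD1 j) //= [X in _ = _ + X](bigD1 i) //= addrA big1 ?addr0 // => k /andP[kj ki].
by have [_ h _] := ov k; rewrite dotC h ?mul0r // eq_sym.
Qed.

(** Both sides are linear in [w], and the edges issuing from [P ord0] form a basis. *)
Lemma lint_hull_grad P (v : 'I_n.+2 -> 'rV[R]_n.+1) F w :
  affine_indep predT P -> C1 F -> (forall k, outward P k (v k)) ->
  lint (hull predT P) (fun x => dot w (grad F x)) =
  \sum_k dot w (v k) * simplex_int (P \o lift k) F.
Proof.
move=> iP cF ov; have uE := edges_unit iP.
pose c := w *m invmx (edges P).
have wE : w = \sum_i c 0 i *: (P (lift ord0 i) - P ord0).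
  by rewrite -mulmx_edges mulmxKV.
have E (y : 'rV[R]_n.+1) : dot w y = \sum_i c 0 i * dot (P (lift ord0 i) - P ord0) y.
  by rewrite {1}wE dot_suml; apply: eq_bigr => i _; rewrite dotZl.
rewrite (_ : (fun x => _) = fun x => \sum_i c 0 i * dot (P (lift ord0 i) - P ord0) (grad F x)); last first.
  by apply/funext => x; rewrite E.
have mH := hull_measurable P.
have iH i : rv_integrable (hull predT P) (fun x => dot (P (lift ord0 i) - P ord0) (grad F x)).
  apply: continuous_rv_integrable; [exact: dot_grad_continuous | exact: mH | exact: hull_bounded].
rewrite lint_sum //; last by move=> i _; exact: rv_integrableZ.
rewrite (eq_bigr (fun i => \sum_k c 0 i * (dot (P (lift ord0 i) - P ord0) (v k) * simplex_int (P \o lift k) F))).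
  rewrite exchange_big; apply: eq_bigr => k _; rewrite E mulr_suml.
  by apply: eq_bigr => i _; rewrite mulrA.
by move=> i _; rewrite lintZ // -mulr_sumr (lint_hull_deriv iP cF ov) // eq_sym neq_lift.
Qed.

Lemma dot_unit_row m (v : 'rV[R]_m) (i : 'I_m) : dot (unit_row m i) v = v 0 i.
Proof.
rewrite /dot (bigD1 i) //= mxE eqxx mul1r big1 ?addr0 // => j ji.
by rewrite mxE val_eqE (negbTE ji) mul0r.
Qed.

Lemma divergence_simplex P (v : 'I_n.+2 -> 'rV[R]_n.+1) (u : 'rV[R]_n.+1 -> 'rV[R]_n.+1) :
  affine_indep predT P -> (forall i, C1 (fun x => u x 0 i)) -> (forall k, outward P k (v k)) ->
  lint (hull predT P) (div u) = \sum_k simplex_int (P \o lift k) (fun x => dot (u x) (v k)).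
Proof.
move=> iP cu ov; have cu0 i : continuous (fun x => u x 0 i) by case: (cu i).
have E (i : 'I_n.+1) : pderiv i (fun x => u x 0 i) = fun x => dot (unit_row n.+1 i) (grad (fun x => u x 0 i) x).
  by apply/funext => x; rewrite dot_unit_row mxE.
rewrite /div lint_sum; last 2 first.
- exact: hull_measurable.
- move=> i _; rewrite E; apply: continuous_rv_integrable.
  + exact: dot_grad_continuous.
  + exact: hull_measurable.
  + exact: hull_bounded.
rewrite (eq_bigr (fun i : 'I_n.+1 => \sum_k v k 0 i * simplex_int (P \o lift k) (fun x => u x 0 i))).
  rewrite exchange_big; apply: eq_bigr => k _.
  rewrite (_ : (fun x => dot (u x) (v k)) = fun x => \sum_i v k 0 i * u x 0 i).
    rewrite simplex_int_sum; last by move=> i; exact: continuous_mull.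
    by apply: eq_bigr => i _; rewrite simplex_intZ.
  by apply/funext => x; apply: eq_bigr => i _; rewrite mulrC.
move=> i _; rewrite E (lint_hull_grad _ iP (cu i) ov).
by apply: eq_bigr => k _; rewrite dot_unit_row.
Qed.

(** The face has [n] edges in dimension [n.+1], hence a nonzero orthogonal [w]. Its product [c] with
    an edge towards [P k] is not 0, or [w] would be orthogonal to a basis. *)
Lemma outward_exists P k : affine_indep predT P -> exists v, outward P k v.
Proof.
move=> iP; pose Q := P \o lift k.
have [w w0 wE] : exists2 w : 'rV[R]_n.+1, w != 0 & edges Q *m w^T = 0.
  have : kermx (edges Q)^T != 0.
    rewrite kermx_eq0 /row_free neq_ltn; apply/orP; left.
    by rewrite ltnS rank_leq_col.
  move=> /rowV0Pn[w /sub_kermxP wE w0]; exists w => //.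
  by rewrite -[LHS]trmxK trmx_mul trmxK wE trmx0.
have wQ a : dot w (Q (lift ord0 a) - Q ord0) = 0.
  have /matrixP/(_ a 0) := wE; rewrite !mxE => E; rewrite dotC -[RHS]E.
  by apply: eq_bigr => b _; rewrite !mxE.
have wQ' a : dot w (Q a) = dot w (Q ord0).
  case: (unliftP ord0 a) => [b ->|->] //.
  by apply/eqP; rewrite -subr_eq0 ![dot w _]dotC -dotBl dotC wQ.
have nk i : i != k -> exists a, P i = Q a.
  by rewrite eq_sym => /unlift_some[a -> _]; exists a.
have wP i j : i != k -> j != k -> dot w (P i - P j) = 0.
  move=> /nk[a ->] /nk[b ->].
  by rewrite dotC dotBl ![dot _ w]dotC (wQ' a) (wQ' b) subrr.
pose c := dot w (P k - Q ord0).
have cE i : i != k -> dot w (P k - P i) = c.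
  move=> /nk[a ->]; rewrite /c ![dot w (_ - _)]dotC !dotBl; congr (_ - _).
  by rewrite dotC wQ' dotC.
have c0 : c != 0.
  apply: contraNneq w0 => c0; have uE := edges_unit iP.
  have wk i : i != k -> dot w (P k - P i) = 0 by move=> ik; rewrite cE.
  have wE0 i : dot w (P (lift ord0 i) - P ord0) = 0.
    have [ik|ik] := eqVneq (lift ord0 i) k.
      by rewrite ik wk // -ik neq_lift.
    have [zk|zk] := eqVneq ord0 k; last exact: wP.
    by have := wk _ ik; rewrite -zk => h; rewrite dotC -opprB dotNl dotC h oppr0.
  have : w *m (edges P)^T = 0.
    apply/rowP => i; rewrite !mxE -[RHS](wE0 i).
    by apply: eq_bigr => l _; rewrite !mxE.
  by move/(congr1 (fun y => y *m invmx (edges P)^T)); rewrite mulmxK ?unitmx_tr // mul0mx => /eqP.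
have d0 : 0 < dot w w.
  by rewrite lt_def dot_ge0 andbT; apply: contraNneq w0 => /dot_eq0/eqP.
(* Dividing by the length normalizes [w], and the sign makes it point away from [P k]. *)
pose a := - Num.sg c / Num.sqrt (dot w w).
exists (a *: w); split.
- rewrite dotZl dotC dotZl mulrA -expr2 /a exprMn exprVn sqr_sqrtr ?ltW // sqrrN.
  by rewrite sqr_sg c0 mul1r mulVf // gt_eqF.
- by move=> i j ik jk; rewrite dotZl wP // mulr0.
- move=> i ik; rewrite dotZl cE // /a mulrAC mulNr -normrEsg mulNr oppr_lt0.
  by rewrite divr_gt0 ?normr_gt0 // sqrtr_gt0.
Qed.

(** Once the vertex [k] is moved to the second place, the inverse of [param] sends the face into the
    hyperplane where the first coordinate is 0. *)
Lemma rv_null_face P k : affine_indep predT P -> rv_null (hull predT (P \o lift k)).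
Proof.
move=> iP; pose one : 'I_n.+2 := lift ord0 ord0; pose s := tperm one k.
have iPs : affine_indep predT (P \o s) by apply: affine_indep_comp => //; exact: perm_inj.
have uE := edges_unit iPs.
have N := rv_null_affine (A := invmx (edges (P \o s))) (- ((P \o s) ord0 *m invmx (edges (P \o s)))) _
  (@rv_null_coord R n 0).
apply: rv_null_sub (N _); [exact: hull_measurable | | by rewrite unitmx_inv].
have /choice[a aE] i : exists a, s (lift one a) = lift k i.
  have : one != s (lift k i) by rewrite -{1}(tpermR one k) (inj_eq perm_inj) neq_lift.
  by case/unlift_some => b bE _; exists b; rewrite -bE tpermK.
have -> : P \o lift k = ((P \o s) \o lift one) \o a.
  by apply/funext => i /=; rewrite aE.
apply: (subset_trans (@hull_reindex _ _ _ _ _ _)).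
rewrite hull_param => _ [t _ <-] /=; rewrite -param_face1 /param mulmxDl mulmxK // addrAC subrr add0r.
by rewrite row_mx_0 mxE mulr1n.
Qed.

(** Positive barycentric coordinates make a point interior; a vanishing one puts it on the opposite
    face. *)
Lemma hull_sub_interior P : affine_indep predT P ->
  hull predT P `<=` (hull predT P)° `|` \big[setU/set0]_k hull predT (P \o lift k).
Proof.
move=> iP x; rewrite {1}hull_param => -[t ht <-].
have [/forallP h|] := boolP [forall k, 0 < bary t k].
  by left; apply: hull_interior => //; exact/open_simplexE.
rewrite negb_forall => /existsP[k]; rewrite -leNgt => tk; right.
rewrite -bigcup_seq; exists k; first exact: mem_index_enum.
have /ref_simplexE h0 := ht.
have t0 : bary t k = 0 by apply/eqP; rewrite eq_le tk h0.
exists (fun i => bary t (lift k i)); split.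
- by move=> i _; exact: h0.
- by rewrite -[RHS](bary_sum t) [RHS](bigD1_ord k) //= t0 add0r.
- by rewrite param_bary (bigD1_ord k) //= t0 scale0r add0r.
Qed.

End DivergenceTheorem.

(** * Polynomial functions *)

Section Polynomials.
Context {R : realType} {n : nat}.
Implicit Types (f g : 'rV[R]_n -> R).

Lemma eq_C1 f g : f =1 g -> C1 f -> C1 g.
Proof. by move=> /funext ->. Qed.

Lemma C1_cst (c : R) : C1 (fun _ : 'rV[R]_n => c).
Proof.
split=> [|j x|j]; [exact: cst_continuous | exact: derivable_cst |].
by rewrite (_ : pderiv j _ = cst 0); [exact: cst_continuous | apply/funext => x; exact: derive_cst].
Qed.

Lemma pderivD f g (j : 'I_n) x : C1 f -> C1 g ->
  pderiv j (fun x => f x + g x) x = pderiv j f x + pderiv j g x.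
Proof. by move=> [_ df _] [_ dg _]; exact: (deriveD (df j x) (dg j x)). Qed.

Lemma C1D f g : C1 f -> C1 g -> C1 (fun x => f x + g x).
Proof.
move=> /[dup] Cf [cf df ddf] /[dup] Cg [cg dg ddg]; split.
- exact: continuous_add.
- by move=> j x; exact: (derivableD (df j x) (dg j x)).
- move=> j; rewrite (_ : pderiv j _ = fun x => pderiv j f x + pderiv j g x).
    exact: continuous_add.
  by apply/funext => x; exact: pderivD.
Qed.

Lemma pderivM f g (j : 'I_n) x : C1 f -> C1 g ->
  pderiv j (fun x => f x * g x) x = f x * pderiv j g x + g x * pderiv j f x.
Proof. by move=> [_ df _] [_ dg _]; exact: (deriveM (df j x) (dg j x)). Qed.

Lemma C1M f g : C1 f -> C1 g -> C1 (fun x => f x * g x).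
Proof.
move=> /[dup] Cf [cf df ddf] /[dup] Cg [cg dg ddg]; split.
- exact: continuous_mul.
- by move=> j x; exact: (derivableM (df j x) (dg j x)).
- move=> j; rewrite (_ : pderiv j _ = fun x => f x * pderiv j g x + g x * pderiv j f x).
    by apply: continuous_add; exact: continuous_mul.
  by apply/funext => x; exact: pderivM.
Qed.

Lemma C1Z (c : R) f : C1 f -> C1 (fun x => c * f x).
Proof. exact/C1M/C1_cst. Qed.

Lemma pderivZ (c : R) f (j : 'I_n) x : C1 f -> pderiv j (fun x => c * f x) x = c * pderiv j f x.
Proof.
move=> Cf; rewrite pderivM //; last exact: C1_cst.
by rewrite [pderiv j (fun=> c) x]derive_cst mulr0 addr0.
Qed.

Lemma C1_sum (I : Type) (r : seq I) (P : pred I) (F : I -> 'rV[R]_n -> R) :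
  (forall i, P i -> C1 (F i)) -> C1 (fun x => \sum_(i <- r | P i) F i x).
Proof.
move=> CF; elim: r => [|i r IHr].
  by apply: eq_C1 (C1_cst 0) => x; rewrite big_nil.
case Pi : (P i).
  by apply: eq_C1 (C1D (CF _ Pi) IHr) => x; rewrite big_cons Pi.
by apply: eq_C1 IHr => x; rewrite big_cons Pi.
Qed.

Lemma pderiv_sum (I : Type) (r : seq I) (P : pred I) (F : I -> 'rV[R]_n -> R) (j : 'I_n) x :
  (forall i, P i -> C1 (F i)) ->
  pderiv j (fun x => \sum_(i <- r | P i) F i x) x = \sum_(i <- r | P i) pderiv j (F i) x.
Proof.
move=> CF; elim: r => [|i r IHr].
  rewrite big_nil (_ : (fun x => _) = cst 0); first exact: derive_cst.
  by apply/funext => y; rewrite big_nil.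
rewrite big_cons (_ : (fun x => _) = fun x => if P i then F i x + \sum_(j <- r | P j) F j x
    else \sum_(j <- r | P j) F j x); last by apply/funext => y; rewrite big_cons.
case Pi : (P i) => //; rewrite pderivD ?IHr //; [exact: CF | exact: C1_sum].
Qed.

Definition monom (a : 'I_n -> nat) (x : 'rV[R]_n) : R := \prod_i x 0 i ^+ a i.

(** Truncated subtraction is harmless at [a j = 0], where the factor [a j] of the derivative
    vanishes. *)
Definition pred_at (j : 'I_n) (a : 'I_n -> nat) (i : 'I_n) : nat := (a i - (i == j))%N.

Lemma monom_continuous a : continuous (monom a).
Proof.
have cX i k : continuous (fun x : 'rV[R]_n => x 0 i ^+ k).
  elim: k => [|k IHk]; first exact: cst_continuous.
  rewrite (_ : (fun x => _) = fun x : 'rV[R]_n => x 0 i * x 0 i ^+ k); last first.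
    by apply/funext => x; rewrite exprS.
  by apply: continuous_mul => //; exact: coord_continuous.
rewrite /monom; elim: (index_enum _) => [|i r IHr].
  rewrite (_ : (fun x => _) = cst 1); first exact: cst_continuous.
  by apply/funext => x; rewrite big_nil.
rewrite (_ : (fun x => _) = fun x : 'rV[R]_n => x 0 i ^+ a i * \prod_(j <- r) x 0 j ^+ a j).
  exact: continuous_mul.
by apply/funext => x; rewrite big_cons.
Qed.

Lemma monom_is_derive a (j : 'I_n) x :
  is_derive x (unit_row n j) (monom a) ((a j)%:R * monom (pred_at j a) x).
Proof.
rewrite -[x in is_derive x]addr0 -(scale0r (unit_row n j)).
apply: (iffRL (@is_derive_line R _ (monom a) x _ 0 _)).
pose C := \prod_(i | i != j) x 0 i ^+ a i.
rewrite (_ : (fun s : R => _) = (C \*: (fun s => (x 0 j + s) ^+ a j))); last first.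
  apply/funext => s; rewrite /monom (bigD1 j) //= !mxE eqxx mulr1 [RHS]mulrC; congr (_ * _).
  by apply: eq_bigr => i ij; rewrite !mxE val_eqE (negbTE ij) mulr0 addr0.
have -> : (a j)%:R * monom (pred_at j a) x = C *: ((a j)%:R * x 0 j ^+ (a j).-1).
  rewrite /monom (bigD1 j) //= [RHS]mulrC -mulrA; congr (_ * (_ * _)).
    by rewrite /pred_at eqxx subn1.
  by apply: eq_bigr => i ij; rewrite /pred_at (negbTE ij) subn0.
apply: is_deriveZ; rewrite (_ : (fun s => _) = (fun s => x 0 j + s) ^+ a j); last first.
  by apply/funext => s; rewrite exprfctE.
have h : is_derive (0 : R) 1 (fun s => x 0 j + s) 1.
  by rewrite -[X in is_derive _ _ _ X]add0r; exact: is_deriveD.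
by have := is_deriveX (a j) h; rewrite addr0 [_ *: 1]mulr1.
Qed.

Lemma pderiv_monom a (j : 'I_n) x : pderiv j (monom a) x = (a j)%:R * monom (pred_at j a) x.
Proof. by case: (monom_is_derive a j x). Qed.

Lemma monom_C1 a : C1 (monom a).
Proof.
split=> [|j x|j]; first exact: monom_continuous.
  by case: (monom_is_derive a j x).
rewrite (_ : pderiv j _ = fun x => (a j)%:R * monom (pred_at j a) x).
  by apply: continuous_mull; exact: monom_continuous.
by apply/funext => x; exact: pderiv_monom.
Qed.

Lemma eq_polyfun m f g : f =1 g -> polyfun m f -> polyfun m g.
Proof. by move=> /funext ->. Qed.

Lemma polyfun0 m : polyfun m (fun _ : 'rV[R]_n => 0).
Proof. by exists (fun=> 0) => x; rewrite big1 // => a _; rewrite mul0r. Qed.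

Lemma polyfunD m f g : polyfun m f -> polyfun m g -> polyfun m (fun x => f x + g x).
Proof.
move=> [c cE] [c' cE']; exists (fun a => c a + c' a) => x.
by rewrite cE cE' -big_split; apply: eq_bigr => a _; rewrite mulrDl.
Qed.

Lemma polyfunZ m (l : R) f : polyfun m f -> polyfun m (fun x => l * f x).
Proof.
move=> [c cE]; exists (fun a => l * c a) => x.
by rewrite cE mulr_sumr; apply: eq_bigr => a _; rewrite mulrA.
Qed.

Lemma polyfun_sum m (I : Type) (r : seq I) (P : pred I) (F : I -> 'rV[R]_n -> R) :
  (forall i, P i -> polyfun m (F i)) -> polyfun m (fun x => \sum_(i <- r | P i) F i x).
Proof.
move=> PF; elim: r => [|i r IHr].
  by apply: eq_polyfun (polyfun0 m) => x; rewrite big_nil.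
case Pi : (P i).
  by apply: eq_polyfun (polyfunD (PF _ Pi) IHr) => x; rewrite big_cons Pi.
by apply: eq_polyfun IHr => x; rewrite big_cons Pi.
Qed.

Lemma polyfun_monom m a : (\sum_i a i <= m)%N -> polyfun m (monom a).
Proof.
move=> am; have ai i : (a i < m.+1)%N.
  by rewrite ltnS (leq_trans _ am) // (bigD1 i) //= leq_addr.
pose b : {ffun 'I_n -> 'I_m.+1} := [ffun i => Ordinal (ai i)].
exists (fun a' => (a' == b)%:R) => x; rewrite (bigD1 b) /=.
  rewrite eqxx mul1r [X in _ + X]big1; last by move=> a' /andP[_ /negbTE ->]; rewrite mul0r.
  by rewrite addr0; apply: eq_bigr => i _; rewrite ffunE.
by rewrite (eq_bigr a) // => i _; rewrite ffunE.
Qed.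

Lemma polyfunE m f : polyfun m f <-> exists c : {ffun 'I_n -> 'I_m.+1} -> R,
  f = fun x => \sum_(a : {ffun 'I_n -> 'I_m.+1} | (\sum_i a i <= m)%N) c a * monom (fun i => a i) x.
Proof. by split=> -[c cE]; exists c; [apply/funext => x; exact: cE | move=> x; rewrite cE]. Qed.

Lemma polyfun_C1 m f : polyfun m f -> C1 f.
Proof. by move=> /polyfunE[c ->]; apply: C1_sum => a _; apply: C1Z; exact: monom_C1. Qed.

Lemma polyfun_pderiv m (j : 'I_n) f : polyfun m f -> polyfun m.-1 (pderiv j f).
Proof.
move=> /polyfunE[c ->].
apply: (eq_polyfun (f := fun x => \sum_(a : {ffun 'I_n -> 'I_m.+1} | (\sum_i a i <= m)%N)
   (c a * (a j)%:R) * monom (pred_at j (fun i => a i)) x)).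
  move=> x; rewrite pderiv_sum => [|a _]; last by apply: C1Z; exact: monom_C1.
  by apply: eq_bigr => a _; rewrite pderivZ ?pderiv_monom ?mulrA //; exact: monom_C1.
(* An exponent 0 at [j] gives the zero term; otherwise lowering it lowers the total degree by
   one. *)
apply: polyfun_sum => a am; have [aj|aj] := posnP (a j).
  by apply: eq_polyfun (polyfun0 _) => x; rewrite aj mulr0 mul0r.
apply: polyfunZ; apply: polyfun_monom.
rewrite -ltnS (leq_trans (n := m)) //; last exact: leqSpred.
apply: leq_trans am.
rewrite (bigD1 j) //= [X in (_ <= X)%N](bigD1 j) //= /pred_at eqxx.
rewrite (eq_bigr (fun i => nat_of_ord (a i))) => [|i ij]; last by rewrite (negbTE ij) subn0.
by rewrite subn1 -addSn prednK.
Qed.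

Lemma polyfun_div m (u : 'rV[R]_n -> 'rV[R]_n) : polyvec m u -> polyfun m.-1 (div u).
Proof. by move=> pu; apply: polyfun_sum => i _; exact: polyfun_pderiv. Qed.

Lemma polyfun_dot m (u : 'rV[R]_n -> 'rV[R]_n) (v : 'rV[R]_n) :
  polyvec m u -> polyfun m (fun x => dot (u x) v).
Proof.
move=> pu; apply: polyfun_sum => i _; apply: (eq_polyfun (f := fun x => v 0 i * u x 0 i)).
  by move=> x; rewrite mulrC.
exact: polyfunZ.
Qed.

End Polynomials.

(** * Cells, faces and triangulations *)

Section Cells.
Context {R : realType}.

Lemma sum_image_set (X : nmodType) (I : finType) m (S : {set I}) (a : 'I_m -> I) (F : I -> X) :
  injective a -> S = [set a j | j : 'I_m]%SET -> \sum_(i in S) F i = \sum_j F (a j).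
Proof. by move=> ia ->; rewrite big_imset /=; [apply: eq_bigl | exact: in2W]. Qed.

(** The mesh describes simplexes by vertex sets, the integration theory by ordered families; an
    injective enumeration carries coefficients from one to the other. *)
Lemma hull_image d (I : finType) m (S : {set I}) (a : 'I_m -> I) (pt : I -> 'rV[R]_d) :
  injective a -> S = [set a j | j : 'I_m]%SET -> hull (mem S) pt = hull predT (pt \o a).
Proof.
move=> ia SE; have aS j : a j \in S by rewrite SE imset_f.
apply/seteqP; split=> x [l [l0 l1 ->]].
  exists (l \o a); split => [j _||]; first by apply: l0; exact: aS.
    by rewrite -[RHS]l1 (sum_image_set l ia SE).
  by rewrite (sum_image_set _ ia SE).
pose l' i := if [pick j | a j == i] is Some j then l j else 0.
have l'a j : l' (a j) = l j.
  rewrite /l'; case: pickP => [k /eqP/ia -> //|/(_ j)]; by rewrite eqxx.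
exists l'; split => [i||].
- move=> iS; have /imsetP[j _ ->] : i \in [set a j | j : 'I_m]%SET by rewrite -SE.
  by rewrite l'a; exact: l0.
- by rewrite -[RHS]l1 (sum_image_set _ ia SE); apply: eq_bigr => j _; rewrite l'a.
- by rewrite (sum_image_set _ ia SE); apply: eq_bigr => j _; rewrite l'a.
Qed.

Lemma affine_indep_image d (I : finType) m (S : {set I}) (a : 'I_m -> I) (pt : I -> 'rV[R]_d) :
  injective a -> S = [set a j | j : 'I_m]%SET ->
  affine_indep (mem S) pt -> affine_indep predT (pt \o a).
Proof.
move=> ia SE iS l l0 lP j _; have aS k : a k \in S by rewrite SE imset_f.
pose l' i := if [pick j | a j == i] is Some j then l j else 0.
have l'a k : l' (a k) = l k.
  rewrite /l'; case: pickP => [k' /eqP/ia -> //|/(_ k)]; by rewrite eqxx.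
rewrite -l'a; apply: iS; last exact: aS.
  by rewrite -[RHS]l0 (sum_image_set _ ia SE); apply: eq_bigr => k _; rewrite l'a.
by rewrite -[RHS]lP (sum_image_set _ ia SE); apply: eq_bigr => k _; rewrite l'a.
Qed.

Lemma hullS d (I : finType) (S S' : {set I}) (pt : I -> 'rV[R]_d) :
  S \subset S' -> hull (mem S) pt `<=` hull (mem S') pt.
Proof.
move=> /fintype.subsetP SS x [l [l0 l1 ->]].
have E (X : nmodType) (F : I -> X) :
    \sum_(i in S) F i = \sum_(i in S') (if i \in S then F i else 0).
  rewrite -big_mkcondr; apply: eq_bigl => i /=.
  by case: (boolP (i \in S)) => [/SS ->//|_]; rewrite andbF.
exists (fun i => if i \in S then l i else 0); split => [i _||].
- by case: ifP => // /l0.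
- by rewrite -E.
- rewrite E; apply: eq_bigr => i _; case: ifP => // _; by rewrite scale0r.
Qed.

(** The cardinality enters through a proof, so that all cells are enumerated by the same ordinal
    type. *)
Definition set_vtx (I : finType) (S : {set I}) m (Sm : #|S| = m) (j : 'I_m) : I :=
  enum_val (cast_ord (esym Sm) j).

Lemma set_vtx_inj I S m Sm : injective (@set_vtx I S m Sm).
Proof. by move=> i j /enum_val_inj /cast_ord_inj. Qed.

Lemma set_vtx_in I S m Sm j : @set_vtx I S m Sm j \in S.
Proof. exact: enum_valP. Qed.

Lemma set_vtx_image I S m Sm : S = [set @set_vtx I S m Sm j | j : 'I_m]%SET.
Proof.
apply/setP => i; apply/idP/imsetP => [iS|[j _ ->]]; last exact: set_vtx_in.
exists (cast_ord Sm (enum_rank_in iS i)) => //.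
by rewrite /set_vtx cast_ordK enum_rankK_in.
Qed.

Section OneCell.
Context {n : nat} (T : mesh R n.+1) (K : {set 'I_(mesh_nv T)}).
Hypothesis cardK : #|K| = n.+2.
Hypothesis indK : affine_indep (mem K) (@mesh_pt R n.+1 T).
Local Notation pt := (@mesh_pt R n.+1 T).
Local Notation vtx := (set_vtx cardK).

Definition cell_pt : 'I_n.+2 -> 'rV[R]_n.+1 := pt \o vtx.

Lemma cell_pt_indep : affine_indep predT cell_pt.
Proof. exact: affine_indep_image (@set_vtx_inj _ _ _ _) (set_vtx_image _) indK. Qed.

Lemma geom_cell : geom K = hull predT cell_pt.
Proof. exact: hull_image (@set_vtx_inj _ _ _ _) (set_vtx_image _). Qed.

Definition opp_face k := (K :\ vtx k)%SET.

Lemma card_opp_face k : #|opp_face k| = n.+1.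
Proof. by have := cardsD1 (vtx k) K; rewrite cardK set_vtx_in => -[]. Qed.

Lemma opp_face_inj : injective opp_face.
Proof.
move=> i j /setP/(_ (vtx i)); rewrite !inE eqxx set_vtx_in andbT /= => h.
by apply: (@set_vtx_inj _ _ _ cardK); apply/eqP; move: h; case: (_ == _).
Qed.

(** A subset with [n.+1] of the [n.+2] vertices omits exactly one. *)
Lemma cell_facesE : cell_faces K = [set opp_face k | k : 'I_n.+2]%SET.
Proof.
apply/setP => e; rewrite inE; apply/andP/imsetP => [[eK /eqP ce]|[k _ ->]]; last first.
  by rewrite subsetDl card_opp_face.
have : (0 < #|K :\: e|)%N.
  by rewrite cardsD (finset.setIidPr eK) cardK ce subSnn.
rewrite card_gt0 => /set0Pn[v]; rewrite inE => /andP[ve vK].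
move: (vK); rewrite {1}(set_vtx_image cardK) => /imsetP[k _ vE].
exists k => //; apply/eqP; rewrite eqEcard card_opp_face ce leqnn andbT.
apply/fintype.subsetP => i ie; rewrite !inE (fintype.subsetP eK) // andbT -vE.
by apply: contraNneq ve => <-.
Qed.

Lemma sum_cell_faces (X : nmodType) (F : {set 'I_(mesh_nv T)} -> X) :
  \sum_(e in cell_faces K) F e = \sum_k F (opp_face k).
Proof. exact: sum_image_set opp_face_inj cell_facesE. Qed.

Lemma opp_face_image k : opp_face k = [set (vtx \o lift k) j | j : 'I_n.+1]%SET.
Proof.
apply/setP => i; rewrite !inE; apply/andP/imsetP => [[ik iK]|[j _ ->]].
  move: (iK); rewrite {1}(set_vtx_image cardK) => /imsetP[k' _ iE].
  have /unlift_some[j jE _] : k != k' by apply: contraNneq ik => ->; rewrite iE.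
  by exists j => //=; rewrite -jE.
by rewrite set_vtx_in (inj_eq (@set_vtx_inj _ _ _ _)) eq_sym neq_lift.
Qed.

Lemma vtx_lift_inj k : injective (vtx \o lift k).
Proof. by apply: inj_comp; [exact: set_vtx_inj | exact: lift_inj]. Qed.

Lemma geom_opp_face k : geom (opp_face k) = hull predT (cell_pt \o lift k).
Proof. exact: hull_image (@vtx_lift_inj k) (opp_face_image k). Qed.

Lemma opp_face_indep k : affine_indep predT (cell_pt \o lift k).
Proof. by apply: affine_indep_comp cell_pt_indep; exact: lift_inj. Qed.

(** [xget] returns a member of its set as soon as one exists; [outward_exists] provides it, once the
    only vertex outside the face is recognized as [vtx k]. *)
Lemma normal_outward k : outward cell_pt k (Defs.normal K (opp_face k)).
Proof.
have [v [v1 v2 v3]] := outward_exists k cell_pt_indep.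
have inv i : i \in K -> exists j, i = vtx j.
  by rewrite {1}(set_vtx_image cardK) => /imsetP[j _ ->]; exists j.
have inF j : (vtx j \in opp_face k) = (j != k).
  by rewrite !inE set_vtx_in andbT (inj_eq (@set_vtx_inj _ _ _ _)).
have sub i : i \in opp_face k -> exists2 j, j != k & i = vtx j.
  move=> ie; have [j jE] : exists j, i = vtx j.
    by apply: inv; move: ie; rewrite inE => /andP[].
  by exists j => //; rewrite -inF -jE.
pose Q := [set m : 'rV[R]_n.+1 | [/\ dot m m = 1,
    {in opp_face k &, forall i j, dot m (pt i - pt j) = 0} &
    forall i j, i \in K -> i \notin opp_face k -> j \in opp_face k ->
      dot m (pt i - pt j) < 0]].
have Qv : Q v.
  split => // [i j /sub[i' ik ->] /sub[j' jk ->]|i j /inv[i' ->]].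
    exact: v2.
  by rewrite inF negbK => /eqP -> /sub[j' jk ->]; exact: v3.
have [w1 w2 w3] : Q (Defs.normal K (opp_face k)) by exact: (xgetPex 0 (ex_intro _ v Qv)).
split => // [i j ik jk|i ik]; first by apply: w2; rewrite inF.
by apply: w3; rewrite ?inF ?eqxx ?set_vtx_in.
Qed.

Lemma face_int_simplex (e : {set 'I_(mesh_nv T)}) (ce : #|e| = n.+1) f :
  face_int e f = simplex_int (pt \o set_vtx ce) f.
Proof.
have vE (i : 'I_n.+1) : face_vertex e i = (pt \o set_vtx ce) i.
  rewrite /face_vertex /= /set_vtx /enum_val.
  rewrite (nth_map (enum_default (cast_ord (esym ce) i))) ?nth_enum // -cardE ce //.
have EE : face_edges e = edges (pt \o set_vtx ce).
  apply/row_matrixP => i; rewrite !rowK -(vE ord0) -(vE (lift ord0 i)).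
  by [].
by rewrite /face_int EE /simplex_int /param -(vE ord0).
Qed.

(** [face_int] uses the enumeration of the face itself, the cell its own enumeration with [k]
    skipped; [simplex_int_image] reconciles the two. *)
Lemma face_int_opp_face k f : continuous f ->
  face_int (opp_face k) f = simplex_int (cell_pt \o lift k) f.
Proof.
move=> cf; rewrite (face_int_simplex (card_opp_face k)).
apply: (simplex_int_image (P := pt) (a := vtx \o lift k)) => //.
- exact: vtx_lift_inj.
- exact: set_vtx_inj.
- move=> i; have := set_vtx_in (card_opp_face k) i.
  by rewrite {2}opp_face_image => /imsetP[j _ ->]; exists j.
- exact: opp_face_indep.
Qed.

Lemma divergence_cell (u : 'rV[R]_n.+1 -> 'rV[R]_n.+1) : (forall i, C1 (fun x => u x 0 i)) ->
  lint (geom K) (div u) =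
  \sum_(e in cell_faces K) face_int e (fun x => dot (u x) (Defs.normal K e)).
Proof.
move=> Cu; rewrite geom_cell sum_cell_faces.
rewrite (divergence_simplex cell_pt_indep Cu normal_outward); apply: eq_bigr => k _.
rewrite face_int_opp_face //.
by apply: continuous_sum => i _; apply: continuous_mul; [case: (Cu i) | exact: cst_continuous].
Qed.

End OneCell.

End Cells.

Lemma patch_rv_of_tuple {R : realType} n (A : set 'rV[R]_n) (f : 'rV[R]_n -> R) :
  (f \_ A) \o @rv_of_tuple R n = (f \o @rv_of_tuple R n) \_ (@rv_of_tuple R n @^-1` A).
Proof.
apply/funext => t; rewrite /= !patchE.
rewrite (_ : (t \in @rv_of_tuple R n @^-1` A) = (rv_of_tuple t \in A)); first by case: ifP.
by apply/idP/idP => /set_mem h; apply/mem_set.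
Qed.

(** * Cells of a triangulation up to null sets, and piecewise functions *)

Section Triangulation.
Context {R : realType} {n : nat} (T : mesh R n.+1) (Omega : set 'rV[R]_n.+1).
Hypotheses (hT : triangulates T Omega) (oO : open Omega).
Local Notation pt := (@mesh_pt R n.+1 T).
Local Notation rv := (@rv_of_tuple R _).
Implicit Types (K e : {set 'I_(mesh_nv T)}).

Let cardK K : K \in cells T -> #|K| = n.+2.
Proof. by case: hT => h _ _ _ /h[]. Qed.

Let indK K : K \in cells T -> affine_indep (mem K) pt.
Proof. by case: hT => h _ _ _ /h[]. Qed.

Lemma cell_face_opp K e (KT : K \in cells T) : e \in cell_faces K ->
  exists k, e = opp_face (cardK KT) k.
Proof. by rewrite (cell_facesE (cardK KT)) => /imsetP[k _ ->]; exists k. Qed.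

Lemma cell_face_in_faces K e : K \in cells T -> e \in cell_faces K -> e \in faces T.
Proof. by move=> KT eK; rewrite inE; apply/existsP; exists K; rewrite KT. Qed.

Lemma face_in_cell e : e \in faces T -> exists2 K, K \in cells T & e \in cell_faces K.
Proof. by rewrite inE => /existsP[K /andP[KT eK]]; exists K. Qed.

Lemma face_null e : e \in faces T -> rv_null (geom e).
Proof.
move=> /face_in_cell[K KT /(cell_face_opp KT)[k ->]].
rewrite geom_opp_face; apply: rv_null_face; apply: cell_pt_indep; exact: indK.
Qed.

(** Off this null set, points of cells are interior to them and points of cell interiors lie in
    [Omega]. *)
Definition skeleton : set 'rV[R]_n.+1 := \big[setU/set0]_(e in faces T) geom e.

Lemma skeletonP x : skeleton x <-> exists2 e, e \in faces T & geom e x.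
Proof.
rewrite /skeleton -bigcup_seq_cond; split=> [[e /= /andP[_ eT] ex]|[e eT ex]]; exists e => //=.
by rewrite mem_index_enum eT.
Qed.

Lemma skeleton_null : rv_null skeleton.
Proof. by apply: rv_null_bigcup => e; exact: face_null. Qed.

Lemma geom_measurable K : K \in cells T -> rv_measurable (geom K).
Proof. by move=> KT; rewrite (geom_cell (cardK KT)); exact: hull_measurable. Qed.

Lemma geom_bounded K : K \in cells T -> bounded_set (geom K).
Proof. by move=> KT; rewrite (geom_cell (cardK KT)); exact: hull_bounded. Qed.

Lemma interior_measurable (A : set 'rV[R]_n.+1) : rv_measurable A°.
Proof. by apply: open_rv_measurable; exact: open_interior. Qed.

Lemma cell_diff_interior K : K \in cells T -> geom K `\` (geom K)° `<=` skeleton.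
Proof.
move=> KT x [Kx nKx]; have iP := cell_pt_indep (cardK := cardK KT) (indK KT).
have := hull_sub_interior iP; rewrite -(geom_cell (cardK KT)) => /(_ _ Kx)[//|].
rewrite -bigcup_seq => -[k _ kx]; apply/skeletonP; exists (opp_face (cardK KT) k).
  by apply: (cell_face_in_faces KT); rewrite (cell_facesE (cardK KT)) imset_f.
by rewrite geom_opp_face.
Qed.

Lemma bdry_sub_skeleton : bdry Omega `<=` skeleton.
Proof.
case: hT => _ _ _ -> x [e /= [eT _] ex]; apply/skeletonP; by exists e.
Qed.

(** A cell lies in the closure of [Omega], so a point of it outside [Omega] is on the boundary,
    which is a union of mesh faces. *)
Lemma interior_diff_domain K : K \in cells T -> (geom K)° `\` Omega `<=` skeleton.
Proof.
move=> KT x [Kx nOx]; apply: bdry_sub_skeleton; split; last by move=> /interior_subset.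
case: hT => _ _ -> _; exists K => //; exact: interior_subset.
Qed.

Lemma open_not_null (U : set 'rV[R]_n.+1) : open U -> U !=set0 -> ~ rv_null U.
Proof.
move=> oU [x Ux] [mU U0].
have /nbhs_ballP[e /= e0] : nbhs x U by exact: open_nbhs_nbhs.
rewrite ball_cube // => eU.
have [_] := rv_null_sub (cube_measurable x e) eU (conj mU U0).
by rewrite lebn_cube // => -[] /eqP; rewrite expf_eq0 /= mulf_eq0 pnatr_eq0 /= gt_eqF.
Qed.

(** If a vertex of [K] is missing in [K'], conformity places the intersection in the opposite face
    of [K], a null set, while the intersection of the interiors is open. *)
Lemma interior_disjoint K K' x : K \in cells T -> K' \in cells T ->
  (geom K)° x -> (geom K')° x -> K = K'.
Proof.
move=> KT K'T Kx K'x; apply/eqP; rewrite eqEcard (cardK KT) (cardK K'T) leqnn andbT.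
apply: contraT => /fintype.subsetPn[v vK vK'].
move: (vK); rewrite {1}(set_vtx_image (cardK KT)) => /imsetP[k _ vE].
have sub : (geom K)° `&` (geom K')° `<=` geom (opp_face (cardK KT) k).
  move=> y [/interior_subset Ky /interior_subset K'y].
  have : geom (K :&: K')%SET y by case: hT => _ <-.
  apply: hullS; apply/fintype.subsetP => i; rewrite !inE => /andP[iK iK'].
  by rewrite iK andbT -vE; apply: contraNneq vK' => <-.
have oI : open ((geom K)° `&` (geom K')°) by apply: openI; exact: open_interior.
case: (open_not_null oI); first by exists x.
apply: rv_null_sub sub _; first exact: open_rv_measurable.
apply: face_null; apply: (cell_face_in_faces KT).
by rewrite (cell_facesE (cardK KT)) imset_f.
Qed.

Lemma piecewise_in (X : nmodType) (F : {set 'I_(mesh_nv T)} -> 'rV[R]_n.+1 -> X) K x :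
  K \in cells T -> (geom K)° x -> piecewise F x = F K x.
Proof.
move=> KT Kx; rewrite /piecewise (bigD1 K) /=; last by rewrite KT; exact/mem_set.
rewrite big1 ?addr0 // => K' /andP[/andP[K'T /set_mem K'x]] /eqP KK'.
by case: KK'; exact: (interior_disjoint K'T KT K'x Kx).
Qed.

Lemma piecewise_out (X : nmodType) (F : {set 'I_(mesh_nv T)} -> 'rV[R]_n.+1 -> X) x :
  (forall K, K \in cells T -> ~ (geom K)° x) -> piecewise F x = 0.
Proof.
by move=> h; rewrite /piecewise big1 // => K /andP[KT /set_mem Kx]; case: (h K KT).
Qed.

Lemma piecewise_cases x : (exists2 K, K \in cells T & (geom K)° x) \/
  (forall K, K \in cells T -> ~ (geom K)° x).
Proof.
have [[K KT Kx]|h] := pselect (exists2 K, K \in cells T & (geom K)° x); first by left; exists K.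
by right => K KT Kx; apply: h; exists K.
Qed.

Lemma restrict_integrable K (f : 'rV[R]_n.+1 -> R) : K \in cells T -> continuous f ->
  rv_integrable Omega (f \_ (geom K)°).
Proof.
move=> KT cf; have mO := open_rv_measurable oO; have mI := interior_measurable (geom K).
rewrite /rv_integrable.
rewrite patch_rv_of_tuple -restrict_EFin.
apply/integrable_restrict => //.
apply: (@rv_integrableS _ _ (geom K) (Omega `&` (geom K)°)).
- exact: geom_measurable.
- exact: measurableI.
- by move=> x [_ /interior_subset].
- by apply: continuous_rv_integrable => //; [exact: geom_measurable | exact: geom_bounded].
Qed.

(** [Omega] intersected with the open cell differs from the closed cell by a part of the
    skeleton. *)
Lemma lint_restrict K (f : 'rV[R]_n.+1 -> R) : K \in cells T -> continuous f ->
  lint Omega (f \_ (geom K)°) = lint (geom K) f.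
Proof.
move=> KT cf; have mO := open_rv_measurable oO; have mI := interior_measurable (geom K).
have mK := geom_measurable KT.
have iK : rv_integrable (geom K) f.
  by apply: continuous_rv_integrable => //; exact: geom_bounded.
have mOI : rv_measurable (Omega `&` (geom K)°) by exact: measurableI.
have iOI : rv_integrable (Omega `&` (geom K)°) f.
  by apply: (rv_integrableS mK mOI _ iK) => x [_ /interior_subset].
transitivity (lint (Omega `&` (geom K)°) f).
  rewrite /lint [RHS]Rintegral_mkcondr; apply: eq_Rintegral => t _.
  by rewrite -[RHS]/(((f \o rv) \_ (rv @^-1` (geom K)°)) t) -patch_rv_of_tuple.
apply: (lint_eq_null mOI mK skeleton_null) => // x.
  by move=> [[_ /interior_subset Kx] nKx].
move=> [Kx nx]; have [Ix|nIx] := pselect ((geom K)° x); last first.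
  exact: (cell_diff_interior KT).
apply: (interior_diff_domain KT); split => // Ox; exact: nx.
Qed.

Lemma piecewise_sum (f : {set 'I_(mesh_nv T)} -> 'rV[R]_n.+1 -> R) x :
  piecewise f x = \sum_(K in cells T) (f K \_ (geom K)°) x.
Proof.
rewrite /piecewise big_mkcondr; apply: eq_bigr => K _; by rewrite patchE.
Qed.

Lemma lint_piecewise (f : {set 'I_(mesh_nv T)} -> 'rV[R]_n.+1 -> R) :
  (forall K, K \in cells T -> continuous (f K)) ->
  lint Omega (piecewise f) = \sum_(K in cells T) lint (geom K) (f K).
Proof.
move=> cf; have mO := open_rv_measurable oO.
rewrite (_ : piecewise f = fun x => \sum_(K in cells T) (f K \_ (geom K)°) x); last first.
  by apply/funext => x; exact: piecewise_sum.
rewrite lint_sum //; last by move=> K KT; apply: restrict_integrable => //; exact: cf.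
by apply: eq_bigr => K KT; apply: lint_restrict => //; exact: cf.
Qed.

Lemma dot_piecewise m (F G : {set 'I_(mesh_nv T)} -> 'rV[R]_n.+1 -> 'rV[R]_m) x :
  dot (piecewise F x) (piecewise G x) = piecewise (fun K x => dot (F K x) (G K x)) x.
Proof.
have [[K KT Kx]|h] := piecewise_cases x; first by rewrite !(piecewise_in _ KT Kx).
by rewrite !(piecewise_out _ h) dot0l.
Qed.

Lemma ip_piecewise m (F G : {set 'I_(mesh_nv T)} -> 'rV[R]_n.+1 -> 'rV[R]_m) :
  (forall K, K \in cells T -> continuous (fun x => dot (F K x) (G K x))) ->
  ip Omega (piecewise F) (piecewise G) =
  \sum_(K in cells T) lint (geom K) (fun x => dot (F K x) (G K x)).
Proof.
move=> cFG; rewrite /ip -lint_piecewise //; apply: eq_lint => x _.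
exact: dot_piecewise.
Qed.

End Triangulation.

(** * Weak gradients *)

Section WeakGradient.
Context {R : realType}.

Lemma L2_indicator n (A : set 'rV[R]_n) (g : 'rV[R]_n -> R) : rv_measurable A -> bounded_set A ->
  continuous g -> (g \o @rv_of_tuple R n) \_ (@rv_of_tuple R n @^-1` A) \in Lfun (lebn R n) 2%:E.
Proof.
move=> mA bA cg; rewrite inE /=; apply/andP; split; apply: mem_set => /=.
  apply/(measurable_restrictT _ mA); apply: measurable_funTS.
  exact: continuous_rv_measurable.
rewrite /finite_norm unlock poweR_lty //.
have ig : rv_integrable A (fun x => g x * g x).
  by apply: continuous_rv_integrable => //; exact: continuous_mul.
have /(integrable_mkcond _ mA) /integrableP[_] := ig.
apply: le_lt_trans; rewrite le_eqVlt; apply/orP; left; apply/eqP.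
apply: eq_integral => t _ /=; rewrite !patchE; case: ifP => _ /=.
  by rewrite powR_mulrn // -normrX expr2.
(* Outside [A] the restriction takes the value [point], which is 0 in [R]. *)
by rewrite -[point]/(0 : R) normr0 powR0.
Qed.

Lemma L2_piecewise n (T : mesh R n.+1) (Omega : set 'rV[R]_n.+1)
    (f : {set 'I_(mesh_nv T)} -> 'rV[R]_n.+1 -> R) : triangulates T Omega -> open Omega ->
  (forall K, K \in cells T -> continuous (f K)) -> L2 Omega (piecewise f).
Proof.
move=> hT oO cf; rewrite /L2.
rewrite (_ : _ \_ _ = \sum_(K in cells T) (f K \o @rv_of_tuple R n.+1) \_
    (@rv_of_tuple R n.+1 @^-1` ((geom K)° `&` Omega))).
  elim/big_ind: _ => [|g h ghL hL|K KT].
  - by have [] := @Lfun_addr_closed _ _ _ (lebn R n.+1) 2%:E (ltac:(by rewrite lee_fin ler1n)).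
  - have [_ h2] := @Lfun_addr_closed _ _ _ (lebn R n.+1) 2%:E (ltac:(by rewrite lee_fin ler1n)).
    exact: h2.
  - apply: L2_indicator; [| |exact: cf].
      apply: measurableI; first exact: interior_measurable.
      exact: open_rv_measurable.
    have [M [Mr hM]] := geom_bounded hT KT; exists M; split => // r /hM h x [/interior_subset Kx _].
    exact: h.
apply/funext => t; rewrite fct_sumE -patch_rv_of_tuple /= patchE; case: ifP => tO.
  rewrite piecewise_sum; apply: eq_bigr => K _.
  rewrite -[RHS]/((((f K) \o _) \_ _) t) -patch_rv_of_tuple /= !patchE.
  rewrite (_ : (rv_of_tuple t \in (geom K)° `&` Omega) = (rv_of_tuple t \in ((geom K)° : set 'rV[R]_n.+1))) //.
  by rewrite in_setI tO andbT.
rewrite big1 // => K _.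
by rewrite -[LHS]/((((f K) \o _) \_ _) t) -patch_rv_of_tuple /= patchE in_setI tO andbF.
Qed.

(** Fredholm alternative for a symmetric matrix: the row space is the orthogonal complement of the
    kernel. *)
Lemma solve_symmetric N (A : 'M[R]_N) (b : 'rV[R]_N) : A^T = A ->
  (forall c : 'rV[R]_N, c *m A = 0 -> c *m b^T = 0) -> exists g : 'rV[R]_N, g *m A = b.
Proof.
move=> sA h; suff /submxP[g ->] : (b <= A)%MS by exists g.
rewrite submxE; apply/eqP; apply: trmx_inj; rewrite trmx0 trmx_mul.
apply/row_matrixP => i; rewrite row_mul row0; apply: h.
by rewrite -row_mul -{2}sA -trmx_mul mulmx_coker trmx0 row0.
Qed.

(** A spanning family suffices. It is indexed by a component and a table of exponents, and tables of
    total degree above [m] give the zero field, so it may be linearly dependent. *)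
Lemma polyvec_basis n l m : exists N (B : 'I_N -> 'rV[R]_n -> 'rV[R]_l),
  (forall s, polyvec m (B s)) /\ (forall phi : 'rV[R]_n -> 'rV[R]_l, polyvec m phi -> exists c : 'rV[R]_N,
    phi = fun x => \sum_s c 0 s *: B s x).
Proof.
pose I : finType := ('I_l * {ffun 'I_n -> 'I_m.+1})%type.
pose B0 (s : I) (x : 'rV[R]_n) : 'rV[R]_l := \row_i ((i == s.1)%:R *
   (if (\sum_i s.2 i <= m)%N then monom (fun i => s.2 i) x else 0)).
exists #|{: I}|, (fun s => B0 (enum_val s)); split => [s i|phi pphi].
  apply: (@eq_polyfun _ _ _ (fun x => (i == (enum_val s).1)%:R *
   (if (\sum_i (enum_val s).2 i <= m)%N then monom (fun i => (enum_val s).2 i) x else 0))).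
    by move=> x; rewrite mxE.
  apply: polyfunZ; case h : (\sum_i (enum_val s).2 i <= m)%N; last exact: polyfun0.
  exact: polyfun_monom.
have /choice[c cE] i : exists c : {ffun 'I_n -> 'I_m.+1} -> R, forall x,
    phi x 0 i = \sum_(a : {ffun 'I_n -> 'I_m.+1} | (\sum_i a i <= m)%N) c a * monom (fun i => a i) x.
  exact: pphi.
exists (\row_s c (enum_val s).1 (enum_val s).2); apply/funext => x; apply/rowP => i.
rewrite summxE (eq_bigr (fun s => (fun s : I => c s.1 s.2 * B0 s x 0 i) (enum_val s))); last first.
  by move=> s _; rewrite !mxE.
rewrite -(big_enum_val (A := {: I})
   (fun s : I => c s.1 s.2 * B0 s x 0 i)) /=.
rewrite (eq_bigl predT) // -(pair_bigA _ (fun j a => c j a * B0 (j, a) x 0 i)) /=.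
rewrite (bigD1 i) //= [X in _ + X]big1 => [|j ji]; last first.
  by apply: big1 => a _; rewrite mxE /= eq_sym (negbTE ji) mul0r mulr0.
rewrite addr0 cE big_mkcond; apply: eq_bigr => a _; rewrite mxE /= eqxx mul1r.
by case: ifP => // _; rewrite mulr0.
Qed.

Lemma polyvec_comb n l m N (B : 'I_N -> 'rV[R]_n -> 'rV[R]_l) (c : 'rV[R]_N) :
  (forall s, polyvec m (B s)) -> polyvec m (fun x => \sum_s c 0 s *: B s x).
Proof.
move=> pB i; apply: (@eq_polyfun _ _ _ (fun x => \sum_s c 0 s * B s x 0 i)).
  by move=> x; rewrite summxE; apply: eq_bigr => s _; rewrite mxE.
by apply: polyfun_sum => s _; apply: polyfunZ; exact: pB.
Qed.

Lemma continuous_dot n l (F G : 'rV[R]_n -> 'rV[R]_l) :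
  (forall i, continuous (fun x => F x 0 i)) -> (forall i, continuous (fun x => G x 0 i)) ->
  continuous (fun x => dot (F x) (G x)).
Proof. by move=> cF cG; apply: continuous_sum => i _; exact: continuous_mul. Qed.

Lemma polyvec_continuous n l m (F : 'rV[R]_n -> 'rV[R]_l) i : polyvec m F -> continuous (fun x => F x 0 i).
Proof. by move=> /(_ i)/polyfun_C1[]. Qed.

Section OneCell.
Context {n : nat} (T : mesh R n.+1) (K : {set 'I_(mesh_nv T)}).
Hypothesis cardK : #|K| = n.+2.
Hypothesis indK : affine_indep (mem K) (@mesh_pt R n.+1 T).
Local Notation V := 'rV[R]_n.+1.

Lemma card_cell_face e : e \in cell_faces K -> #|e| = n.+1.
Proof. by rewrite inE => /andP[_ /eqP]. Qed.

Lemma geom_cell_face e : e \in cell_faces K -> geom e `<=` geom K.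
Proof. by rewrite inE => /andP[eK _]; exact: hullS. Qed.

Lemma face_int_sum (e : {set 'I_(mesh_nv T)}) (I : Type) (r : seq I) (f : I -> V -> R) : #|e| = n.+1 ->
  (forall i, continuous (f i)) ->
  face_int e (fun x => \sum_(i <- r) f i x) = \sum_(i <- r) face_int e (f i).
Proof.
move=> ce cf; rewrite (face_int_simplex ce) (simplex_int_sum _ _ cf).
by apply: eq_bigr => i _; rewrite (face_int_simplex ce).
Qed.

Lemma face_intZ (e : {set 'I_(mesh_nv T)}) (c : R) (f : V -> R) : #|e| = n.+1 -> continuous f ->
  face_int e (fun x => c * f x) = c * face_int e f.
Proof. by move=> ce cf; rewrite !(face_int_simplex ce) (simplex_intZ _ _ cf). Qed.

Lemma face_int_eq0 (e : {set 'I_(mesh_nv T)}) (f : V -> R) : #|e| = n.+1 ->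
  (forall x, geom e x -> f x = 0) -> face_int e f = 0.
Proof.
move=> ce f0; rewrite (face_int_simplex ce) /simplex_int -(eq_lint (f := fun=> 0)).
  by rewrite lint0 mulr0.
move=> t rt; rewrite f0 // /geom (hull_image _ (@set_vtx_inj _ _ _ ce) (set_vtx_image ce)).
by rewrite hull_param; exists t.
Qed.

(** The surface element is nonzero and the parametrized integrand is nonnegative and continuous, so
    [lint_eq0] applies on the reference simplex. *)
Lemma face_int_sqr_eq0 e (f : V -> R) : e \in cell_faces K -> continuous f ->
  (forall x, 0 <= f x) -> face_int e f = 0 -> forall x, geom e x -> f x = 0.
Proof.
rewrite (cell_facesE cardK) => /imsetP[k _ ->] cf f0.
have iP : affine_indep predT (cell_pt cardK \o lift k) by exact: opp_face_indep.
pose P := cell_pt cardK \o lift k.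
rewrite face_int_opp_face // /simplex_int -/P => /eqP; rewrite mulf_eq0 => /orP[|/eqP h].
  (* The square root would vanish on negative numbers too, so the Gram determinant is written as a
     square by means of a normal. *)
  have [v ov] := outward_exists k (cell_pt_indep (cardK := cardK) indK).
  have := gram_unitmx ((affine_indep_row_free P).1 iP); rewrite unitmxE unitfE.
  have [v1 _ _] := ov; rewrite (gram_det_normal v1 (edges_normal ov)) sqrtr_sqr normr_eq0.
  by rewrite expf_eq0 /= => /negbTE ->.
move=> x; rewrite geom_opp_face hull_param => -[t rt <-].
apply: (lint_eq0 (D := @ref_simplex R n) (f := f \o param P)) => //.
- by move=> s; apply: (@continuous_comp _ _ _ (param P) f); [exact: param_continuous | exact: cf].
- by move=> s; exact: f0.
- exact: ref_simplex_measurable.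
- exact: ref_simplex_bounded.
- move=> s /ref_simplex_closure; apply: closureS.
  rewrite -open_subsetE; last exact: open_simplex_open.
  by move=> y [y0 y1]; split; [move=> i; exact: ltW | exact: ltW].
Qed.

End OneCell.

End WeakGradient.

(** * Existence of the weak gradient, and Green's formula on a cell *)

Section WeakGradientExistence.
Context {R : realType} {n : nat} (T : mesh R n.+1) (K : {set 'I_(mesh_nv T)}).
Hypothesis cardK : #|K| = n.+2.
Hypothesis indK : affine_indep (mem K) (@mesh_pt R n.+1 T).
Local Notation V := 'rV[R]_n.+1.
Local Notation nu e := (Defs.normal K e).

Lemma cell_measurable : rv_measurable (geom K).
Proof. by rewrite (geom_cell cardK); exact: hull_measurable. Qed.

Lemma cell_integrable (f : V -> R) : continuous f -> rv_integrable (geom K) f.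
Proof.
move=> cf; apply: continuous_rv_integrable => //; first exact: cell_measurable.
by rewrite (geom_cell cardK); exact: hull_bounded.
Qed.

Lemma cell_closure_interior : geom K `<=` closure (geom K)°.
Proof.
by rewrite (geom_cell cardK); apply: hull_closure_interior; exact: cell_pt_indep.
Qed.

Lemma cell_lint_eq0 (f : V -> R) : continuous f -> (forall x, 0 <= f x) ->
  lint (geom K) f = 0 -> forall x, geom K x -> f x = 0.
Proof.
move=> cf f0; apply: lint_eq0 => //; [exact: cell_measurable | | exact: cell_closure_interior].
by rewrite (geom_cell cardK); exact: hull_bounded.
Qed.

Lemma div_continuous m (phi : V -> V) : polyvec m phi -> continuous (div phi).
Proof. by move=> /polyfun_div/polyfun_C1[]. Qed.

Lemma div_comb m N (B : 'I_N -> V -> V) (c : 'rV[R]_N) x : (forall s, polyvec m (B s)) ->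
  div (fun x => \sum_s c 0 s *: B s x) x = \sum_s c 0 s * div (B s) x.
Proof.
move=> pB; rewrite /div; under [RHS]eq_bigr do rewrite mulr_sumr.
rewrite exchange_big /=; apply: eq_bigr => i _.
rewrite (_ : (fun y => _) = fun y => \sum_s c 0 s * B s y 0 i); last first.
  by apply/funext => y; rewrite summxE; apply: eq_bigr => s _; rewrite mxE.
rewrite pderiv_sum => [|s _]; last by apply: C1Z; exact: polyfun_C1 (pB s i).
by apply: eq_bigr => s _; rewrite pderivZ //; exact: polyfun_C1 (pB s i).
Qed.

(** The functional of [phi] on the right of [is_wgrad], named so that its linearity can be used. *)
Definition wgrad_rhs (q : wfun T R) (phi : V -> V) : R :=
  - lint (geom K) (fun x => wo q K x * div phi x) +
  \sum_(e in cell_faces K) face_int e (fun x => wb q e x * dot (phi x) (nu e)).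

Section Data.
Variables (m : nat) (q : wfun T R).
Hypothesis cqo : continuous (wo q K).
Hypothesis cqb : forall e, e \in cell_faces K -> continuous (wb q e).

Lemma dot_normal_continuous (phi : V -> V) (v : V) : polyvec m phi -> continuous (fun x => dot (phi x) v).
Proof.
move=> pphi; apply: continuous_dot => i; last exact: cst_continuous.
exact: polyvec_continuous pphi.
Qed.

Lemma wgrad_rhs_comb N (B : 'I_N -> V -> V) (c : 'rV[R]_N) : (forall s, polyvec m (B s)) ->
  wgrad_rhs q (fun x => \sum_s c 0 s *: B s x) = \sum_s c 0 s * wgrad_rhs q (B s).
Proof.
move=> pB; have cI s : continuous (fun x => wo q K x * div (B s) x).
  by apply: continuous_mul => //; exact: div_continuous (pB s).
rewrite /wgrad_rhs; under [RHS]eq_bigr do rewrite mulrDr mulrN mulr_sumr.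
rewrite big_split /= sumrN exchange_big /=; congr (- _ + _).
  rewrite (_ : (fun x => _) = fun x => \sum_s c 0 s * (wo q K x * div (B s) x)); last first.
    apply/funext => x; rewrite (div_comb _ _ pB) mulr_sumr.
    by apply: eq_bigr => s _; rewrite mulrCA.
  rewrite lint_sum; first last.
  - by move=> s _; apply: cell_integrable; exact: continuous_mull.
  - exact: cell_measurable.
  by apply: eq_bigr => s _; rewrite lintZ //; [exact: cell_measurable | exact: cell_integrable].
apply: eq_bigr => e eK; have ce := card_cell_face eK.
have cF s : continuous (fun x => wb q e x * dot (B s x) (nu e)).
  by apply: continuous_mul; [exact: cqb | exact: dot_normal_continuous].
rewrite (_ : (fun x => _) = fun x => \sum_s c 0 s * (wb q e x * dot (B s x) (nu e))); last first.
  apply/funext => x; rewrite dot_suml mulr_sumr.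
  by apply: eq_bigr => s _; rewrite dotZl mulrCA.
rewrite face_int_sum //; last by move=> s; exact: continuous_mull.
by apply: eq_bigr => s _; rewrite face_intZ.
Qed.

Lemma lint_dot_comb N (B : 'I_N -> V -> V) (c : 'rV[R]_N) (F : V -> V) :
  (forall s, polyvec m (B s)) -> polyvec m F ->
  lint (geom K) (fun x => dot (\sum_s c 0 s *: B s x) (F x)) =
  \sum_s c 0 s * lint (geom K) (fun x => dot (B s x) (F x)).
Proof.
move=> pB pF; have cI s : continuous (fun x => dot (B s x) (F x)).
  by apply: continuous_dot => i; [exact: polyvec_continuous (pB s) | exact: polyvec_continuous pF].
rewrite (_ : (fun x => _) = fun x => \sum_s c 0 s * dot (B s x) (F x)); last first.
  by apply/funext => x; rewrite dot_suml; apply: eq_bigr => s _; rewrite dotZl.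
rewrite lint_sum; first last.
- by move=> s _; apply: cell_integrable; exact: continuous_mull.
- exact: cell_measurable.
by apply: eq_bigr => s _; rewrite lintZ //; [exact: cell_measurable | exact: cell_integrable].
Qed.

(* Both terms of the right-hand side only see the values of [phi] on the cell. *)
Lemma wgrad_rhs_eq0 phi : polyvec m phi -> (forall x, geom K x -> phi x = 0) -> wgrad_rhs q phi = 0.
Proof.
move=> pphi phi0; rewrite /wgrad_rhs.
rewrite (_ : lint _ _ = 0) ?oppr0 ?add0r; last first.
  rewrite -(lint0 (geom K)); apply: eq_lint => x /cell_closure_interior Kx.
  (* The derivatives of [phi] are seen to vanish in the interior; closedness of the zero set of the
     integrand carries this to all of [K]. *)
  have cl : closed [set y | wo q K y * div phi y = 0].
    apply: (@closed_comp _ _ (fun y => wo q K y * div phi y) [set 0]); last exact: closed_eq.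
    by move=> y _; apply: continuous_mul => //; exact: div_continuous pphi.
  apply: (cl x); apply: closureS Kx => y Ky /=; rewrite /div big1 ?mulr0 // => i _.
  have nK : \forall z \near y, phi z 0 i = (cst 0 : V -> R) z.
    by apply: filterS Ky => z Kz; rewrite phi0 // mxE.
  by rewrite /pderiv (near_eq_derive _ nK) derive_cst.
rewrite big1 // => e eK; apply: (face_int_eq0 (card_cell_face eK)).
by move=> x /(geom_cell_face eK) Kx; rewrite phi0 // dot0l mulr0.
Qed.

(** The coefficients of the gradient solve a Gram system that can be singular. It is compatible: a
    kernel vector yields a field of zero norm on [K], hence zero there, on which the right-hand side
    vanishes. *)
Lemma wgrad_exists : exists G, is_wgrad m q K G.
Proof.
have [N [B [pB Bspan]]] := @polyvec_basis R n.+1 n.+1 m.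
pose A : 'M[R]_N := \matrix_(s, t) lint (geom K) (fun x => dot (B s x) (B t x)).
pose b : 'rV[R]_N := \row_s wgrad_rhs q (B s).
have sA : A^T = A.
  by apply/matrixP => s t; rewrite !mxE; apply: eq_lint => x _; rewrite dotC.
have [c cA|g gA] := solve_symmetric (b := b) sA.
  pose phi x := \sum_s c 0 s *: B s x.
  have pphi : polyvec m phi by exact: polyvec_comb.
  have phit t : lint (geom K) (fun x => dot (phi x) (B t x)) = 0.
    rewrite lint_dot_comb //; have /rowP/(_ t) := cA; rewrite !mxE => E; rewrite -[RHS]E.
    by apply: eq_bigr => s _; rewrite mxE.
  have phi2 : lint (geom K) (fun x => dot (phi x) (phi x)) = 0.
    rewrite /phi lint_dot_comb //; apply: big1 => s _.
    rewrite (_ : (fun x => _) = fun x => dot (phi x) (B s x)) ?phit ?mulr0 //.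
    by apply/funext => x; rewrite dotC.
  have phi0 x : geom K x -> phi x = 0.
    move=> Kx; apply: dot_eq0; apply: (cell_lint_eq0 _ _ phi2) Kx => [|y]; last exact: dot_ge0.
    by apply: continuous_dot => i; exact: polyvec_continuous pphi.
  apply/rowP => i; rewrite ord1 [RHS]mxE mxE -[RHS](wgrad_rhs_eq0 pphi phi0) wgrad_rhs_comb //.
  by apply: eq_bigr => s _; rewrite !mxE.
exists (fun x => \sum_s g 0 s *: B s x); split; first exact: polyvec_comb.
move=> phi /Bspan[c phiE]; rewrite -/(wgrad_rhs q phi) phiE wgrad_rhs_comb //.
have pG : polyvec m (fun x => \sum_s g 0 s *: B s x) by exact: polyvec_comb.
rewrite (_ : (fun x => _) = fun x => dot (\sum_s c 0 s *: B s x) (\sum_s g 0 s *: B s x)); last first.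
  by apply/funext => x; rewrite dotC.
rewrite lint_dot_comb //; apply: eq_bigr => s _; congr (_ * _).
have /rowP/(_ s) := gA; rewrite !mxE => <-.
rewrite (_ : (fun x => _) = fun x => dot (\sum_t g 0 t *: B t x) (B s x)); last first.
  by apply/funext => x; rewrite dotC.
by rewrite lint_dot_comb //; apply: eq_bigr => t _; rewrite mxE.
Qed.

Lemma wgradP : is_wgrad m q K (wgrad m q K).
Proof. by have [G GP] := wgrad_exists; exact: (xgetPex _ (ex_intro _ G GP)). Qed.

End Data.

(** [divergence_cell] for the product [phi *: u], combined with the product rule. *)
Lemma green_cell (phi : V -> R) (u : V -> V) : C1 phi -> (forall i, C1 (fun x => u x 0 i)) ->
  lint (geom K) (fun x => dot (u x) (grad phi x)) =
  - lint (geom K) (fun x => phi x * div u x) +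
  \sum_(e in cell_faces K) face_int e (fun x => phi x * dot (u x) (nu e)).
Proof.
move=> Cphi Cu; pose w x := phi x *: u x.
have wE i : (fun x => w x 0 i) = fun x => phi x * u x 0 i by apply/funext => x; rewrite mxE.
have Cw i : C1 (fun x => w x 0 i) by rewrite wE; exact: C1M.
have divE x : div w x = phi x * div u x + dot (u x) (grad phi x).
  rewrite /div mulr_sumr -big_split; apply: eq_bigr => i _ /=.
  by rewrite wE pderivM // mxE.
have cdiv : continuous (fun x => phi x * div u x).
  apply: continuous_mul; first by case: Cphi.
  by apply: continuous_sum => i _; case: (Cu i) => _ _; exact.
have cgrad : continuous (fun x => dot (u x) (grad phi x)).
  apply: continuous_dot => i; first by case: (Cu i).
  rewrite (_ : (fun x => _) = pderiv i phi); last by apply/funext => x; rewrite mxE.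
  by case: Cphi => _ _; exact.
have := divergence_cell cardK indK Cw.
rewrite (_ : div w = fun x => phi x * div u x + dot (u x) (grad phi x)); last exact/funext.
rewrite lintD; [|exact: cell_measurable|exact: cell_integrable|exact: cell_integrable].
move=> h; rewrite (eq_bigr (fun e => face_int e (fun x => dot (w x) (nu e)))).
  by rewrite -h addrA addNr add0r.
by move=> e _; congr face_int; apply/funext => x; rewrite dotZl.
Qed.

End WeakGradientExistence.

(** * Divergence-free fields *)

Section DivergenceFree.
Context {R : realType} {n : nat} (T : mesh R n.+1) (Omega : set 'rV[R]_n.+1).
Hypotheses (hT : triangulates T Omega) (oO : open Omega).
Local Notation V := 'rV[R]_n.+1.
Implicit Types (K e : {set 'I_(mesh_nv T)}).

Let cardK K : K \in cells T -> #|K| = n.+2.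
Proof. by case: hT => h _ _ _ /h[]. Qed.

Let indK K : K \in cells T -> affine_indep (mem K) (@mesh_pt R n.+1 T).
Proof. by case: hT => h _ _ _ /h[]. Qed.

Let card_face e : e \in faces T -> #|e| = n.+1.
Proof. by case/face_in_cell => K _ /card_cell_face. Qed.

(** Summing over all cells that have [e] as a face treats inner and boundary faces alike;
    neighbouring normals being opposite, the sum is a jump on inner faces. *)
Definition face_jump (v : wfun T V) e (x : V) : R :=
  \sum_(K in cells T | e \in cell_faces K) dot (wo v K x) (Defs.normal K e).

Section Field.
Variables (k : nat) (v : wfun T V).
Hypothesis pv : forall K, K \in cells T -> polyvec k (wo v K).

Lemma face_jump_polyfun e : polyfun k (face_jump v e).
Proof. by apply: polyfun_sum => K /andP[KT _]; exact: polyfun_dot (pv KT). Qed.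

Lemma face_jump_continuous e : continuous (face_jump v e).
Proof. by case: (polyfun_C1 (face_jump_polyfun e)). Qed.

(** The weight [g e] belongs to the face and not to the cell, so exchanging the two sums collects
    the normal traces into [face_jump]. *)
Lemma sum_face_int_jump (g : {set 'I_(mesh_nv T)} -> V -> R) : (forall e, continuous (g e)) ->
  \sum_(K in cells T) \sum_(e in cell_faces K)
    face_int e (fun x => g e x * dot (wo v K x) (Defs.normal K e)) =
  \sum_(e in faces T) face_int e (fun x => g e x * face_jump v e x).
Proof.
move=> cg; rewrite (exchange_big_dep (mem (faces T))) /=; last first.
  by move=> K e KT eK; exact: cell_face_in_faces KT eK.
apply: eq_bigr => e eT; rewrite big_mkcond /=.
(* Cells not adjacent to [e] are included with value 0, so that the sum runs over a fixed list and
   can leave the integral. *)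
pose F K x := if (K \in cells T) && (e \in cell_faces K) then
  g e x * dot (wo v K x) (Defs.normal K e) else 0.
rewrite (_ : (fun x => _ * _) = fun x => \sum_K F K x); last first.
  by apply/funext => x; rewrite /face_jump mulr_sumr big_mkcond.
rewrite (face_int_sum _ (card_face eT)) => [|K]; last first.
  rewrite /F; case E : ((K \in cells T) && _); last exact: cst_continuous.
  have /andP[KT _] := E.
  by apply: continuous_mul => //; exact: dot_normal_continuous (pv KT).
apply: eq_bigr => K _; rewrite /F; case: ((K \in cells T) && _) => //.
by rewrite (face_int_eq0 (card_face eT)).
Qed.

(** [wo v K] is polynomial of degree [k], hence admissible as [phi] in the definition of
    [wgrad k]. *)
Lemma ip_wgrad (q : wfun T R) :
  (forall K, K \in cells T -> continuous (wo q K)) -> (forall e, continuous (wb q e)) ->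
  ip Omega (piecewise (wgrad k q)) (piecewise (wo v)) =
  - \sum_(K in cells T) lint (geom K) (fun x => wo q K x * div (wo v K) x) +
  \sum_(e in faces T) face_int e (fun x => wb q e x * face_jump v e x).
Proof.
move=> cqo cqb; have P K (KT : K \in cells T) :=
  wgradP (cardK KT) (indK KT) k (cqo K KT) (fun e _ => cqb e).
rewrite ip_piecewise // => [|K KT]; last first.
  have [pG _] := P K KT.
  by apply: continuous_dot => i; [exact: polyvec_continuous pG | exact: polyvec_continuous (pv KT)].
rewrite -sum_face_int_jump // -sumrN -big_split; apply: eq_bigr => K KT.
by have [_ /(_ _ (pv KT))] := P K KT.
Qed.

(** With zero cell part, [ip_wgrad] becomes a vanishing sum of nonnegative integrals of squared
    jumps. The predicate [ok] selects the faces on which the test function may be nonzero. *)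
Lemma face_jump_eq0 (ok : pred {set 'I_(mesh_nv T)}) :
  ip Omega (piecewise (wgrad k (WFun (fun _ _ => 0) (fun e x => if ok e then face_jump v e x else 0) : wfun T R)))
     (piecewise (wo v)) = 0 ->
  forall e x, e \in faces T -> ok e -> geom e x -> face_jump v e x = 0.
Proof.
have cb e : continuous (fun x => if ok e then face_jump v e x else 0).
  by case: (ok e); [exact: face_jump_continuous | exact: cst_continuous].
rewrite ip_wgrad //=; last by move=> K _; exact: cst_continuous.
rewrite [X in - X]big1 ?oppr0 ?add0r => [|K _]; last first.
  by apply: lint0_eq => x _; rewrite mul0r.
have sq_ge0 e x : 0 <= (if ok e then face_jump v e x else 0) * face_jump v e x.
  by case: (ok e); rewrite ?mul0r // -expr2 sqr_ge0.
move=> /eqP; rewrite psumr_eq0 => [/allP h e x eT oke ex|e eT]; last first.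
  by rewrite /face_int mulr_ge0 ?sqrtr_ge0 // /lint Rintegral_ge0.
have [K KT eK] := face_in_cell eT.
have := h e (mem_index_enum _); rewrite eT /= => /eqP h0.
have := face_int_sqr_eq0 (cardK KT) (indK KT) eK _ (sq_ge0 e) h0 ex.
rewrite oke -expr2 => H; apply/eqP; rewrite -sqrf_eq0; apply/eqP; apply: H.
by apply: continuous_mul => //; exact: face_jump_continuous.
Qed.

(** With zero face part, [ip_wgrad] is minus the sum of the integrals of the squared divergences. *)
Lemma cell_div_eq0 :
  ip Omega (piecewise (wgrad k (WFun (fun K => div (wo v K)) (fun _ _ => 0) : wfun T R)))
     (piecewise (wo v)) = 0 ->
  forall K x, K \in cells T -> geom K x -> div (wo v K) x = 0.
Proof.
have cd K : K \in cells T -> continuous (div (wo v K)).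
  by move=> KT; exact: div_continuous (pv KT).
rewrite ip_wgrad //=; last by move=> e; exact: cst_continuous.
rewrite [X in _ + X]big1 ?addr0 => [|e eT]; last first.
  by apply: (face_int_eq0 (card_face eT)) => x _; rewrite mul0r.
move=> /eqP; rewrite oppr_eq0 psumr_eq0 => [/allP h K x KT Kx|K KT]; last first.
  by rewrite /lint Rintegral_ge0 // => t _; rewrite -expr2 sqr_ge0.
have := h K (mem_index_enum _); rewrite KT /= => /eqP h0.
apply/eqP; rewrite -sqrf_eq0 expr2; apply/eqP.
apply: (cell_lint_eq0 (cardK KT) (indK KT) (f := fun x => div (wo v K) x * div (wo v K) x)) => //.
- by apply: continuous_mul; exact: cd.
- by move=> y; rewrite -expr2 sqr_ge0.
Qed.

Lemma lint_piecewise_div :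
  (forall e x, e \in faces T -> geom e x -> face_jump v e x = 0) ->
  lint Omega (piecewise (fun K => div (wo v K))) = 0.
Proof.
move=> j0; rewrite (lint_piecewise hT oO) => [|K KT]; last exact: div_continuous (pv KT).
(* The constant weight 1 brings the cell divergences into the form of [sum_face_int_jump]. *)
rewrite (eq_bigr (fun K => \sum_(e in cell_faces K)
    face_int e (fun x => cst (1 : R) x * dot (wo v K x) (Defs.normal K e)))) => [|K KT].
  rewrite (sum_face_int_jump (g := fun=> cst 1)) => [|e]; last exact: cst_continuous.
  rewrite big1 // => e eT.
  by apply: (face_int_eq0 (card_face eT)) => x ex; rewrite j0 // mulr0.
rewrite (divergence_cell (cardK KT) (indK KT)) => [|i]; last exact: polyfun_C1 (pv KT i).
by apply: eq_bigr => e _; congr face_int; apply/funext => x; rewrite mul1r.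
Qed.

(** Faces off the boundary contribute nothing because of the jumps, boundary faces because of [phi],
    so one argument serves both fields. *)
Lemma piecewise_divergence_free :
  (forall K x, K \in cells T -> geom K x -> div (wo v K) x = 0) ->
  (forall e x, e \in faces T -> ~ (geom e `<=` bdry Omega) -> geom e x -> face_jump v e x = 0) ->
  Hdiv Omega (piecewise (wo v)) /\ weak_div Omega (piecewise (wo v)) (fun=> 0).
Proof.
move=> d0 j0; have W : weak_div Omega (piecewise (wo v)) (fun=> 0).
  move=> phi [Ckphi _ supp].
  have Cphi : C1 phi.
    have [cphi h] := Ckphi 1%N; split => // [j x|j]; last by case: (h j) => _ [].
    rewrite (_ : unit_row _ j = \row_(i < n.+1) (i == j)%:R); first by case: (h j).
    by apply/rowP => i; rewrite !mxE val_eqE.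
  have phi_out x : ~ Omega x -> phi x = 0.
    move=> nOx; apply/eqP/negP => /negP px; apply: nOx; apply: supp.
    exact: subset_closure.
  have cgrad i : continuous (fun x => grad phi x 0 i).
    rewrite (_ : (fun x => _) = pderiv i phi); last by apply/funext => x; rewrite mxE.
    by case: Cphi => _ _; exact.
  rewrite (_ : lint Omega (fun x => 0 * phi x) = 0) ?oppr0; last first.
    by apply: lint0_eq => x _; rewrite mul0r.
  have gradE x : Omega x -> dot (piecewise (wo v) x) (grad phi x) =
      piecewise (fun K x => dot (wo v K x) (grad phi x)) x.
    move=> _; have [[K KT Kx]|h] := piecewise_cases T x.
      by rewrite !(piecewise_in hT _ KT Kx).
    by rewrite !(piecewise_out _ h) dot0l.
  rewrite (eq_lint gradE) (lint_piecewise hT oO) => [|K KT]; last first.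
    by apply: continuous_dot => i //; exact: polyvec_continuous (pv KT).
  rewrite (eq_bigr (fun K => \sum_(e in cell_faces K)
      face_int e (fun x => phi x * dot (wo v K x) (Defs.normal K e)))) => [|K KT].
    rewrite (sum_face_int_jump (g := fun=> phi)) => [|e]; last by case: Cphi.
    rewrite big1 // => e eT; apply: (face_int_eq0 (card_face eT)) => x ex.
    have [eO|neO] := pselect (geom e `<=` bdry Omega); last by rewrite j0 // mulr0.
    (* The support of [phi] is inside [Omega], which as an open set is disjoint from
       [bdry Omega]. *)
    rewrite phi_out ?mul0r // => Ox; have [_ []] := eO _ ex.
    by apply: open_nbhs_nbhs.
  rewrite (green_cell (cardK KT) (indK KT)) // => [|i]; last exact: polyfun_C1 (pv KT i).
  rewrite [X in - X](_ : _ = 0) ?oppr0 ?add0r //.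
  by apply: lint0_eq => x Kx; rewrite d0 // mulr0.
split => //; split; last first.
  exists (fun=> 0); split => //; rewrite (_ : (fun=> 0) = piecewise (fun (K : {set 'I_(mesh_nv T)}) (_ : V) => 0 : R)).
    by apply: (L2_piecewise hT oO) => K _; exact: cst_continuous.
  by apply/funext => x; rewrite /piecewise big1.
move=> i; rewrite (_ : (fun x => _) = piecewise (fun K x => wo v K x 0 i)).
  by apply: (L2_piecewise hT oO) => K KT; exact: polyvec_continuous (pv KT).
apply/funext => x; have [[K KT Kx]|h] := piecewise_cases T x.
  by rewrite !(piecewise_in hT _ KT Kx).
by rewrite !(piecewise_out _ h) mxE.
Qed.

End Field.

End DivergenceFree.

(** * Test functions for the scheme, and the conclusion for both fields *)

Section WeakGalerkin.
Context {R : realType} {n : nat} (T : mesh R n.+1) (Omega : set 'rV[R]_n.+1).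
Local Notation V := 'rV[R]_n.+1.

Definition wf0 (X : nmodType) : wfun T X := WFun (fun _ _ => 0) (fun _ _ => 0).

Lemma polyvec0 l k : polyvec k (fun _ : V => 0 : 'rV[R]_l).
Proof. by move=> i; apply: eq_polyfun (polyfun0 k) => x; rewrite mxE. Qed.

Lemma Vh_wf0 k : Vh k (wf0 V).
Proof.
split=> [K _|e _ i]; first exact: polyvec0.
by exists (fun=> 0) => [|x _ /=]; [exact: polyfun0 | rewrite mxE].
Qed.

Lemma Vh0_wf0 k : Vh0 Omega k (wf0 V).
Proof. by split; [exact: Vh_wf0 |]. Qed.

Lemma cross0l d (w : 'rV[R]_d) : cross 0 w = 0.
Proof.
have co0 i : co (0 : 'rV[R]_d) i = 0 by rewrite /co; case: insub => // j; rewrite mxE.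
by apply/rowP => i; rewrite !mxE !co0 !mul0r subrr if_same.
Qed.

Lemma Wh0_wf0 k : Wh0 Omega k (wf0 V).
Proof. by split; [exact: Vh_wf0 | move=> K e _ _ _ x _; exact: cross0l]. Qed.

Lemma Qh_poly k (q : wfun T R) : (forall K, K \in cells T -> polyfun k.-1 (wo q K)) ->
  (forall e, polyfun k (wb q e)) -> Qh k q.
Proof. by move=> qo qb; split => // e _; exists (wb q e). Qed.

(** Dimension [n.+1] is the form in which the reference simplex splits off one coordinate and faces
    have dimension [n]. *)
Theorem WG_divergence_free (Ha N Rm : R) f g k (u B : wfun T V) (p r : wfun T R) :
  triangulates T Omega -> open Omega -> 0 < Rm -> WG_solution Omega k Ha N Rm f g u B p r ->
  (Hdiv Omega (piecewise (wo u)) /\ weak_div Omega (piecewise (wo u)) (fun=> 0)) /\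
  (Hdiv Omega (piecewise (wo B)) /\ weak_div Omega (piecewise (wo B)) (fun=> 0)).
Proof.
move=> hT oO Rm0 [[[pu _] _] [[pB _] _] _ _ sol].
have pw0 (q : {set 'I_(mesh_nv T)} -> V -> R) : (forall K, K \in cells T -> continuous (q K)) ->
  L2 Omega (piecewise q) by exact: L2_piecewise.
(* With zero cell part the condition of zero mean is immediate, and it does not constrain the face
   part. *)
have Qh00 (q : wfun T R) : (forall K, wo q K = fun=> 0) -> Qh k q -> Qh0 Omega k q.
  move=> q0 hq; split => //; split; first by apply: pw0 => K _; rewrite q0; exact: cst_continuous.
  apply: lint0_eq => x _.
  by rewrite /piecewise big1 // => K _; rewrite q0.
have Qh0_wf0 : Qh0 Omega k (wf0 R).
  by apply: Qh00 => //; apply: Qh_poly => *; exact: polyfun0.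
have Rh0_wf0 : Rh0 Omega k (wf0 R).
  by split => //; apply: Qh_poly => *; exact: polyfun0.
have ip0 (v : wfun T V) : (forall K, K \in cells T -> polyvec k (wo v K)) ->
    ip Omega (piecewise (wgrad k (wf0 R))) (piecewise (wo v)) = 0.
  move=> pv; rewrite (ip_wgrad hT oO pv); last 2 first.
  - by move=> K _; exact: cst_continuous.
  - by move=> e; exact: cst_continuous.
  rewrite !big1 ?oppr0 ?addr0 // => [e eT|K KT].
    have [K KT eK] := face_in_cell eT.
    by apply: (face_int_eq0 (card_cell_face eK)) => x _; rewrite mul0r.
  by apply: lint0_eq => x _; rewrite mul0r.
have sol00 (q th : wfun T R) := sol _ _ q th (Vh0_wf0 k) (Wh0_wf0 k).
(* with zero test functions [v] and [w] only the terms in [q] and [theta] vary *)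
have bu (q : wfun T R) : Qh0 Omega k q -> ip Omega (piecewise (wgrad k q)) (piecewise (wo u)) = 0.
  move=> hq; rewrite -(ip0 _ pu).
  have := etrans (sol00 _ _ hq Rh0_wf0) (esym (sol00 _ _ Qh0_wf0 Rh0_wf0)).
  (* Five terms follow [bh u q] in the scheme; they and the terms before it are common to both
     instances. *)
  by do 5 move/addIr; move/addrI/oppr_inj.
have bB (th : wfun T R) : Rh0 Omega k th -> ip Omega (piecewise (wgrad k th)) (piecewise (wo B)) = 0.
  move=> hth; rewrite -(ip0 _ pB).
  have := etrans (sol00 _ _ Qh0_wf0 hth) (esym (sol00 _ _ Qh0_wf0 Rh0_wf0)).
  (* Here three terms follow, and the factor [1 / Rm] is cancelled because [Rm] is positive. *)
  do 3 move/addIr; move/addrI/oppr_inj; apply: mulfI.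
  by rewrite mul1r invr_eq0 gt_eqF.
split.
- have j0 e x : e \in faces T -> geom e x -> face_jump u e x = 0.
    move=> eT; apply: (face_jump_eq0 hT oO pu (ok := predT)) => //.
    apply: bu; apply: Qh00 => //; apply: Qh_poly => [K _|e']; first exact: polyfun0.
    exact: face_jump_polyfun.
  apply: (piecewise_divergence_free hT oO pu) => [|e x eT _]; last exact: j0.
  apply: (cell_div_eq0 hT oO pu); apply: bu; split.
    by apply: Qh_poly => [K KT|e]; [exact: polyfun_div (pu K KT) | exact: polyfun0].
  split; last exact: (lint_piecewise_div hT oO pu j0).
  by apply: pw0 => K KT; exact: div_continuous (pu K KT).
- apply: (piecewise_divergence_free hT oO pB).
    apply: (cell_div_eq0 hT oO pB); apply: bB; split => //.
    by apply: Qh_poly => [K KT|e]; [exact: polyfun_div (pB K KT) | exact: polyfun0].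
  (* Membership in [Rh0] forces the face part to vanish on boundary faces. *)
  move=> e x eT neO; pose ok (e : {set 'I_(mesh_nv T)}) := ~~ `[< geom e `<=` bdry Omega >].
  apply: (face_jump_eq0 hT oO pB (ok := ok)) => //; last exact/asboolPn.
  apply: bB; split.
    apply: Qh_poly => [K _|e']; first exact: polyfun0.
    by rewrite /=; case: (ok e'); [exact: face_jump_polyfun | exact: polyfun0].
  by move=> e' _ eO y _ /=; rewrite /ok asboolT.
Qed.

End WeakGalerkin.

Theorem theorem3p1 (R : realType) (d : nat) (hd : d = 2%N \/ d = 3%N)
    (Omega : set 'rV[R]_d) (hOmega : polyhedral_domain Omega)
    (Ha N Rm : R) (hHa : 0 < Ha) (hN : 0 < N) (hRm : 0 < Rm)
    (f g : 'rV[R]_d -> 'rV[R]_d) (hf : L2vec Omega f) (hg : L2vec Omega g)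
    (Th : mesh R d) (hTh : triangulates Th Omega)
    (sigma : R) (hsigma : 0 < sigma) (hreg : shape_regular Th sigma)
    (k : nat) (hk : (1 <= k)%N)
    (u B : wfun Th 'rV[R]_d) (p r : wfun Th R)
    (hsol : WG_solution Omega k Ha N Rm f g u B p r) :
  (Hdiv Omega (piecewise (wo u)) /\ weak_div Omega (piecewise (wo u)) (fun=> 0)) /\
  (Hdiv Omega (piecewise (wo B)) /\ weak_div Omega (piecewise (wo B)) (fun=> 0)).
Proof.
have oO : open Omega by case: hOmega.
by case: hd => ?; subst d; exact: WG_divergence_free hTh oO hRm hsol.
Qed.
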